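(* (Fundamental Lemma.) Let $F$ be a non-archimedean local field of arbitrary characteristic, $E/F$ an unramified separable quadratic algebra (the unramified quadratic field extension, or $F\oplus F$), $\mathcal E=\{T_{E/F},\varepsilon_{E/F}\}$, $\kappa=\varepsilon_{E/F}$, and let $f$ be the characteristic function of $K=SL(2,\mathfrak O_F)$. With transfer factor normalized by the constant $1$, $$t\mapsto f^{\mathcal E}(t)=\Delta^{\mathcal E}(t)\,\mathcal O^\kappa(t,f)$$ (defined for regular $t$ and extended smoothly to $T_{E/F}(F)$) is the characteristic function of $T_{E/F}(\mathfrak O_F)=\mathfrak O_E^1$, the subgroup of elements of norm $1$ in $\mathfrak O_E^\times$.
   Context: $F$ is a non-archimedean local field with ring of integers $\mathfrak O_F$ and normalized absolute value $|\cdot|_F$. $\mathfrak O_E$ is the ring of integers of $E$ ($\mathfrak O_F\oplus\mathfrak O_F$ if $E=F\oplus F$); $x\mapsto\overline x$ is the nontrivial $F$-automorphism of $E$, $N_{E/F}(x)=x\overline x$, and $|x|:=|N_{E/F}(x)|_F^{1/2}$ on $E^\times$. $\varepsilon_{E/F}:F^\times\to\{\pm1\}$ is the character with kernel $N_{E/F}E^\times$. Choose $\tau\in E^\times$ with $\mathfrak O_E=\mathfrak O_F\oplus\mathfrak O_F\tau$. Multiplication on $E$ in the basis $\{1,\tau\}$ embeds $E^\times$ in $GL(2,F)$ with image $\widetilde T(F)$; $T_{E/F}(F)=\widetilde T(F)\cap SL(2,F)$ is the group of norm-one elements of $E^\times$. For $t\ne\pm1$ in $T_{E/F}(F)$, corresponding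 to $\gamma=a+b\tau$, $$\mathcal O^\kappa(t,f)=\int_{\widetilde T(F)\backslash GL(2,F)}\kappa(\det x)f(x^{-1}tx)\,dx,\qquad \Delta^{\mathcal E}(t)=\varepsilon_{E/F}\Big(\frac{\gamma-\overline\gamma}{\tau-\overline\tau}\Big)|\gamma-\overline\gamma|.$$ The measure on $\widetilde T(F)\backslash GL(2,F)$ is the right-invariant one extending the quotient measure on the open subset $T_{E/F}(F)\backslash SL(2,F)$, for the Haar measures giving volume $1$ to $SL(2,\mathfrak O_F)$ and to $T_{E/F}(\mathfrak O_F)$. *)

(* Defs.v *)
From HB Require Import structures.
From mathcomp Require Import all_boot all_order all_algebra.
From mathcomp Require Import all_classical all_reals all_analysis.

Set Implicit Arguments.
Unset Strict Implicit.
Unset Printing Implicit Defensive.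

Import Order.TTheory GRing.Theory Num.Theory.
Import numFieldNormedType.Exports.

Local Open Scope classical_set_scope.
Local Open Scope ring_scope.

(* A non-archimedean local field of any characteristic: a field complete for an
   ultrametric absolute value with discrete value group and finite residue
   field.  In the last axiom, [p] is a uniformizer and [s] lists one
   representative of each residue class, so that [size s] is the residue
   cardinality q; [absF p = q^-1] says that the absolute value is the normalized
   one (and, as q > 1, that it is non-trivial).
   The library's normed Z-modules satisfy |x *+ n| = |x| *+ n, so they cannot be
   used here. *)
HB.mixin Record isNALocal (R : realType) F & GRing.Field F := {
  absF : F -> R ;
  absF_ge0 : forall x, 0 <= absF x ;
  absF_eq0 : forall x, absF x = 0 <-> x = 0 ;
  absFM : forall x y, absF (x * y) = absF x * absF y ;
  absF_ultra : forall x y, absF (x + y) <= Num.max (absF x) (absF y) ;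
  absF_complete : forall u : nat -> F,
    (forall e : R, 0 < e -> exists N : nat, forall m n,
       (N <= m)%N -> (N <= n)%N -> absF (u m - u n) < e) ->
    exists l : F, forall e : R, 0 < e -> exists N : nat, forall n,
       (N <= n)%N -> absF (u n - l) < e ;
  absF_residue : exists (p : F) (s : seq F),
    [/\ absF p < 1 /\ (forall x, absF x < 1 -> absF x <= absF p),
        forall x, x \in s -> absF x <= 1,
        uniq s /\
          (forall x y, x \in s -> y \in s -> absF (x - y) < 1 -> x = y),
        forall x, absF x <= 1 -> exists2 y, y \in s & absF (x - y) < 1
      & absF p = (size s)%:R^-1]
}.

#[short(type="naLocalFieldType")]
HB.structure Definition NALocalField (R : realType) :=
  {F of GRing.Field F & isNALocal R F}.

Section Topology.
Context {R : realType} (F : naLocalFieldType R).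

Let dist (x y : F) : R := absF (x - y).

Let distxx x : dist x x = 0.
Proof. by rewrite /dist subrr; apply/absF_eq0. Qed.

Let dist_eq0 x y : dist x y = 0 -> x = y.
Proof. by move=> /absF_eq0/eqP; rewrite subr_eq0 => /eqP. Qed.

Let absF1 : absF (1 : F) = 1 :> R.
Proof.
have n0 : absF (1 : F) != 0 :> R.
  by apply/eqP => /absF_eq0/eqP; rewrite oner_eq0.
by apply: (mulfI n0); rewrite -absFM !mulr1.
Qed.

Let absFN1 : absF (-1 : F) = 1 :> R.
Proof.
apply/eqP; rewrite -(@eqrXn2 _ 2) ?absF_ge0// expr1n expr2 -absFM.
by rewrite mulrNN mulr1 absF1.
Qed.

Let dist_sym x y : dist x y = dist y x.
Proof. by rewrite /dist -opprB -mulN1r absFM absFN1 mul1r. Qed.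

Let dist_triangle y x z : dist x z <= dist x y + dist y z.
Proof.
rewrite /dist -(subrKA y x); apply: le_trans (absF_ultra _ _) _.
by rewrite ge_max lerDl lerDr !absF_ge0.
Qed.

HB.instance Definition _ :=
  isMetric.Build R F distxx dist_eq0 dist_sym dist_triangle.
HB.instance Definition _ := isPointed.Build F 0.

End Topology.

Section QuadraticAlgebra.
Context {R : realType} {F : naLocalFieldType R}.

Definition integersF : set F := [set a | absF a <= 1].

Context {E : comUnitAlgType F}.

(* The element of F with image z in E (meaningful only for z in F). *)
Definition toF (z : E) : F := xget 0 [set a : F | a%:A = z].

Definition is_split : Prop :=
  exists phi : {lrmorphism E -> (F^o * F^o)%type}, bijective phi.

Definition is_field : Prop := forall x : E, x != 0 -> x \is a GRing.unit.

Definition quadratic : Prop :=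
  exists w : E, forall x : E, exists! ab : F * F, x = ab.1%:A + ab.2 *: w.

Variable conj : {lrmorphism E -> E}.

Definition normEF (x : E) : F := toF (x * conj x).

Definition absE (x : E) : R := Num.sqrt (absF (normEF x)).

(* In the field case, a quadratic extension with a non-trivial automorphism is
   Galois, hence separable; unramified means that E and F have the same value
   group (residue fields are finite, hence perfect).  In both cases [conj] is
   the only non-trivial F-automorphism, the swap if E = F x F. *)
Definition unramified_quadratic : Prop :=
  [/\ bijective conj, exists x, conj x != x &
      is_split \/
      [/\ is_field, quadratic &
          forall x : E, x != 0 ->
            exists2 y : F, y != 0 & absE x = absF y]].

(* The valuation ring of E if E is a field, O_F x O_F if E = F x F. *)
Definition integersE : set E :=
  [set x | (is_field /\ absE x <= 1) \/
           exists phi : {lrmorphism E -> (F^o * F^o)%type},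
             [/\ bijective phi, integersF (phi x).1 & integersF (phi x).2]].

(* Elements of norm 1 in the unit group of the ring of integers. *)
Definition integersE1 : set E :=
  [set x | [/\ x \is a GRing.unit, integersE x, integersE x^-1
             & normEF x = 1]].

(* O_E = O_F (+) O_F tau, with tau invertible in E *)
Definition integral_generator (tau : E) : Prop :=
  [/\ tau \is a GRing.unit,
      integersE =
        [set x | exists a b, [/\ integersF a, integersF b
                                & x = a%:A + b *: tau]]
    & forall a b : F, a%:A + b *: tau = 0 -> a = 0 /\ b = 0].

(* The character of F^* with values +-1 and kernel N(E^* ). *)
Definition eps (a : F) : R :=
  if `[< exists2 x : E, x \is a GRing.unit & normEF x = a >] then 1 else -1.

Variable tau : E.

(* Matrix of the multiplication by g in the basis (1, tau); the columns are the
   coordinates of g * 1 and g * tau. *)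
Definition mulmat (g : E) : 'M[F]_2 :=
  xget 0 [set M : 'M[F]_2 | g = (M 0 0)%:A + M 1 0 *: tau /\
                  g * tau = (M 0 1)%:A + M 1 1 *: tau].

Definition GL2 : set 'M[F]_2 := [set x | x \in unitmx].
Definition SL2 : set 'M[F]_2 := [set x | \det x = 1].
Definition SL2O : set 'M[F]_2 :=
  [set x | SL2 x /\ forall i j, integersF (x i j)].

Definition torusGL : set 'M[F]_2 :=
  [set mulmat g | g in [set g : E | g \is a GRing.unit]].
Definition torus : set 'M[F]_2 := torusGL `&` SL2.
Definition torusO : set 'M[F]_2 := [set mulmat g | g in integersE1].

(* Delta^E for the transfer constant 1. *)
Definition transfer_factor (g : E) : R :=
  eps (toF ((g - conj g) / (tau - conj tau))) * absE (g - conj g).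

End QuadraticAlgebra.

Arguments integersE {R F E} conj.
Arguments integersE1 {R F E} conj.
Arguments GL2 {R F}.
Arguments SL2 {R F}.
Arguments SL2O {R F}.

(* Borel sigma-algebra.  Measures on a closed subgroup G of GL(2,F) are
   represented by Borel measures on 'M[F]_2, of which only the values on subsets
   of G are used; similarly for coset spaces. *)
Definition borel (X : ptopologicalType) := g_sigma_algebraType (@open X).

Section Measures.
Context {R : realType} {F : naLocalFieldType R}.
Local Notation M2 := 'M[F]_2.

(* Borel measures on G with these properties are Radon, since G is second
   countable. *)
Definition is_haar (G : set M2) (mu : {measure set (borel M2) -> \bar R}) :=
  [/\ forall (g : M2) (A : set (borel M2)), G g -> measurable A -> A `<=` G ->
        mu [set g *m x | x in A] = mu A,
      forall C : set M2, compact C -> C `<=` G -> (mu C < +oo)%E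
    & mu G <> 0%E].

Section Cosets.
Variable H : set M2.

(* x ~ y iff H x = H y *)
Definition same_coset (x y : M2) : bool :=
  `[< [set h *m x | h in H] = [set h *m y | h in H] >].

Lemma same_coset_equiv : equiv_class_of same_coset.
Proof.
split.
- by move=> x; apply/asboolP.
- by move=> x y; apply/asboolP/asboolP => ->.
- by move=> y x z /asboolP xy /asboolP yz; apply/asboolP; rewrite xy.
Qed.

Canonical same_coset_rel := EquivRelPack same_coset_equiv.

(* H \ M2 with the quotient topology.  If H is a subgroup of G then H \ G is
   its subspace [cosets G], the image of G, and [rep c] is in G for every c in
   [cosets G]. *)
Definition coset_space : ptopologicalType :=
  quotient_topology {eq_quot same_coset_rel}%qT.

Definition coset (x : M2) : coset_space :=
  (\pi_({eq_quot same_coset_rel}) x)%qT.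

Definition rep (c : coset_space) : M2 :=
  repr (c : {eq_quot same_coset_rel}%qT).

Definition cosets (G : set M2) : set coset_space := coset @` G.

Definition right_translate (g : M2) (A : set coset_space) : set coset_space :=
  coset @` [set x *m g | x in coset @^-1` A].

Definition right_invariant (G : set M2)
    (mu : {measure set (borel coset_space) -> \bar R}) : Prop :=
  forall (g : M2) (A : set (borel coset_space)),
    G g -> measurable A -> A `<=` cosets G ->
    mu (right_translate g A) = mu A.

(* nu is the quotient on H \ G of the Haar measures muG and muH, for G and H
   unimodular:
     int_G phi(x) dx = int_(H \ G) (int_H phi(s x) ds) dx
   for phi continuous with compact support on G. *)
Definition is_quotient_measure (G : set M2)
    (muG muH : {measure set (borel M2) -> \bar R})
    (nu : {measure set (borel coset_space) -> \bar R}) : Prop :=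
  forall phi : M2 -> R,
    {within G, continuous phi} ->
    (exists C : set M2, [/\ compact C, C `<=` G
                          & forall x, G x -> ~ C x -> phi x = 0]) ->
    (\int[muG]_(x in G) (phi x)%:E =
     \int[nu]_(c in cosets G) \int[muH]_(s in H) (phi (s *m rep c))%:E)%E.

End Cosets.

Arguments coset H x : clear implicits.
Arguments rep {H} c.
Arguments cosets H G : clear implicits.

(* For H = H' :&: G, the natural map H \ G -> H' \ G' identifies H \ G with a
   subset of H' \ G', on which mu restricts to nu. *)
Definition extends_measure (H H' G : set M2)
    (nu : {measure set (borel (coset_space H)) -> \bar R})
    (mu : {measure set (borel (coset_space H')) -> \bar R}) : Prop :=
  forall A : set (borel (coset_space H)),
    measurable A -> A `<=` cosets H G ->
    mu (coset H' @` (G `&` coset H @^-1` A)) = nu A.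

Context {E : comUnitAlgType F}.
Variables (conj : {lrmorphism E -> E}) (tau : E).

(* The kappa-orbital integral, for kappa = eps_(E/F). *)
Definition orbital_integral
    (mu : {measure set (borel (coset_space (torusGL tau))) -> \bar R})
    (t : M2) (f : M2 -> R) : \bar R :=
  (\int[mu]_(c in cosets (torusGL tau) GL2)
     (eps conj (\det (rep c)) * f (invmx (rep c) *m t *m rep c))%:E)%E.

(* fE : T(F) -> R (given by a function on matrices of which only the values on
   T(F) are used) is locally constant and is equal to
   t |-> Delta^E(t) * O^kappa(t, f) for t <> +-1. *)
Definition is_smooth_transfer
    (mu : {measure set (borel (coset_space (torusGL tau))) -> \bar R})
    (f fE : M2 -> R) : Prop :=
  (forall t, torus tau t ->
     \forall s \near t, torus tau s -> fE s = fE t) /\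
  (forall g : E, g \is a GRing.unit -> torus tau (mulmat tau g) ->
     mulmat tau g <> 1%:M -> mulmat tau g <> - 1%:M ->
     (fE (mulmat tau g))%:E =
       ((transfer_factor conj tau g)%:E
          * orbital_integral mu (mulmat tau g) f)%E).

End Measures.

(* Main.v *)
Require Import Defs.
From HB Require Import structures.
From mathcomp Require Import all_boot all_order all_algebra.
From mathcomp Require Import all_classical all_reals all_analysis.
From mathcomp Require Import measurable_realfun ring zify.

Import Order.TTheory GRing.Theory Num.Theory.
Import numFieldNormedType.Exports.

Set Implicit Arguments.
Unset Strict Implicit.
Unset Printing Implicit Defensive.

Local Open Scope classical_set_scope.
Local Open Scope ring_scope.

(* A coset of the torus in GL(2, F) modulo GL(2, O) is a lattice L of E up to
   E^*; its order is O_F + p^n tau O_F for a level n, and t = a + b tau of norm 1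
   with a, b integral stabilizes L iff n <= m, where |b| = |p|^m.  As eps(det x)
   is kap^n on level n, with kap = eps(p), the orbital integral is the sum over
   n <= m of kap^n times the measure of level n.  Level 0 is the image of K, of
   measure 1.  The other measures follow from right invariance by counting the
   edges between two consecutive levels of the tree of lattices: a lattice of
   level 0 has q - kap neighbours of level 1, and one of level n > 0 has q
   neighbours of level n + 1 and one of level n - 1.  Hence level n > 0 has
   measure (q - kap) q^(n-1), the sum is (kap q)^m, and it cancels against the
   transfer factor kap^m q^-m.  At t = 1 and t = -1 one concludes by local
   constancy, since regular elements accumulate there. *)

(** * Absolute values and residues *)

(** Origin of the neighbour counts: the neighbours of a lattice $L$ correspond to the $q+1$ lines of
    $L/pL$, and from level $n$ the level rises exactly along the lines not stable under the
    reduction of $p^n\tau$. At level 0 this reduction has the characteristic polynomial of $\tau$,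
    hence $1+\kappa$ stable lines with $\kappa=$ [kap] (two if split, none if inert). At level $n>0$
    it is nilpotent and non-zero, with a single stable line, along which the level drops. The sign
    of $\det x$ comes from the identity $N(z)=\det(z,\tau z)$ for a column $z$ of $x$: up to a norm,
    $\det x$ is the inverse of an off-diagonal entry of the matrix of $\tau$ in the basis $x$.
    Comparison with $SL(2)$ serves at level 0 only. Its lattices are free over $O_E$, and since
    every unit of $F$ is a norm from $O_E$, each coset contains an element of $K$ and not merely of
    $GL(2,O)$. This surjectivity, in every residue characteristic including 2, is what the
    pigeonhole and Hensel arguments are for. *)

Section AbsoluteValue.
Context {R : realType} {F : naLocalFieldType R}.
Implicit Types x y z : F.

Lemma absF0 : absF (0 : F) = 0.
Proof. exact/absF_eq0. Qed.

Lemma absF_neq0 x : (absF x != 0) = (x != 0).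
Proof. by congr (~~ _); apply/eqP/eqP => /absF_eq0. Qed.

Lemma absF_gt0 x : (0 < absF x) = (x != 0).
Proof. by rewrite lt0r absF_ge0 andbT absF_neq0. Qed.

Lemma absF1 : absF (1 : F) = 1.
Proof. by apply: (mulfI (_ : absF (1 : F) != 0)); rewrite ?absF_neq0 ?oner_eq0// -absFM !mulr1. Qed.

Lemma absFN x : absF (- x) = absF x.
Proof.
apply/eqP; rewrite -(@eqrXn2 _ 2) ?absF_ge0// !expr2 -!absFM.
by rewrite mulrNN.
Qed.

Lemma absFB x y : absF (x - y) = absF (y - x).
Proof. by rewrite -opprB absFN. Qed.

Lemma absFX x n : absF (x ^+ n) = absF x ^+ n.
Proof. by elim: n => [|n IH]; rewrite ?expr0 ?absF1// !exprS absFM IH. Qed.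

Lemma absF_sqr1 x : absF (x ^+ 2) = 1 -> absF x = 1.
Proof.
by rewrite absFX => e; apply/eqP; rewrite -(@eqrXn2 _ 2) ?absF_ge0 ?ler01// e expr1n.
Qed.

Lemma absFV x : absF x^-1 = (absF x)^-1.
Proof.
have [->|x0] := eqVneq x 0; first by rewrite invr0 absF0 invr0.
apply: (mulfI (_ : absF x != 0)); rewrite ?absF_neq0// -absFM.
by rewrite !divff ?absF1 ?absF_neq0.
Qed.

Lemma absF_le x y (e : R) : absF x <= e -> absF y <= e -> absF (x + y) <= e.
Proof. by move=> xe ye; apply: le_trans (absF_ultra _ _) _; rewrite ge_max xe. Qed.

Lemma absF_lt x y (e : R) : absF x < e -> absF y < e -> absF (x + y) < e.
Proof. by move=> xe ye; apply: le_lt_trans (absF_ultra _ _) _; rewrite gt_max xe. Qed.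

Lemma absF_leB x y (e : R) : absF x <= e -> absF y <= e -> absF (x - y) <= e.
Proof. by move=> xe ye; apply: absF_le; rewrite ?absFN. Qed.

Lemma absF_ltB x y (e : R) : absF x < e -> absF y < e -> absF (x - y) < e.
Proof. by move=> xe ye; apply: absF_lt; rewrite ?absFN. Qed.

Lemma absFD_dom x y : absF y < absF x -> absF (x + y) = absF x.
Proof.
move=> yx; apply/eqP; rewrite eq_le absF_le ?(ltW yx)//= leNgt; apply/negP => lt.
have : absF (x + y - y) < absF x by apply: absF_ltB.
by rewrite addrK ltxx.
Qed.

Lemma absFM_le1 x y : absF x <= 1 -> absF y <= 1 -> absF (x * y) <= 1.
Proof. by move=> x1 y1; rewrite absFM mulr_ile1 ?absF_ge0. Qed.

Lemma absFM_lt1l x y : absF x < 1 -> absF y <= 1 -> absF (x * y) < 1.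
Proof.
move=> x1 y1; rewrite absFM; apply: le_lt_trans x1.
by rewrite -[leRHS]mulr1 ler_wpM2l ?absF_ge0.
Qed.

Lemma absFM_lt1r x y : absF x <= 1 -> absF y < 1 -> absF (x * y) < 1.
Proof. by move=> x1 y1; rewrite mulrC absFM_lt1l. Qed.

Lemma absF_nat n : absF (n%:R : F) <= 1.
Proof.
elim: n => [|n IH]; first by rewrite absF0 ler01.
by rewrite mulrS absF_le// absF1.
Qed.

Lemma absF_near_unit x y : absF x = 1 -> absF (y - x) < 1 -> absF y = 1.
Proof. by move=> x1 yx; rewrite -x1 -(subrK x y) addrC absFD_dom// x1. Qed.

Lemma absF_lt1P x : absF x <= 1 -> absF x != 1 -> absF x < 1.
Proof. by move=> x1 xn; rewrite lt_neqAle xn. Qed.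

Lemma absFM_unitP x y : absF x <= 1 -> absF y <= 1 ->
  (absF (x * y) == 1) = (absF x == 1) && (absF y == 1).
Proof.
move=> x1 y1; apply/idP/andP => [/eqP xy|[/eqP xe /eqP ye]]; last first.
  by rewrite absFM xe ye mulr1.
split; apply/negPn/negP => /absF_lt1P h.
  by have := absFM_lt1l (h x1) y1; rewrite xy ltxx.
by have := absFM_lt1r x1 (h y1); rewrite xy ltxx.
Qed.

End AbsoluteValue.

#[global] Hint Extern 0 (is_true (0 <= absF _)) => apply: absF_ge0 : core.

(** * Maps with fibres of at most two elements *)

Section TwoToOne.
Variables (J : finType) (h : J -> J).
Hypothesis fiber_le2 :
  forall a b c, h a = h b -> h b = h c -> [|| a == b, b == c | c == a].

Let fiber_card y : (\sum_(a in [set: J]%SET | h a == y) 1 <= 2)%N.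
Proof.
rewrite sum1_card leqNgt; apply/negP => /card_gt2P[a [b [c [[ha hb hc] [ab bc ca]]]]].
case/andP: ha => _ /eqP ha; case/andP: hb => _ /eqP hb; case/andP: hc => _ /eqP hc.
by have := fiber_le2 (etrans ha (esym hb)) (etrans hb (esym hc));
  rewrite (negbTE ab) (negbTE bc) (negbTE ca).
Qed.

Lemma card_le_twice_imset : (#|J| <= 2 * #|h @: [set: J]%SET|)%N.
Proof.
rewrite -cardsT -sum1_card (partition_big_imset h) mulnC -sum_nat_const.
by apply: leq_sum => y _; exact: fiber_card.
Qed.

(** The fibre of [a0] contributes one element where the bound allows two, which makes the inequality
    strict. In [residue_norm], [a0] is the residue 0. *)
Lemma card_lt_twice_imset (a0 : J) :
  (forall a, h a = h a0 -> a = a0) -> (#|J| < 2 * #|h @: [set: J]%SET|)%N.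
Proof.
move=> ha0; rewrite -cardsT -sum1_card (partition_big_imset h) mulnC -sum_nat_const.
have im0 : h a0 \in h @: [set: J]%SET by apply: imset_f; rewrite finset.inE.
rewrite (bigD1 (h a0) im0)/= [ltnRHS](bigD1 (h a0) im0)/=.
rewrite (_ : (\sum_(_ in _ | h _ == h a0) 1 = 1)%N); last first.
  rewrite (big_pred1 a0)// => a.
  by rewrite finset.in_setT; apply/eqP/eqP => [/ha0|->].
by rewrite add1n add2n !ltnS; apply: leq_sum => y _; exact: fiber_card.
Qed.

End TwoToOne.

Lemma exprn_small (R : realType) (r e : R) : 0 <= r -> r < 1 -> 0 < e ->
  exists n, r ^+ n < e.
Proof.
move=> r0 r1 e0; have /cvgrPdist_lt/(_ e e0)[n _ /(_ n)] : r ^+ n @[n --> \oo] --> (0 : R).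
  by apply: cvg_expr; rewrite ger0_norm.
rewrite /= leqnn sub0r normrN ger0_norm ?exprn_ge0// => /(_ isT) ?.
by exists n.
Qed.

(** * Uniformizer, residue field and norms modulo p *)

Section Uniformizer.
Context {R : realType} {F : naLocalFieldType R}.
Implicit Types x y z : F.

(** The body of [absF_residue] under its existential quantifier, named so that one uniformizer [p]
    and one list [s] of residue representatives can be fixed throughout. *)
Definition uniformizer_residues (p : F) (s : seq F) :=
  [/\ absF p < 1 /\ (forall x, absF x < 1 -> absF x <= absF p),
      forall x, x \in s -> absF x <= 1,
      uniq s /\
        (forall x y, x \in s -> y \in s -> absF (x - y) < 1 -> x = y),
      forall x, absF x <= 1 -> exists2 y, y \in s & absF (x - y) < 1
    & absF p = (size s)%:R^-1].

Variables (p : F) (s : seq F).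
Hypothesis ps : uniformizer_residues p s.
Local Notation pi := (absF p).

Lemma unif_lt1 : pi < 1. Proof. by case: ps => -[]. Qed.

Lemma unif_max x : absF x < 1 -> absF x <= pi.
Proof. by case: ps => -[_ +] _ _ _ _; exact. Qed.

(** [absF p] is the inverse of the residue cardinality, which is non-zero because [s] contains a
    representative of 0. *)
Lemma unif_neq0 : p != 0.
Proof.
case: ps => _ _ _ cov psz; rewrite -absF_neq0 psz invr_eq0 pnatr_eq0.
have [|y ys _] := cov 0; first by rewrite absF0.
by apply: contraTneq ys => /size0nil ->.
Qed.

Lemma unif_gt0 : 0 < pi. Proof. by rewrite absF_gt0 unif_neq0. Qed.

Lemma residue_card_inv : (size s)%:R = pi^-1.
Proof. by case: ps => _ _ _ _ ->; rewrite invrK. Qed.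

Lemma residue_card_gt1 : (1 < size s)%N.
Proof. by rewrite -(@ltr_nat R) residue_card_inv invf_gt1 ?unif_gt0 ?unif_lt1. Qed.

Lemma unif_expn_small (e : R) : 0 < e -> exists n, pi ^+ n < e.
Proof. by apply: exprn_small; rewrite ?unif_lt1. Qed.

(** For the least [n] that makes [x * p ^+ n] integral the absolute value is 1: otherwise the
    maximality of [absF p] among values below 1 would allow one factor [p] less. *)
Lemma absF_ge1_valuation x : 1 <= absF x -> exists n, absF x * pi ^+ n = 1.
Proof.
move=> x1; have x0 : 0 < absF x by rewrite (lt_le_trans ltr01).
have /ex_minnP[n] : exists n, absF (x * p ^+ n) <= 1.
  have [n nx] := @unif_expn_small (absF x)^-1 (ltac:(by rewrite invr_gt0)).
  exists n; rewrite absFM absFX mulrC -ler_pdivlMr// div1r; exact: ltW.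
rewrite absFM absFX => n1 nmin; exists n; apply/eqP; rewrite eq_le n1/= leNgt.
case: n n1 nmin => [|n] n1 nmin; first by rewrite expr0 mulr1 -leNgt.
apply/negP; rewrite -absFX -absFM => /unif_max.
rewrite absFM absFX exprS mulrCA -[leRHS]mulr1 ler_pM2l ?unif_gt0// => h.
by have := nmin n; rewrite absFM absFX h => /(_ isT); rewrite ltnn.
Qed.

Lemma absF_le1_valuation x : x != 0 -> absF x <= 1 -> exists n, absF x = pi ^+ n.
Proof.
move=> x0 x1; have [|n] := @absF_ge1_valuation x^-1.
  by rewrite absFV invf_ge1// absF_gt0.
rewrite absFV => e; exists n; apply: (mulfI (_ : (absF x)^-1 != 0)).
  by rewrite invr_eq0 absF_neq0.
by rewrite e mulVf ?absF_neq0.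
Qed.

Lemma unif_expn_inj m n : pi ^+ m = pi ^+ n -> m = n.
Proof.
have mono a b : (pi ^+ a <= pi ^+ b) = (b <= a)%N.
  by rewrite ler_iXn2l// ?unif_gt0 ?unif_lt1.
by move=> e; apply/eqP; rewrite eqn_leq -!mono e lexx.
Qed.

Lemma unif_expn_le1 n : pi ^+ n <= 1.
Proof. by rewrite exprn_ile1 ?absF_ge0 ?ltW ?unif_lt1. Qed.

Local Notation J := (seq_sub s).

Lemma card_residues : #|{: J}| = size s.
Proof. by rewrite card_seq_sub//; case: ps => _ _ []. Qed.

Lemma residue_int (j : J) : absF (ssval j) <= 1.
Proof. by case: ps => _ + _ _ _; apply; exact: ssvalP. Qed.

Lemma residue_inj (i j : J) : absF (ssval i - ssval j) < 1 -> i = j.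
Proof.
by case: ps => _ _ [_ h] _ _ ij; apply/val_inj/h; rewrite ?ssvalP.
Qed.

Lemma residue_map : exists res : F -> J,
  forall x, absF x <= 1 -> absF (x - ssval (res x)) < 1.
Proof.
case: ps => _ _ _ cov _.
have [|y0 ys0 _] := cov 0; first by rewrite absF0.
(* Outside the integers [y0] is a default value, so that choice yields a total map. *)
have h x : exists j : J, absF x <= 1 -> absF (x - ssval j) < 1.
  have [/cov[y ys xy]|_] := boolP (absF x <= 1); first by exists (SeqSub ys).
  by exists (SeqSub ys0).
by have [f hf] := boolp.choice h; exists f.
Qed.

Lemma residue_map_eq (res : F -> J) x y :
  (forall x, absF x <= 1 -> absF (x - ssval (res x)) < 1) ->
  absF x <= 1 -> absF y <= 1 ->
  res x = res y <-> absF (x - y) < 1.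
Proof.
move=> hres x1 y1; split => [e|xy].
  rewrite (_ : x - y = (x - ssval (res x)) - (y - ssval (res y))); last by rewrite e; ring.
  by rewrite absF_ltB// hres.
apply: residue_inj.
rewrite (_ : _ - _ = (y - ssval (res y)) - (x - ssval (res x)) + (x - y)); last by ring.
by rewrite absF_lt// absF_ltB// hres.
Qed.

(** The only root modulo p is the residue of $-a/b$. *)
Lemma linear_residue_root (a b : F) : absF a <= 1 -> absF b = 1 ->
  exists j0 : J, forall j, (absF (a + ssval j * b) < 1) = (j == j0).
Proof.
move=> a1 b1; have [res hres] := residue_map.
have b0 : b != 0 by rewrite -(@absF_neq0 R) b1 oner_eq0.
have ab : absF (- a / b) <= 1 by rewrite absFM absFV b1 invr1 mulr1 absFN.
have e j : absF (a + ssval j * b) = absF (- a / b - ssval j).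
  rewrite -[RHS]mul1r -b1 -absFM -[RHS]absFN; congr absF; field.
  exact: b0.
exists (res (- a / b)) => j; rewrite e; apply/idP/eqP => [h|->]; last exact: hres.
apply: residue_inj.
rewrite (_ : _ - _ = (- a / b - ssval (res (- a / b))) - (- a / b - ssval j)); last by ring.
by rewrite absF_ltB// hres.
Qed.

(* Pigeonhole: the values of X^2 + T X + N and those of u X^2 each fill at least
   half of the residue field, the latter strictly more since 0 has a single
   square root. *)
Lemma residue_norm (T N u : F) : absF T <= 1 -> absF N <= 1 ->
  absF u = 1 ->
  (forall r, absF r <= 1 -> absF (r ^+ 2 + T * r + N) = 1) ->
  exists a b : F, [/\ absF a <= 1, absF b <= 1
    & absF (a ^+ 2 + T * a * b + N * b ^+ 2 - u) < 1].
Proof.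
move=> T1 N1 u1 unitP; have [res hres] := residue_map.
have u0 : u != 0 by rewrite -(@absF_neq0 R) u1 oner_eq0.
have resE := residue_map_eq hres.
pose P r : F := r ^+ 2 + T * r + N.
have P1 (j : J) : absF (P (ssval j)) <= 1 by rewrite unitP// residue_int.
have Q1 (j : J) : absF (u * ssval j ^+ 2) <= 1.
  by rewrite absFM u1 mul1r absFX exprn_ile1// residue_int.
pose f (j : J) := res (P (ssval j)).
pose g (j : J) := res (u * ssval j ^+ 2).
have cf : (#|{: J}| <= 2 * #|f @: [set: J]%SET|)%N.
  (* $P(i)-P(j)=(i-j)(i+j+T)$, so three distinct residues with the same value would give
     $a+b+T\equiv b+c+T\equiv 0$, hence $a=c$. *)
  apply: card_le_twice_imset => a b c /(resE _ _ (P1 _) (P1 _)).1 ab /(resE _ _ (P1 _) (P1 _)).1 bc.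
  apply/negPn; rewrite !negb_or; apply/and3P => -[nab nbc nca].
  have sep (i j : J) : i != j -> absF (ssval i - ssval j) = 1.
    move=> ij; apply/eqP; apply: contraNT ij => h; apply/eqP/residue_inj.
    by apply: absF_lt1P h; rewrite absF_leB ?residue_int.
  have root (i j : J) : i != j -> absF (P (ssval i) - P (ssval j)) < 1 ->
      absF (ssval i + ssval j + T) < 1.
    move=> /sep ij; rewrite (_ : P _ - P _ =
      (ssval i - ssval j) * (ssval i + ssval j + T)) ?absFM ?ij ?mul1r//.
    by rewrite /P; ring.
  have := absF_ltB (root _ _ nab ab) (root _ _ nbc bc).
  rewrite (_ : _ - _ = ssval a - ssval c); last by ring.
  by rewrite absFB (sep _ _ nca) ltxx.
have cg : (#|{: J}| < 2 * #|g @: [set: J]%SET|)%N.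
  have groot (i j : J) : g i = g j ->
      absF (ssval i - ssval j) < 1 \/ absF (ssval i + ssval j) < 1.
    move=> /(resE _ _ (Q1 _) (Q1 _)).1.
    rewrite (_ : _ - _ = u * ((ssval i - ssval j) * (ssval i + ssval j))); last by ring.
    rewrite absFM u1 mul1r => lt1.
    have [|h] := ltP (absF (ssval i - ssval j)) 1; first by left.
    right; rewrite ltNge; apply/negP => h'; move: lt1.
    by rewrite ltNge absFM mulr_ege1.
  apply: (@card_lt_twice_imset _ _ _ (res 0)).
    move=> a b c /groot[/residue_inj->|ab]; first by rewrite eqxx.
    move=> /groot[/residue_inj->|bc]; first by rewrite eqxx orbT.
    suff -> : c = a by rewrite eqxx !orbT.
    apply: residue_inj; rewrite (_ : _ - _ =
      (ssval b + ssval c) - (ssval a + ssval b)); last by ring.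
    exact: absF_ltB.
  move=> a; have r0 : absF (ssval (res 0)) < 1.
    by rewrite -absFN -sub0r hres// absF0.
  move=> /groot[/residue_inj//|h]; apply: residue_inj.
  rewrite -(addrK (ssval (res 0)) (ssval a)) !absF_ltB//.
have [k] : exists k, k \in (f @: [set: J]%SET) :&: (g @: [set: J]%SET).
  apply/set0Pn; rewrite -card_gt0 cardsI.
  have := subset_leq_card (finset.subsetT (f @: [set: J]%SET :|: g @: [set: J]%SET)).
  rewrite cardsT subn_gt0 => /leq_ltn_trans; apply.
  by rewrite -(ltn_pmul2l (isT : 0 < 2)%N) mulnDr mul2n -addnn -addnS leq_add.
rewrite finset.inE => /andP[/imsetP[i _ ->] /imsetP[j _]].
move=> /(resE _ _ (P1 _) (Q1 _)).1 ij.
have uj : absF (u * ssval j ^+ 2) = 1.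
  by apply: absF_near_unit (unitP _ (residue_int i)) _; rewrite absFB.
have j1 : absF (ssval j) = 1.
  apply/eqP; rewrite -(@eqrXn2 _ 2) ?absF_ge0// expr1n -absFX.
  by rewrite -[absF _]mul1r -u1 -absFM uj u1.
have j0 : ssval j != 0 by rewrite -(@absF_neq0 R) j1 oner_eq0.
(* $P(i)$ is congruent to $uj^2$; division by $j^2$ turns this into a congruence for the homogeneous
   form. *)
exists (ssval i / ssval j), (ssval j)^-1; split.
- by rewrite absFM absFV j1 invr1 mulr1 residue_int.
- by rewrite absFV j1 invr1.
- move: ij; rewrite (_ : P _ - _ = ssval j ^+ 2 * ((ssval i / ssval j) ^+ 2 +
    T * (ssval i / ssval j) * (ssval j)^-1 + N * (ssval j)^-1 ^+ 2 - u)); last first.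
    by rewrite /P; field; exact: j0.
  by rewrite absFM absFX j1 expr1n mul1r.
Qed.

(** In residue characteristic 2 squaring is injective on residues, since $i^2-j^2=(i-j)^2+2j(i-j)$,
    hence surjective by finiteness. *)
Lemma residue_sqrt (u : F) : absF (2%:R : F) < 1 -> absF u <= 1 ->
  exists2 a, absF a <= 1 & absF (a ^+ 2 - u) < 1.
Proof.
move=> two u1; have [res hres] := residue_map.
have resE := residue_map_eq hres.
have Q1 (j : J) : absF (ssval j ^+ 2) <= 1.
  by rewrite absFX exprn_ile1// residue_int.
pose g (j : J) := res (ssval j ^+ 2).
have ginj : injective g.
  move=> i j /(resE _ _ (Q1 _) (Q1 _)).1 lt1; apply: residue_inj.
  move: lt1; apply: contraTT; rewrite -!leNgt => h.
  rewrite (_ : _ - _ = (ssval i - ssval j) * (ssval i - ssval j) +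
    2%:R * (ssval j * (ssval i - ssval j))); last by ring.
  have ge1 : 1 <= absF ((ssval i - ssval j) * (ssval i - ssval j)).
    by rewrite absFM mulr_ege1.
  rewrite absFD_dom//; apply: lt_le_trans ge1.
  by apply: absFM_lt1l => //; rewrite absFM_le1 ?absF_leB ?residue_int.
have [g' _ gK] := injF_bij ginj.
exists (ssval (g' (res u))); first exact: residue_int.
by apply/resE; rewrite // -[res _]/(g _) gK.
Qed.

End Uniformizer.

(** * Hensel's lemma for quadratic equations and norms of units *)

Section QuadraticHensel.
Context {R : realType} {F : naLocalFieldType R}.
Implicit Types x y z : F.

(* The root is the fixed point of the contraction h |-> - (c + a h^2) / b. *)
Lemma hensel_quadratic (a b c : F) : absF a <= 1 -> absF b = 1 -> absF c < 1 ->
  exists2 h, absF h < 1 & a * h ^+ 2 + b * h + c = 0.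
Proof.
move=> a1 b1 c1; pose r : R := absF c; have b0 : b != 0.
  by rewrite -(@absF_neq0 R) b1 oner_eq0.
have r0 : 0 <= r by exact: absF_ge0.
pose g h : F := - (c + a * h ^+ 2) / b.
pose u n := iter n g 0.
have gr h : absF h <= r -> absF (g h) <= r.
  move=> hr; rewrite absFM absFV b1 invr1 mulr1 absFN absF_le// absFM absFX.
  apply: le_trans (_ : r ^+ 2 <= r).
    by rewrite -[leRHS]mul1r ler_pM ?exprn_ge0// lerXn2r ?nnegrE ?absF_ge0.
  by rewrite expr2 ler_piMl ?absF_ge0 ?ltW.
have ur n : absF (u n) <= r by elim: n => [|n IH] /=; rewrite ?absF0 ?absF_ge0 ?gr.
have gg x y : absF x <= r -> absF y <= r -> absF (g x - g y) <= r * absF (x - y).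
  move=> xr yr; rewrite (_ : _ - _ = - (a * ((x + y) * (x - y))) / b); last by rewrite /g; ring.
  rewrite absFM absFV b1 invr1 mulr1 absFN absFM -[leRHS]mul1r ler_pM//.
  by rewrite absFM ler_wpM2r ?absF_le.
(* The contraction factor is [r = absF c < 1], so the iterates are Cauchy at rate [r ^+ n]. *)
have step n k : absF (u (n + k)%N - u n) <= r ^+ n.
  elim: n => [|n IH].
    by rewrite add0n expr0 subr0 (le_trans (ur _))// ltW.
  by rewrite addSn exprS /= (le_trans (gg _ _ (ur _) (ur _)))// ler_wpM2l.
have small := @exprn_small R r _ (absF_ge0 _) c1.
have [e e0|l hl] := @absF_complete _ F u.
  have [n rn] := small _ e0; exists n => m k nm nk.
  rewrite (_ : _ - _ = (u (n + (m - n))%N - u n) - (u (n + (k - n))%N - u n)).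
    by apply: absF_ltB; apply: le_lt_trans rn.
  by rewrite !subnKC//; ring.
have lr : absF l <= r.
  rewrite leNgt; apply/negP => rl.
  have [|n /(_ n (leqnn n)) ul] := hl (absF l); first exact: le_lt_trans rl.
  have := absF_ltB (le_lt_trans (ur n) rl) ul.
  by rewrite opprB addrC subrK ltxx.
have gl : g l = l.
  apply/eqP; rewrite -subr_eq0 -[_ == _]negbK -(@absF_neq0 R F); apply/negP => gl0.
  have e0 : 0 < absF (g l - l) by rewrite lt_neqAle eq_sym gl0/=.
  have [n hn] := hl _ e0.
  have h1 : absF (u n.+1 - l) < absF (g l - l) by apply: hn.
  have h2 : absF (g l - u n.+1) < absF (g l - l).
    apply: le_lt_trans (gg _ _ lr (ur n)) _.
    apply: le_lt_trans (_ : absF (l - u n) < _).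
      by rewrite ler_piMl// ltW.
    by rewrite absFB hn.
  by have := absF_lt h2 h1; rewrite subrKA ltxx.
exists l; first exact: le_lt_trans c1.
by rewrite -{2}gl /g; field.
Qed.

Variables (p : F) (s : seq F).
Hypothesis ps : uniformizer_residues p s.

Variables (T N : F).
Hypothesis (T1 : absF T <= 1) (N1 : absF N <= 1).
Hypothesis unitP : forall r, absF r <= 1 -> absF (r ^+ 2 + T * r + N) = 1.

(** An inert polynomial stays separable modulo p. If 2 is a unit, the discriminant is $-4$ times the
    value at $-T/2$. Otherwise $T$ is a unit and $T^2$ dominates: if $T$ were not, a square root of
    $-N$ modulo p would be a root modulo p. *)
Lemma discriminant_unit : absF (T ^+ 2 - 4%:R * N) = 1.
Proof.
have [two|two] := eqVneq (absF (2%:R : F)) 1.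
  have n20 : (2%:R : F) != 0 by rewrite -(@absF_neq0 R) two oner_eq0.
  have r1 : absF (- T / 2%:R) <= 1 by rewrite absFM absFV two invr1 mulr1 absFN.
  rewrite (_ : _ - _ = - (2%:R ^+ 2 * ((- T / 2%:R) ^+ 2 + T * (- T / 2%:R) + N))).
    by rewrite absFN absFM unitP// absFX two expr1n mul1r.
  by field.
have {}two := absF_lt1P (absF_nat 2) two.
have [TT|/(absF_lt1P T1) TT] := eqVneq (absF T) 1.
  rewrite absFD_dom ?absFX ?TT ?expr1n// absFN.
  rewrite (_ : 4%:R = 2%:R * 2%:R) -?mulrA ?absFM_lt1l ?absFM_le1 ?absF_nat//.
  by rewrite -natrM.
have [|a a1 aN] := residue_sqrt ps (u := - N) two; first by rewrite absFN.
have := @unitP a a1; rewrite (_ : _ + _ = (a ^+ 2 - - N) + T * a); last by ring.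
by move=> h; have := absF_lt aN (absFM_lt1l TT a1); rewrite h ltxx.
Qed.

(** A solution modulo p is lifted in a variable whose partial derivative is a unit. There is one:
    the partial derivatives are linear forms in $(a,b)$ whose determinant is minus the discriminant,
    so if both were non-units, [a], [b] and the norm would be non-units too. *)
Lemma norm_unit_surj (u : F) : absF u = 1 ->
  exists a b, [/\ absF a <= 1, absF b <= 1 & a ^+ 2 + T * a * b + N * b ^+ 2 = u].
Proof.
move=> u1; have [a [b [a1 b1 c1]]] := residue_norm ps T1 N1 u1 unitP.
set c := (X in absF X < 1) in c1.
have [da|da] := eqVneq (absF (2%:R * a + T * b)) 1.
  have [|h h1 e] := @hensel_quadratic 1 _ c _ da c1; first by rewrite absF1.
  exists (a + h), b; split; rewrite ?absF_le ?(ltW h1)//; apply/eqP.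
  by rewrite -subr_eq0 -{}e /c; apply/eqP; ring.
have [db|db] := eqVneq (absF (T * a + 2%:R * N * b)) 1.
  have [h h1 e] := hensel_quadratic N1 db c1.
  exists a, (b + h); split; rewrite ?absF_le ?(ltW h1)//; apply/eqP.
  by rewrite -subr_eq0 -{}e /c; apply/eqP; ring.
have two : absF (2%:R : F) <= 1 by exact: absF_nat.
have {}da : absF (2%:R * a + T * b) < 1.
  by apply: absF_lt1P da; rewrite absF_le ?absFM_le1.
have {}db : absF (T * a + 2%:R * N * b) < 1.
  by apply: absF_lt1P db; rewrite absF_le ?absFM_le1 ?absFM_le1.
have d1 := discriminant_unit.
have b_lt : absF b < 1.
  rewrite -[absF b]mul1r -{1}d1 -absFM (_ : _ * b =
    T * (2%:R * a + T * b) - 2%:R * (T * a + 2%:R * N * b)); last by ring.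
  by apply: absF_ltB; apply: absFM_lt1r.
have a_lt : absF a < 1.
  rewrite -[absF a]mul1r -{1}d1 -absFM (_ : _ * a =
    T * (T * a + 2%:R * N * b) - (2%:R * N) * (2%:R * a + T * b)); last by ring.
  by apply: absF_ltB; apply: absFM_lt1r; rewrite ?absFM_le1.
suff : absF (a ^+ 2 + T * a * b + N * b ^+ 2 - c) < 1.
  by rewrite /c opprB addrC subrK u1 ltxx.
apply: absF_ltB => //; apply: absF_lt; first apply: absF_lt.
- exact: absFM_lt1l.
- by apply: absFM_lt1r => //; rewrite absFM_le1.
- by apply: absFM_lt1r => //; apply: absFM_lt1r.
Qed.

End QuadraticHensel.

(** * Unramified quadratic algebras *)

(** Turns scalings into products in the algebra, where [ring] applies. *)
Lemma scale_in_alg (K : fieldType) (A : comUnitAlgType K) (a : K) (x : A) :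
  a *: x = in_alg A a * x.
Proof. by rewrite mulr_algl. Qed.

Section QuadraticStructure.
Context {R : realType} {F : naLocalFieldType R} {E : comUnitAlgType F}.
Variables (conj : {lrmorphism E -> E}) (tau : E).

Lemma alg_inj : injective (fun a : F => a%:A : E).
Proof.
move=> a b ab; apply/eqP; rewrite -subr_eq0; apply: contraT => n0.
have : (a - b)^-1 *: ((a - b) *: (1 : E)) = 0 by rewrite scalerBl ab subrr scaler0.
by rewrite scalerA mulVf// scale1r => /eqP; rewrite oner_eq0.
Qed.

Lemma toF_alg (a : F) : toF (a%:A : E) = a.
Proof. exact: alg_inj (@xgetI F 0 [set b : F | b%:A = a%:A :> E] a erefl). Qed.

Lemma normEF_eq (x : E) (n : F) : x * conj x = n%:A -> normEF conj x = n.
Proof. by rewrite /normEF => ->; rewrite toF_alg. Qed.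

Lemma absE_le1 (x : E) : (absE conj x <= 1) = (absF (normEF conj x) <= 1).
Proof. by rewrite /absE -[X in _ <= X]sqrtr1 ler_sqrt. Qed.

Lemma absE_sqr (x : E) : absE conj x ^+ 2 = absF (normEF conj x).
Proof. by rewrite sqr_sqrtr. Qed.

(** [T] and [N] are the trace and the norm of [tau]. The split and the field case are both brought
    to this form. *)
Definition quadratic_basis (T N : F) :=
  [/\ conj tau = T%:A - tau, tau * conj tau = N%:A,
      forall x : E, exists a b : F, x = a%:A + b *: tau
    & forall a b : F, a%:A + b *: tau = 0 -> a = 0 /\ b = 0].

Section Basis.
Variables (T N : F).
Hypothesis TN : quadratic_basis T N.

Definition norm_form (T N a b : F) := a ^+ 2 + T * a * b + N * b ^+ 2.


Lemma conj_basis (a b : F) : conj (a%:A + b *: tau) = (a + T * b)%:A - b *: tau.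
Proof.
case: TN => ct _ _ _; rewrite linearD !linearZ rmorph1/= ct.
by rewrite !scale_in_alg; ring.
Qed.

Lemma normEF_basis (a b : F) : normEF conj (a%:A + b *: tau) = norm_form T N a b.
Proof.
apply: normEF_eq; rewrite conj_basis /norm_form; case: TN => ct tn _ _.
have := congr1 (fun z => (b ^+ 2) *: z) tn; rewrite ct => e.
transitivity ((a ^+ 2 + T * a * b)%:A + b ^+ 2 *: (tau * (T%:A - tau))).
  by rewrite !scale_in_alg; ring.
by rewrite e !scale_in_alg; ring.
Qed.

Lemma tau_sqr : tau * tau = T *: tau - N%:A.
Proof. by case: TN => ct <- _ _; rewrite ct !scale_in_alg; ring. Qed.

Lemma basis_inj (a b c d : F) :
  a%:A + b *: tau = c%:A + d *: tau -> a = c /\ b = d.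
Proof.
case: TN => _ _ _ h e; have [|/eqP + /eqP] := h (a - c) (b - d).
  apply/eqP; rewrite -(subrr (c%:A + d *: tau)) -{1}e; apply/eqP.
  by rewrite !scale_in_alg; ring.
by rewrite !subr_eq0 => /eqP -> /eqP ->.
Qed.

Lemma mul_conj_normEF (x : E) : x * conj x = (normEF conj x)%:A.
Proof.
case: (TN) => _ _ /(_ x)[a [b ->]] _.
rewrite normEF_basis conj_basis /norm_form; case: TN => ct tn _ _.
have := congr1 (fun z => (b ^+ 2) *: z) tn; rewrite ct => e.
transitivity ((a ^+ 2 + T * a * b)%:A + b ^+ 2 *: (tau * (T%:A - tau))).
  by rewrite !scale_in_alg; ring.
by rewrite e !scale_in_alg; ring.
Qed.

Lemma normEFM (x y : E) : normEF conj (x * y) = normEF conj x * normEF conj y.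
Proof.
apply: normEF_eq; rewrite rmorphM mulrACA !mul_conj_normEF.
by rewrite !scale_in_alg; ring.
Qed.

Lemma normEF1 : normEF conj 1 = 1.
Proof. by apply: normEF_eq; rewrite rmorph1 mul1r scale1r. Qed.

Lemma unit_normEF (x : E) : (x \is a GRing.unit) = (normEF conj x != 0).
Proof.
apply/idP/idP => [xu|n0].
  have := normEFM x x^-1; rewrite divrr// normEF1 => e.
  by apply: contraTneq isT => n0; move: e; rewrite n0 mul0r => /eqP; rewrite oner_eq0.
apply/unitrPr; exists ((normEF conj x)^-1 *: conj x).
by rewrite -scalerAr mul_conj_normEF scalerA mulVf// scale1r.
Qed.

End Basis.

(** Stated without a [quadratic_basis], because [field_structure] needs it while that basis is being
    established. *)
Lemma normEFZ (c : F) (x : E) (n : F) : x * conj x = n%:A ->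
  normEF conj (c *: x) = c ^+ 2 * n.
Proof.
move=> e; apply: normEF_eq; rewrite linearZ/=.
transitivity ((c ^+ 2) *: (x * conj x)); first by rewrite !scale_in_alg; ring.
by rewrite e scalerA.
Qed.


(** The two projections of an isomorphism from [E] to $F\oplus F$, as plain functions. *)
Definition split_coordinates (u v : E -> F) :=
  [/\ forall a b x, u (a%:A + b *: x) = a + b * u x
                 /\ v (a%:A + b *: x) = a + b * v x,
      forall x y, u (x * y) = u x * u y /\ v (x * y) = v x * v y,
      forall x y, u x = u y -> v x = v y -> x = y
    & forall a b, exists x, u x = a /\ v x = b].

Lemma split_coordinates_of (phi : {lrmorphism E -> (F^o * F^o)%type}) :
  bijective phi -> split_coordinates (fun x => (phi x).1) (fun x => (phi x).2).
Proof.
move=> [psi phiK psiK]; split.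
- move=> a b x; have := linearD phi (a%:A) (b *: x).
  rewrite !linearZ/= => ->; have -> : phi 1 = 1 by exact: rmorph1.
  by split; rewrite /= [_ *: 1]mulr1.
- by move=> x y; have /= -> := rmorphM phi x y.
- move=> x y e1 e2; rewrite -[x]phiK -[y]phiK [phi x]surjective_pairing e1 e2.
  by rewrite -surjective_pairing.
- by move=> a b; exists (psi (a, b)); have -> : phi (psi (a, b)) = (a, b) := psiK _.
Qed.

Lemma split_coordinatesE (u v : E -> F) : split_coordinates u v ->
  [/\ u 0 = 0, v 0 = 0, u 1 = 1 & v 1 = 1].
Proof.
case=> h _ _ _; have [] := h 0 0 0; have [] := h 1 0 0.
by rewrite !scale0r scale1r !addr0 !mul0r !addr0.
Qed.

(** The idempotents $(1,0)$ and $(0,1)$ have product 0. This separates the two alternatives in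
    [integersE]. *)
Lemma field_not_split (u v : E -> F) :
  @is_field R F E -> split_coordinates u v -> False.
Proof.
move=> fE uv; have [u0 v0 u1 v1] := split_coordinatesE uv.
case: uv => _ hM inj surj.
have [e [ue ve]] := surj 1 0; have [f [uf vf]] := surj 0 1.
have e0 : e != 0 by apply/eqP => ee; move/eqP: ue; rewrite ee u0 eq_sym oner_eq0.
have f0 : f != 0 by apply/eqP => ff; move/eqP: vf; rewrite ff v0 eq_sym oner_eq0.
move: f0; rewrite -[f](mulKr (fE _ e0)) (_ : e * f = 0) ?mulr0 ?eqxx//.
by have [h1 h2] := hM e f; apply: inj; rewrite ?h1 ?h2 ?uf ?ve ?u0 ?v0 ?mulr0 ?mul0r.
Qed.

Lemma integersE_basis (x : E) : integral_generator conj tau -> integersE conj x ->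
  exists a b, [/\ absF a <= 1, absF b <= 1 & x = a%:A + b *: tau].
Proof. by case=> _ -> _. Qed.

(** Everything is read off the idempotent [e] with coordinates $(1,0)$. Being integral, it is an
    integral combination of 1 and [tau], which makes $t_1-t_2$ a unit; its conjugate is an
    idempotent other than 0, 1 and [e], hence $1-e$, which determines [conj tau]. *)
Lemma split_structure (phi : {lrmorphism E -> (F^o * F^o)%type}) :
  bijective phi -> bijective conj -> (exists x, conj x != x) ->
  integral_generator conj tau ->
  exists t1 t2, [/\ absF t1 <= 1, absF t2 <= 1, absF (t1 - t2) = 1
    & quadratic_basis (t1 + t2) (t1 * t2)].
Proof.
move=> /split_coordinates_of phi_uv [cinv cK _] x0 [tau_unit intE ind].
(* The coordinates come from the isomorphism by which [integersE] holds for [tau], so that [t1] and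
   [t2] are integral. *)
have [u [v [uv ut vt uvint]]] : exists u v : E -> F,
    [/\ split_coordinates u v, absF (u tau) <= 1, absF (v tau) <= 1
      & forall x, absF (u x) <= 1 -> absF (v x) <= 1 -> integersE conj x].
  have : integersE conj tau.
    rewrite intE; exists 0, 1; split; rewrite /integersF/= ?absF0 ?absF1 ?ler01//.
    by rewrite scale0r add0r scale1r.
  case=> [[fE _]|[phi' [bphi' ut vt]]].
    by case: (field_not_split fE phi_uv).
  exists (fun x => (phi' x).1), (fun x => (phi' x).2); split => //.
    exact: split_coordinates_of.
  by move=> x ux vx; right; exists phi'.
have [u0 v0 u1 v1] := split_coordinatesE uv; case: (uv) => lin mul inj surj.
have [e [ue ve]] := surj 1 0.
have gen : integral_generator conj tau by split.
have [|a [b [a1 b1 eab]]] := integersE_basis (x := e) gen.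
  by apply: uvint; rewrite ?ue ?ve ?absF1 ?absF0 ?ler01.
set t1 := u tau in ut *; set t2 := v tau in vt *; exists t1, t2.
have bt : b * (t1 - t2) = 1.
  have [h1 h2] := lin a b tau; rewrite -ue -[RHS]subr0 -[in RHS]ve eab h1 h2.
  by rewrite -/t1 -/t2; ring.
have t12 : absF (t1 - t2) = 1.
  have /eqP := absF1 (R := R) (F := F).
  by rewrite -{1}bt absFM_unitP ?absF_leB// => /andP[_ /eqP].
have t0 : t1 - t2 != 0 by rewrite -(@absF_neq0 R) t12 oner_eq0.
have tauE : tau = t2%:A + (t1 - t2) *: e.
  have [h1 h2] := lin t2 (t1 - t2) e.
  by apply: inj; rewrite ?h1 ?h2 ?ue ?ve -/t1 -/t2; ring.
have conjE : conj tau = t2%:A + (t1 - t2) *: conj e.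
  by rewrite tauE linearD !linearZ rmorph1.
have span x : exists c d : F, x = c%:A + d *: tau.
  pose d := (u x - v x) / (t1 - t2); pose c := u x - d * t1.
  have [h1 h2] := lin c d tau.
  exists c, d; apply: inj; rewrite ?h1 ?h2 -/t1 -/t2 /c /d; field; exact: t0.
have cinj : injective conj by exact: can_inj cK.
have idem (w : E -> F) : w (conj e * conj e) = w (conj e) * w (conj e) ->
    w (conj e) = 0 \/ w (conj e) = 1.
  rewrite -rmorphM (_ : e * e = e); last first.
    have [h1 h2] := mul e e.
    by apply: inj; rewrite ?h1 ?h2 ?ue ?ve ?mulr1 ?mulr0.
  move=> /eqP; rewrite -subr_eq0 -[X in X - _]mulr1 -mulrBr mulf_eq0 subr_eq0.
  by case/orP => /eqP <-; [left|right].
have [/idem uce /idem vce] := mul (conj e) (conj e).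
have ce : conj e = 1 - e.
  have [eu ev] : u (conj e) = 0 /\ v (conj e) = 1.
    case: uce vce => eu [] ev //.
    - have : conj e = conj 0 by rewrite rmorph0; apply: inj; rewrite ?u0 ?v0.
      by move=> /cinj ee; move: ue; rewrite ee u0 => /esym/eqP; rewrite oner_eq0.
    - case: x0 => x cx; exfalso; move/negP: cx; apply.
      have cee : conj e = e by apply: inj; rewrite ?ue ?ve.
      case: (span x) => c [d ->]; rewrite linearD !linearZ rmorph1/=.
      by rewrite conjE cee -tauE.
    - have : conj e = conj 1 by rewrite rmorph1; apply: inj; rewrite ?u1 ?v1.
      by move=> /cinj ee; move: ve; rewrite ee v1 => /eqP; rewrite oner_eq0.
  have := lin 1 (-1) e; rewrite scaleN1r scale1r => -[h1 h2].
  by apply: inj; rewrite ?h1 ?h2 ?ue ?ve ?eu ?ev; ring.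
have ct : conj tau = (t1 + t2)%:A - tau.
  by rewrite conjE ce tauE !scale_in_alg; ring.
split=> //; split => //.
rewrite ct; have := lin (t1 + t2) (-1) tau; rewrite scaleN1r => -[h1 h2].
have [m1 m2] := mul tau ((t1 + t2)%:A - tau).
have := lin (t1 * t2) 0 1; rewrite scale0r addr0 => -[l1 l2].
by apply: inj; rewrite ?m1 ?m2 ?h1 ?h2 ?l1 ?l2 -/t1 -/t2; ring.
Qed.

(** Both [w] and [conj w] are roots of $X^2-dX-c$ and they differ, so their sum is [d]. Norms are
    thus known to lie in [F] before integrality, which is defined through them, is exploited. *)
Lemma field_conj_trace : @is_field R F E -> @quadratic R F E ->
  (exists x, conj x != x) ->
  forall x, exists t n : F, conj x = t%:A - x /\ x * conj x = n%:A.
Proof.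
move=> fE [w wb] [x0 cx0].
have span x : exists a b : F, x = a%:A + b *: w.
  by have [[a b] [-> _]] := wb x; exists a, b.
have [c [d w2]] := span (w * w).
have cw2 : conj w * conj w = c%:A + d *: conj w.
  transitivity (conj (w * w)); first by rewrite rmorphM.
  by rewrite w2 linearD !linearZ rmorph1.
have cw : conj w = d%:A - w.
  have cww : conj w - w != 0.
    apply: contra_neq cx0 => /eqP; rewrite subr_eq0 => /eqP e.
    by have [a [b ->]] := span x0; rewrite linearD !linearZ rmorph1/= e.
  have /(congr1 (fun z => (conj w - w)^-1 * z)) :
      (conj w - w) * (conj w + w - d%:A) = 0.
    transitivity (conj w * conj w - w * w - d *: (conj w - w)).
      by rewrite !scale_in_alg; ring.
    by rewrite cw2 w2 !scale_in_alg; ring.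
  rewrite mulKr ?fE// mulr0 => /eqP; rewrite -addrA addr_eq0 => /eqP ->.
  by rewrite opprB.
move=> x; have [a [b ->]] := span x.
exists (2%:R * a + b * d), (a ^+ 2 + a * b * d - b ^+ 2 * c).
rewrite linearD !linearZ rmorph1/= cw; split; first by rewrite !scale_in_alg; ring.
transitivity ((a ^+ 2)%:A + (a * b * d)%:A + b ^+ 2 *: (d *: w - w * w)).
  by rewrite !scale_in_alg; ring.
by rewrite w2 !scale_in_alg; ring.
Qed.

Lemma field_structure (p : F) (s : seq F) : uniformizer_residues p s ->
  @is_field R F E -> @quadratic R F E -> (exists x, conj x != x) ->
  (forall x : E, x != 0 -> exists2 y : F, y != 0 & absE conj x = absF y) ->
  integral_generator conj tau ->
  exists T N, [/\ absF T <= 1, absF N <= 1, quadratic_basis T N,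
    forall r, absF r <= 1 -> absF (r ^+ 2 + T * r + N) = 1
    & forall a b, norm_form T N a b != 0 ->
        exists2 y : F, y != 0 & absF (norm_form T N a b) = absF y ^+ 2].
Proof.
move=> ps fE qE ncE unram gen; have tn := field_conj_trace fE qE ncE.
have [tau_unit intE ind] := gen.
have [T [N [ct cn]]] := tn tau; exists T, N.
have norm_sq x (c : F) : normEF conj (c *: x) = c ^+ 2 * normEF conj x.
  by have [t [n [_ xn]]] := tn x; rewrite (normEFZ _ xn) (normEF_eq xn).
have int_norm x : integersE conj x <-> absF (normEF conj x) <= 1.
  rewrite -absE_le1; split; last by left.
  by case=> [[]//|[phi [/split_coordinates_of h _ _]]]; case: (field_not_split fE h).
have p0 := unif_neq0 ps; have p1 := unif_lt1 ps.
have TN : quadratic_basis T N.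
  split=> // x.
  (* A large power of [p] makes [x] integral, hence a combination of 1 and [tau]; dividing it out
     shows that these span [E]. *)
  have [|k kn] := @unif_expn_small _ _ _ _ ps (absF (normEF conj x) + 1)^-1.
    by rewrite invr_gt0 ltr_wpDl.
  have /integersE_basis : integersE conj (p ^+ k *: x).
    apply/int_norm; rewrite norm_sq absFM !absFX.
    apply: le_trans (_ : absF p ^+ k * absF (normEF conj x) <= 1).
      by rewrite ler_wpM2r// expr2 ler_piMr ?exprn_ge0 ?(unif_expn_le1 ps).
    apply: le_trans (_ : (absF (normEF conj x) + 1)^-1 * (absF (normEF conj x) + 1) <= 1).
      by rewrite ler_pM ?exprn_ge0 ?lerDl ?ler01 ?(ltW kn).
    by rewrite mulVf// gt_eqF// ltr_wpDl.
  case=> // a [b [_ _ e]]; exists (p ^- k * a), (p ^- k * b).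
  rewrite -[x](scalerK (a := p ^+ k)) ?expf_neq0// e.
  by rewrite !scale_in_alg; ring.
have nb := normEF_basis TN.
have N1 : absF N <= 1.
  have : integersE conj tau.
    rewrite intE; exists 0, 1; split; rewrite /integersF/= ?absF0 ?absF1 ?ler01//.
    by rewrite scale0r add0r scale1r.
  by move/int_norm; rewrite (normEF_eq cn).
have Pint r : absF r <= 1 -> absF (r ^+ 2 + T * r + N) <= 1.
  move=> r1; have /int_norm : integersE conj (r%:A + 1 *: tau).
    by rewrite intE; exists r, 1; split; rewrite /integersF/= ?absF1.
  by rewrite nb /norm_form expr1n !mulr1.
have T1 : absF T <= 1.
  (* The bracket is the norm of the integral element $1+\tau$. *)
  rewrite (_ : T = (1 ^+ 2 + T * 1 + N) - 1 - N); last by ring.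
  by rewrite !absF_leB ?Pint ?absF1.
split=> // [r r1|a b n0].
  (* If $N(r+\tau)$ were a non-unit then, [E] having the value group of [F], $(r+\tau)/p$ would be
     integral, yet its coefficient at [tau] is $1/p$. *)
  apply/eqP; rewrite -[_ == _]negbK; apply/negP => /(absF_lt1P (Pint _ r1)).
  have nbr := nb r 1; rewrite /norm_form expr1n !mulr1 in nbr; rewrite -nbr.
  set x := (X in normEF conj X) => x1.
  have x0 : x != 0.
    apply/eqP => /ind[_] /eqP; exact/negP/oner_neq0.
  have [y y0 xy] := unram x x0.
  have y1 : absF y < 1.
    by rewrite -(@ltr_pXn2r _ 2)// ?nnegrE ?ler01// -xy absE_sqr expr1n.
  have /integersE_basis : integersE conj (p^-1 *: x).
    apply/int_norm; rewrite norm_sq absFM -absE_sqr xy absFX absFV -exprMn.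
    rewrite exprn_ile1 ?mulr_ge0 ?invr_ge0// mulrC ler_pdivrMr ?(unif_gt0 ps)//.
    by rewrite mul1r (unif_max ps).
  case=> // c [d [c1 d1]]; rewrite /x scalerDr !scalerA mulr1 => /(basis_inj TN)[_ e].
  by move: d1; rewrite -e absFV invf_le1 ?(unif_gt0 ps)// leNgt p1.
have : a%:A + b *: tau != 0.
  apply: contra_neq n0 => e0; rewrite -nb e0.
  by apply: normEF_eq; rewrite mul0r scale0r.
by move=> /unram[y y0 e]; exists y; rewrite // -e absE_sqr nb.
Qed.

End QuadraticStructure.

(** * Matrices of size 2 *)

Section Matrix22.
Context {K : fieldType}.
Implicit Types a b c d : K.

Lemma ord2P (P : 'I_2 -> Prop) : P 0 -> P 1 -> forall i, P i.
Proof.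
move=> P0 P1 [[|[|//]] i2]; first by rewrite (_ : Ordinal i2 = 0)//; exact: val_inj.
by rewrite (_ : Ordinal i2 = 1)//; exact: val_inj.
Qed.

Definition mx22 a b c d : 'M[K]_2 :=
  \matrix_(i, j) if i == 0 then (if j == 0 then a else b) else (if j == 0 then c else d).

Lemma mx22E a b c d :
  (mx22 a b c d 0 0 = a) * (mx22 a b c d 0 1 = b) *
  (mx22 a b c d 1 0 = c) * (mx22 a b c d 1 1 = d).
Proof. by rewrite !mxE. Qed.

Lemma mx22_eta (M : 'M[K]_2) : M = mx22 (M 0 0) (M 0 1) (M 1 0) (M 1 1).
Proof. by apply/matrixP; do 2 apply: ord2P; rewrite mx22E. Qed.

Lemma mx22_inj a b c d a' b' c' d' : mx22 a b c d = mx22 a' b' c' d' ->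
  [/\ a = a', b = b', c = c' & d = d'].
Proof.
move=> /matrixP e; have := e 0 0; have := e 0 1; have := e 1 0; have := e 1 1.
by rewrite !mx22E.
Qed.

Lemma mx22M a b c d a' b' c' d' : mx22 a b c d *m mx22 a' b' c' d' =
  mx22 (a * a' + b * c') (a * b' + b * d') (c * a' + d * c') (c * b' + d * d').
Proof.
by apply/matrixP; do 2 apply: ord2P;
  rewrite mxE big_ord_recl big_ord1 (_ : lift ord0 ord0 = 1) ?mx22E//; exact: val_inj.
Qed.

Lemma det_mx22 a b c d : \det (mx22 a b c d) = a * d - b * c.
Proof.
rewrite (expand_det_row _ 0) big_ord_recl big_ord1.
rewrite (_ : lift ord0 ord0 = 1) ?mx22E; last exact: val_inj.
by rewrite /cofactor !det_mx11 !mxE /= expr0 expr1 mul1r mulN1r mulrN.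
Qed.

Lemma scalar_mx22 a : a%:M = mx22 a 0 0 a.
Proof. by apply/matrixP; do 2 apply: ord2P; rewrite mx22E mxE/= ?mulr1n ?mulr0n. Qed.

Lemma scale_mx22 e a b c d : e *: mx22 a b c d = mx22 (e * a) (e * b) (e * c) (e * d).
Proof. by apply/matrixP; do 2 apply: ord2P; rewrite mxE !mx22E. Qed.

Lemma addmx22 a b c d a' b' c' d' :
  mx22 a b c d + mx22 a' b' c' d' = mx22 (a + a') (b + b') (c + c') (d + d').
Proof. by apply/matrixP; do 2 apply: ord2P; rewrite mxE !mx22E. Qed.

Lemma oppmx22 a b c d : - mx22 a b c d = mx22 (- a) (- b) (- c) (- d).
Proof. by apply/matrixP; do 2 apply: ord2P; rewrite mxE !mx22E. Qed.

Lemma unitmx22 a b c d : (mx22 a b c d \in unitmx) = (a * d - b * c != 0).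
Proof. by rewrite unitmxE det_mx22 unitfE. Qed.

(** The hypothesis [r *m z = y *m r] is free of inverses, so it can be checked on entries as a
    polynomial identity. *)
Lemma conjmx_eq (r y z : 'M[K]_2) : r \in unitmx -> r *m z = y *m r ->
  invmx r *m y *m r = z.
Proof. by move=> ru e; rewrite -mulmxA -e mulKmx. Qed.

End Matrix22.

(** * The tori and the transfer factor in coordinates *)

Section TorusCoordinates.
Context {R : realType} {F : naLocalFieldType R} {E : comUnitAlgType F}.
Variables (conj : {lrmorphism E -> E}) (tau : E) (T N : F).
Hypothesis TN : quadratic_basis conj tau T N.
Hypothesis tau_gen : integral_generator conj tau.
Hypothesis disc1 : absF (T ^+ 2 - 4%:R * N) = 1.
Hypotheses (T1 : absF T <= 1) (N1 : absF N <= 1).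

Definition torus_mx (T N a b : F) := mx22 a (- (N * b)) b (a + T * b).

Lemma mulmat_basis (a b : F) : mulmat tau (a%:A + b *: tau) = torus_mx T N a b.
Proof.
have e : (a%:A + b *: tau) * tau = (- (N * b))%:A + (a + T * b) *: tau.
  transitivity (a *: tau + b *: (tau * tau)); first by rewrite !scale_in_alg; ring.
  by rewrite (tau_sqr TN) !scale_in_alg; ring.
apply: xget_unique => [|M [/(basis_inj TN)[m00 m10]]]; first by rewrite /= !mx22E.
by rewrite e => /(basis_inj TN)[m01 m11]; rewrite [M]mx22_eta -m00 -m10 -m01 -m11.
Qed.

Lemma det_torus_mx a b : \det (torus_mx T N a b) = norm_form T N a b.
Proof. by rewrite det_mx22 /norm_form; ring. Qed.

Lemma torus_mxM a b c d : torus_mx T N a b *m torus_mx T N c d =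
  torus_mx T N (a * c - N * b * d) (a * d + b * c + T * b * d).
Proof. by rewrite mx22M; congr mx22; ring. Qed.

(** The second factor is the matrix of the conjugate divided by the norm. *)
Lemma torus_mx_inv a b : norm_form T N a b != 0 ->
  torus_mx T N a b *m torus_mx T N ((a + T * b) / norm_form T N a b)
                                   (- b / norm_form T N a b) = 1%:M.
Proof.
by move=> n0; rewrite torus_mxM scalar_mx22; congr mx22; rewrite /norm_form; field.
Qed.

Lemma torusGLP M : torusGL tau M <->
  exists a b, norm_form T N a b != 0 /\ M = torus_mx T N a b.
Proof.
split=> [[g /= gu <-]|[a [b [n0 ->]]]].
  case: TN => _ _ /(_ g)[a [b gab]] _; exists a, b.
  by rewrite -(normEF_basis TN) -(unit_normEF TN) -gab gu gab mulmat_basis.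
exists (a%:A + b *: tau); last exact: mulmat_basis.
by rewrite /= (unit_normEF TN) (normEF_basis TN).
Qed.

Lemma torusP M : torus tau M <->
  exists a b, norm_form T N a b = 1 /\ M = torus_mx T N a b.
Proof.
split=> [[/torusGLP[a [b [_ ->]]]]|[a [b [n1 ->]]]].
  by rewrite /SL2/= det_torus_mx => n1; exists a, b.
split; last by rewrite /SL2/= det_torus_mx.
by apply/torusGLP; exists a, b; rewrite n1 oner_neq0.
Qed.

Lemma integersEP a b : integersE conj (a%:A + b *: tau) <-> absF a <= 1 /\ absF b <= 1.
Proof.
case: tau_gen => _ -> _; split=> [[c [d [c1 d1 /(basis_inj TN)[-> ->]]]]//|[a1 b1]].
by exists a, b.
Qed.

Lemma torusOP M : torusO conj tau M <->
  exists a b, [/\ norm_form T N a b = 1, absF a <= 1, absF b <= 1 & M = torus_mx T N a b].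
Proof.
split=> [[g [gu gi _ gn] <-]|[a [b [n1 a1 b1 ->]]]].
  case: TN => _ _ /(_ g)[a [b gab]] _; exists a, b.
  move: gi gn; rewrite gab (normEF_basis TN) => /integersEP[a1 b1] n1.
  by split=> //; exact: mulmat_basis.
have gu : a%:A + b *: tau \is a GRing.unit.
  by rewrite (unit_normEF TN) (normEF_basis TN) n1 oner_neq0.
exists (a%:A + b *: tau); last exact: mulmat_basis.
split=> //; first exact/integersEP; last by rewrite (normEF_basis TN).
(* The inverse of an element of norm 1 is its conjugate. *)
rewrite (_ : _^-1 = (a + T * b)%:A + (- b) *: tau).
  by apply/integersEP; rewrite absFN absF_le// absFM_le1.
apply: (mulrI gu); rewrite mulrV//.
have := mul_conj_normEF TN (a%:A + b *: tau).
by rewrite (normEF_basis TN) n1 (conj_basis TN) scale1r scaleNr => ->.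
Qed.

Lemma torusO_integral M : torusO conj tau M <->
  torus tau M /\ forall i j, integersF (M i j).
Proof.
split=> [/torusOP[a [b [n1 a1 b1 ->]]]|[/torusP[a [b [n1 ->]]] h]].
  split; first by apply/torusP; exists a, b.
  do 2 apply: ord2P; rewrite /integersF/= mx22E ?absFN ?absFM_le1//.
  by rewrite absF_le ?absFM_le1.
apply/torusOP; exists a, b; split => //.
  by have := h 0 0; rewrite mx22E.
by have := h 1 0; rewrite mx22E.
Qed.

(** $\gamma-\overline\gamma=b(\tau-\overline\tau)$, and the norm of $\tau-\overline\tau$ is minus
    the discriminant, a unit. *)
Lemma transfer_factorE a b :
  transfer_factor conj tau (a%:A + b *: tau) = eps conj b * absF b :> R.
Proof.
case: (TN) => ct _ _ _; rewrite /transfer_factor (conj_basis TN) ct.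
have -> : a%:A + b *: tau - ((a + T * b)%:A - b *: tau) = b *: ((- T)%:A + 2%:R *: tau).
  by rewrite !scale_in_alg; ring.
have -> : tau - (T%:A - tau) = (- T)%:A + 2%:R *: tau.
  by rewrite !scale_in_alg; ring.
have nd : norm_form T N (- T) 2%:R = - (T ^+ 2 - 4%:R * N) by rewrite /norm_form; ring.
have nz := normEF_basis TN (- T) 2%:R.
rewrite -[X in toF (X / _)]mulr_algl mulrK; last first.
  by rewrite (unit_normEF TN) nz nd oppr_eq0 -(@absF_neq0 R) disc1 oner_neq0.
rewrite toF_alg; congr (_ * _).
rewrite /absE (normEFZ _ (mul_conj_normEF TN _)) nz nd absFM absFN disc1 mulr1.
by rewrite absFX sqrtr_sqr ger0_norm.
Qed.

End TorusCoordinates.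

(** * Norms of units and stable lines over the residue field *)

Section UnramifiedType.
Context {R : realType} {F : naLocalFieldType R}.

(* First the split case, where tau has coordinates (t1, t2), then the case of a
   field; [kap] is the value of eps at a uniformizer. *)
Definition unramified_type (T N : F) (kap : R) :=
  (kap = 1 /\ exists t1 t2, [/\ absF t1 <= 1, absF t2 <= 1, absF (t1 - t2) = 1,
     T = t1 + t2 & N = t1 * t2]) \/
  (kap = -1 /\ forall r, absF r <= 1 -> absF (r ^+ 2 + T * r + N) = 1).

Variables (p : F) (s : seq F).
Hypothesis ps : uniformizer_residues p s.

Lemma unit_norm_form (T N u : F) kap : absF T <= 1 -> absF N <= 1 ->
  unramified_type T N kap -> absF u = 1 ->
  exists a b, [/\ absF a <= 1, absF b <= 1 & norm_form T N a b = u].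
Proof.
move=> T1 N1 [[_ [t1 [t2 [t11 t21 t12 -> ->]]]]|[_ unitP]] u1; last first.
  by have [a [b [a1 b1 e]]] := norm_unit_surj ps T1 N1 unitP u1; exists a, b.
have t0 : t1 - t2 != 0 by rewrite -(@absF_neq0 R) t12 oner_eq0.
have b1 : absF ((u - 1) / (t1 - t2)) <= 1.
  by rewrite absFM absFV t12 invr1 mulr1 absF_leB ?u1 ?absF1.
(* The element with coordinates $(u,1)$: $a+bt_1=u$ and $a+bt_2=1$. *)
exists (1 - (u - 1) / (t1 - t2) * t2), ((u - 1) / (t1 - t2)).
split=> //; first by rewrite absF_leB ?absF1// absFM_le1.
by rewrite /norm_form; field.
Qed.

Lemma norm_form_split_surj (t1 t2 c : F) : t1 - t2 != 0 ->
  exists a b, norm_form (t1 + t2) (t1 * t2) a b = c.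
Proof.
move=> t0; exists (1 - (c - 1) / (t1 - t2) * t2), ((c - 1) / (t1 - t2)).
by rewrite /norm_form; field.
Qed.

Local Notation J := (seq_sub s).

Lemma card_nonroots (P : pred J) (j0 : J) : (forall j, P j = (j != j0)) ->
  (#|P| = (size s).-1)%N.
Proof.
move=> h; rewrite -(card_residues ps) -(cardC1 j0); apply: eq_card => j.
exact: h.
Qed.

Section LowerLeftEntry.
Variables (a b c d : F).
Hypotheses (a1 : absF a <= 1) (b1 : absF b <= 1) (c1 : absF c <= 1) (d1 : absF d <= 1).

(* The lower left entry of the conjugate of mx22 a b c d by mx22 1 0 z 1. *)
Definition lower_left (z : F) := c + z * (d - a) - z ^+ 2 * b.

(* The right-hand side is the characteristic polynomial at a + z b; when b is a
   unit this reduces [lower_left z = 0] to linear congruences for z. *)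
Lemma lower_left_char z : - b * lower_left z =
  (a + z * b) ^+ 2 - (a + d) * (a + z * b) + (a * d - b * c).
Proof. by rewrite /lower_left; ring. Qed.

Lemma lower_left_near z : absF z <= 1 -> absF b < 1 ->
  absF (lower_left z - (c + z * (d - a))) < 1.
Proof.
move=> z1 b_lt; rewrite (_ : _ - _ = - (z ^+ 2 * b)); last by rewrite /lower_left; ring.
by rewrite absFN absFM_lt1r// absFX exprn_ile1.
Qed.

Lemma residue_arg_int (j : J) : absF (a + ssval j * b) <= 1.
Proof. by rewrite absF_le// absFM_le1// (residue_int ps). Qed.

Lemma nilpotent_diag : absF (a + d) < 1 -> absF (a * d - b * c) < 1 ->
  absF (b * c) < 1 -> absF a < 1 /\ absF d < 1.
Proof.
move=> tr det bc; have alt : absF a < 1.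
  have : absF (a ^+ 2) < 1.
    rewrite (_ : _ ^+ 2 = (a + d) * a - (a * d - b * c) - b * c); last by ring.
    by apply: absF_ltB => //; apply: absF_ltB => //; exact: absFM_lt1l.
  by rewrite absFX expr_lt1.
by split=> //; rewrite -(addKr a d) absF_lt// absFN.
Qed.

(** Counts the lines of the residue plane that are not stable: [absF b == 1] tests the line of the
    second basis vector, and [lower_left z] the line of $(1,z)$. A non-zero nilpotent matrix has one
    stable line out of $q+1$. *)
Lemma count_nilpotent : absF (a + d) < 1 -> absF (a * d - b * c) < 1 ->
  absF b = 1 \/ absF c = 1 ->
  ((absF b == 1%R) + #|[pred j : J | absF (lower_left (ssval j)) == 1%R]| = size s)%N.
Proof.
move=> tr det bc; have q1 := residue_card_gt1 ps.
have [bu|bn] := eqVneq (absF b) 1.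
  have [j0 hj0] := linear_residue_root ps a1 bu.
  rewrite (@card_nonroots _ j0) ?add1n ?prednK ?(ltnW q1)// => j /=.
  rewrite -hj0 -[absF (lower_left _)]mul1r -{1}bu -(absFN b) -absFM lower_left_char.
  set z := a + _; have z1 : absF z <= 1 by exact: residue_arg_int.
  have [zu|zn] := eqVneq (absF z) 1; rewrite ?zu ?ltxx.
    apply/eqP; rewrite -addrA absFD_dom ?absFX ?zu ?expr1n//.
    by rewrite absF_lt// absFN absFM_lt1l.
  have zlt := absF_lt1P z1 zn; rewrite zlt; apply/negbTE; rewrite lt_eqF//.
  by rewrite absF_lt// absF_ltB// ?absFM_lt1l// expr2 absFM_lt1l// ltW.
have {}bn := absF_lt1P b1 bn.
have cu : absF c = 1 by case: bc => // bu; move: bn; rewrite bu ltxx.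
have [alt dlt] := nilpotent_diag tr det (absFM_lt1l bn c1).
rewrite add0n -(card_residues ps); apply: eq_card => j; rewrite !finset.inE.
apply/eqP/(absF_near_unit cu).
rewrite (_ : _ - _ = ssval j * (d - a) - ssval j ^+ 2 * b); last by rewrite /lower_left; ring.
by rewrite absF_ltB// absFM_lt1r ?absF_ltB ?absFX ?exprn_ile1 ?(residue_int ps).
Qed.

(** Two distinct eigenvalues modulo p give two stable lines out of $q+1$. *)
Lemma count_split t1 t2 : absF t1 <= 1 -> absF t2 <= 1 -> absF (t1 - t2) = 1 ->
  a + d = t1 + t2 -> a * d - b * c = t1 * t2 ->
  ((absF b == 1%R) + #|[pred j : J | absF (lower_left (ssval j)) == 1%R]| = (size s).-1)%N.
Proof.
move=> t11 t21 t12 tr det; have q1 := residue_card_gt1 ps.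
have [bu|bn] := eqVneq (absF b) 1.
  have [|j1 hj1] := @linear_residue_root _ _ _ _ ps (a - t1) _ _ bu; first by rewrite absF_leB.
  have [|j2 hj2] := @linear_residue_root _ _ _ _ ps (a - t2) _ _ bu; first by rewrite absF_leB.
  have j12 : j1 != j2.
    apply/eqP => e; have := hj1 j1; have := hj2 j1; rewrite e eqxx => h2 h1.
    have := absF_ltB h2 h1; rewrite (_ : _ - _ = t1 - t2); last by ring.
    by rewrite t12 ltxx.
  have : (#|{: J}| = #|[pred j : J | absF (lower_left (ssval j)) == 1%R]| + 2)%N.
    rewrite -(cardC [pred j : J | absF (lower_left (ssval j)) == 1%R]); congr addn.
    transitivity #|pred2 j1 j2|; last by rewrite card2 j12.
    apply: eq_card => j; rewrite !finset.inE -hj1 -hj2.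
    rewrite -[absF (lower_left _)]mul1r -{1}bu -(absFN b) -absFM lower_left_char.
    rewrite (_ : _ + _ = (a - t1 + ssval j * b) * (a - t2 + ssval j * b)); last first.
      by rewrite tr det; ring.
    have i t : absF t <= 1 -> absF (a - t + ssval j * b) <= 1.
      by move=> ?; rewrite addrAC absF_leB// residue_arg_int.
    rewrite absFM_unitP ?i// negb_and !lt_neqAle !i// !andbT.
    done.
  by rewrite (card_residues ps) => ->; lia.
have {}bn := absF_lt1P b1 bn.
(* Modulo p the matrix is lower triangular: its diagonal is $t_1,t_2$ in some order, and
   [lower_left] is affine in [z] with unit slope. *)
have uda : absF (d - a) = 1.
  have : absF ((a - t1) * (a - t2)) < 1.
    rewrite (_ : _ * _ = a ^+ 2 - (t1 + t2) * a + t1 * t2); last by ring.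
    rewrite -tr -det (_ : _ + _ = - (b * c)); last by ring.
    by rewrite absFN absFM_lt1l.
  have [at1|] := eqVneq (absF (a - t1)) 1.
    rewrite absFM at1 mul1r => at2.
    apply: (@absF_near_unit _ _ (t1 - t2)) => //.
    rewrite (_ : _ - _ = (a + d) - (t1 + t2) - (a - t2) - (a - t2)); last by ring.
    by rewrite tr subrr sub0r absF_ltB// absFN.
  move=> /absF_lt1P at1 _; apply: (@absF_near_unit _ _ (t2 - t1)); first by rewrite absFB.
  rewrite (_ : _ - _ = (a + d) - (t1 + t2) - (a - t1) - (a - t1)); last by ring.
  by rewrite tr subrr sub0r absF_ltB ?absFN ?at1 ?absF_leB.
have [j0 hj0] := linear_residue_root ps c1 uda.
rewrite add0n; apply: (@card_nonroots _ j0) => j /=; rewrite -hj0.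
have j1 := residue_int ps j; have near := lower_left_near j1 bn.
have cj : absF (c + ssval j * (d - a)) <= 1 by rewrite absF_le// absFM_le1// uda.
have [u|nu] := eqVneq (absF (c + ssval j * (d - a))) 1.
  by rewrite u ltxx (absF_near_unit u near) eqxx.
have {}nu := absF_lt1P cj nu; rewrite nu; apply/negbTE; rewrite lt_eqF//.
by rewrite -(subrK (c + ssval j * (d - a)) (lower_left _)) absF_lt.
Qed.

Section Inert.
Hypothesis unitP :
  forall r, absF r <= 1 -> absF (r ^+ 2 + (a + d) * r + (a * d - b * c)) = 1.

Let unitN r : absF r <= 1 -> absF (r ^+ 2 - (a + d) * r + (a * d - b * c)) = 1.
Proof. by move=> r1; have := @unitP (- r); rewrite absFN sqrrN mulrN; exact. Qed.

(** Otherwise [a] would be a root modulo p of the characteristic polynomial. *)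
Lemma inert_upper_right_unit : absF b = 1.
Proof.
apply/eqP; rewrite -[_ == _]negbK; apply/negP => /(absF_lt1P b1) bn.
have := unitN a1; rewrite (_ : _ + _ = - (b * c)); last by ring.
by move=> e; have := absFM_lt1l bn c1; rewrite -absFN e ltxx.
Qed.

Lemma count_inert :
  ((absF b == 1%R) + #|[pred j : J | absF (lower_left (ssval j)) == 1%R]| = (size s).+1)%N.
Proof.
rewrite inert_upper_right_unit eqxx add1n -(card_residues ps); congr S.
apply: eq_card => j; rewrite !finset.inE.
rewrite -[absF (lower_left _)]mul1r -{1}inert_upper_right_unit -(absFN b) -absFM.
by rewrite lower_left_char unitN ?eqxx// residue_arg_int.
Qed.

End Inert.

Lemma count_unramified T N kap : unramified_type T N kap ->
  a + d = T -> a * d - b * c = N ->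
  ((absF b == 1%R) + #|[pred j : J | absF (lower_left (ssval j)) == 1%R]|)%N%:R
    = (size s)%:R - kap.
Proof.
have q1 := residue_card_gt1 ps.
move=> [[-> [t1 [t2 [t11 t21 t12 -> ->]]]]|[-> unitP]] tr det.
  by rewrite (count_split t11 t21 t12 tr det) -[in RHS](prednK (ltnW q1)) -natr1 addrK.
by rewrite count_inert ?tr ?det// opprK -natr1.
Qed.

End LowerLeftEntry.
End UnramifiedType.

(** * The quadratic character *)

Section QuadraticCharacter.
Context {R : realType} {F : naLocalFieldType R} {E : comUnitAlgType F}.
Variables (conj : {lrmorphism E -> E}) (tau : E) (p : F) (s : seq F).
Hypothesis ps : uniformizer_residues p s.
Hypothesis tau_gen : integral_generator conj tau.
Local Notation pi := (absF p).

Lemma epsM_norm (T N : F) (x : E) (a : F) : quadratic_basis conj tau T N ->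
  normEF conj x != 0 -> eps conj (normEF conj x * a) = eps conj a :> R.
Proof.
move=> TN x0; have xu : x \is a GRing.unit by rewrite (unit_normEF TN).
have nV : normEF conj x^-1 = (normEF conj x)^-1.
  by apply: (mulfI x0); rewrite -(normEFM TN) divrr// normEF1 divff.
rewrite /eps; congr (if _ then _ else _); apply/asboolP/asboolP => -[z zu e].
  exists (x^-1 * z); first by rewrite unitrM unitrV xu.
  by rewrite (normEFM TN) nV e mulKf.
by exists (x * z); rewrite ?unitrM ?xu// (normEFM TN) e.
Qed.

(** In the field case units are norms and norms have even valuation, so [eps] is the parity of the
    valuation. The first clause on [eps] covers integral arguments only; the last one lets
    determinants of any valuation be handled in the split case. *)
Lemma unramified_data : unramified_quadratic conj ->
  exists T N kap, [/\ absF T <= 1, absF N <= 1, quadratic_basis conj tau T N,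
    absF (T ^+ 2 - 4%:R * N) = 1 & unramified_type T N kap] /\
  [/\ forall a n, absF a = pi ^+ n -> eps conj a = kap ^+ n
    & kap = 1 -> forall a, a != 0 -> eps conj a = 1 :> R].
Proof.
move=> [bconj ncE [[phi bphi]|[fE qE unram]]].
  have [t1 [t2 [t11 t21 t12 TN]]] := split_structure bphi bconj ncE tau_gen.
  have t0 : t1 - t2 != 0 by rewrite -(@absF_neq0 R) t12 oner_eq0.
  have eps1 a : a != 0 -> eps conj a = 1 :> R.
    move=> a0; rewrite /eps; case: asboolP => // -[].
    have [b [c e]] := norm_form_split_surj a t0.
    exists (b%:A + c *: tau); last by rewrite (normEF_basis TN).
    by rewrite (unit_normEF TN) (normEF_basis TN) e.
  exists (t1 + t2), (t1 * t2), 1; split; last first.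
    split=> // a n e; rewrite expr1n eps1// -(@absF_neq0 R) e expf_neq0//.
    by rewrite absF_neq0 (unif_neq0 ps).
  split=> //; first by rewrite absF_le.
  - by rewrite absFM_le1.
  - by rewrite (_ : _ - _ = (t1 - t2) ^+ 2) ?absFX ?t12 ?expr1n//; ring.
  - by left; split=> //; exists t1, t2.
have [T [N [T1 N1 TN unitP even]]] := field_structure ps fE qE ncE unram tau_gen.
have type : unramified_type T N (-1 : R) by right.
exists T, N, (-1); split; first by split=> //; exact (discriminant_unit ps T1 N1 unitP).
split=> [a n an|/eqP]; last by rewrite -subr_eq0 -opprD oppr_eq0 -[1 + 1]/(2%:R) pnatr_eq0.
have p0 := unif_neq0 ps.
pose u := a / p ^+ n; have u1 : absF u = 1.
  by rewrite absFM absFV absFX an divff// expf_neq0// absF_neq0.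
have aE : a = p ^+ n * u by rewrite /u mulrC divfK// expf_neq0.
rewrite -signr_odd /eps; case: asboolP => [[z zu]|]; last first.
  case: (boolP (odd n)) => [|ev] //= []; have [b [c [_ _ e]]] := unit_norm_form ps T1 N1 type u1.
  have nE : normEF conj (p ^+ n./2 *: (b%:A + c *: tau)) = a.
    rewrite (normEFZ _ (mul_conj_normEF TN _)) (normEF_basis TN) e aE.
    by rewrite -exprM muln2 even_halfK.
  exists (p ^+ n./2 *: (b%:A + c *: tau)) => //.
  by rewrite (unit_normEF TN) nE -(@absF_neq0 R) an expf_neq0// absF_neq0.
case: (TN) => _ _ /(_ z)[b [c ->]] _; rewrite (normEF_basis TN) => e.
have [|y y0] := even b c.
  by rewrite e -(@absF_neq0 R) an expf_neq0// absF_neq0.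
rewrite e an => yn.
have y1 : absF y <= 1.
  by rewrite -(@ler_pXn2r _ 2) ?nnegrE ?ler01// -yn expr1n (unif_expn_le1 ps).
have [k yk] := absF_le1_valuation ps y0 y1.
move: yn; rewrite yk -exprM => /(unif_expn_inj ps) ->.
by rewrite oddM andbF expr0.
Qed.

End QuadraticCharacter.

(** * Lattices and their orders *)

Section Levels.
Context {R : realType} {F : naLocalFieldType R}.
Local Notation M2 := 'M[F]_2.
Implicit Types x y k : M2.

Definition integral_mx x := forall i j, integersF (x i j).

Definition GL2O : set M2 := [set k | integral_mx k /\ absF (\det k) = 1].

Lemma integral_mx22 (a b c d : F) : integral_mx (mx22 a b c d) <->
  [/\ absF a <= 1, absF b <= 1, absF c <= 1 & absF d <= 1].
Proof.
split=> [h|[? ? ? ?]]; last by do 2 apply: ord2P; rewrite /integersF/= mx22E.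
have := h 1 1; have := h 1 0; have := h 0 1; have := h 0 0.
by rewrite !mx22E.
Qed.

Lemma integral_mxM x y : integral_mx x -> integral_mx y -> integral_mx (x *m y).
Proof.
rewrite [x]mx22_eta [y]mx22_eta mx22M => /integral_mx22[? ? ? ?] /integral_mx22[? ? ? ?].
by apply/integral_mx22; split; rewrite absF_le// absFM_le1.
Qed.

Lemma invmx22 (a b c d : F) : a * d - b * c != 0 ->
  invmx (mx22 a b c d) = (a * d - b * c)^-1 *: mx22 d (- b) (- c) a.
Proof.
move=> n0; rewrite -[RHS](mulKmx (_ : mx22 a b c d \in unitmx)) ?unitmx22//.
rewrite -scalemxAr mx22M scale_mx22 -[LHS]mulmx1 scalar_mx22; congr (_ *m _).
by congr mx22; field.
Qed.

Lemma GL2O_unit k : GL2O k -> k \in unitmx.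
Proof.
by case=> _ k1; rewrite unitmxE unitfE -(@absF_neq0 R) k1 oner_neq0.
Qed.

Lemma GL2O_inv k : GL2O k -> GL2O (invmx k).
Proof.
move=> kO; have := GL2O_unit kO; case: kO; rewrite [k]mx22_eta det_mx22 unitmx22.
move=> /integral_mx22[? ? ? ?] d1 d0; split; last first.
  by rewrite det_inv det_mx22 absFV d1 invr1.
rewrite invmx22// scale_mx22; apply/integral_mx22.
by split; rewrite absFM absFV d1 invr1 mul1r ?absFN.
Qed.

Lemma GL2OM k k' : GL2O k -> GL2O k' -> GL2O (k *m k').
Proof.
by move=> [? k1] [? k1']; split; [exact: integral_mxM|rewrite det_mulmx absFM k1 k1' mulr1].
Qed.

Lemma SL2O_GL2O k : SL2O k -> GL2O k.
Proof. by case; rewrite /SL2/= => k1 ki; split; rewrite ?k1 ?absF1. Qed.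

Definition weyl_mx : M2 := mx22 0 1 1 0.
Definition lower_mx (z : F) : M2 := mx22 1 0 z 1.

Lemma GL2O_weyl : GL2O weyl_mx.
Proof.
split; last by rewrite det_mx22 mulr0 mul1r sub0r absFN absF1.
by apply/integral_mx22; rewrite absF0 absF1 ler01 lexx.
Qed.

Lemma GL2O_lower z : absF z <= 1 -> GL2O (lower_mx z).
Proof.
move=> z1; split; last by rewrite det_mx22 mulr1 mul0r subr0 absF1.
by apply/integral_mx22; rewrite absF0 absF1 ler01 lexx.
Qed.

Variables (p : F) (s : seq F).
Hypothesis ps : uniformizer_residues p s.
Local Notation pi := (absF p).

Variables (T N : F).
Hypotheses (T1 : absF T <= 1) (N1 : absF N <= 1).

(* The matrix of tau in the basis of E given by the columns of x: an element
   a + b tau of E stabilizes the lattice L spanned by these columns iff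
   a + b (tau_conj x) is integral. *)
Definition tau_conj (T N : F) x : M2 := invmx x *m torus_mx T N 0 1 *m x.
Local Notation yy := (tau_conj T N).

Lemma tau_conj_mulr x k : x \in unitmx -> k \in unitmx ->
  yy (x *m k) = invmx k *m yy x *m k.
Proof.
move=> xu ku; apply: conjmx_eq; first by rewrite unitmx_mul xu.
by rewrite /tau_conj !mulmxA mulmxK// mulmxV// mul1mx.
Qed.

Lemma tau_conj_trdet x (a b c d : F) : x \in unitmx -> yy x = mx22 a b c d ->
  a + d = T /\ a * d - b * c = N.
Proof.
move=> xu e; split; last first.
  rewrite -det_mx22 -e /tau_conj !det_mulmx mulrAC -det_mulmx mulVmx// det1 mul1r.
  by rewrite det_mx22; ring.
have : \tr (yy x) = T.
  rewrite /tau_conj mxtrace_mulC mulKVmx// /mxtrace big_ord_recl big_ord1.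
  by rewrite (_ : lift ord0 ord0 = 1) ?mx22E; [ring|exact: val_inj].
rewrite e /mxtrace big_ord_recl big_ord1.
by rewrite (_ : lift ord0 ord0 = 1) ?mx22E//; exact: val_inj.
Qed.

(* The order of L is O_F + p^n tau O_F. *)
Definition level n : set M2 := [set x | [/\ x \in unitmx,
  integral_mx (p ^+ n *: yy x) & forall m, integral_mx (p ^+ m *: yy x) -> (n <= m)%N]].

Lemma level_inj m n x : level m x -> level n x -> m = n.
Proof.
by move=> [_ im mm] [_ int nm]; apply/eqP; rewrite eqn_leq mm// nm.
Qed.

Lemma level_exists x : x \in unitmx -> exists n, level n x.
Proof.
move=> xu; have bound (a : F) : exists n, absF (p ^+ n * a) <= 1.
  have [|n hn] := @unif_expn_small _ _ _ _ ps (absF a + 1)^-1.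
    by rewrite invr_gt0 ltr_wpDl.
  exists n; rewrite absFM absFX.
  apply: le_trans (_ : (absF a + 1)^-1 * (absF a + 1) <= 1).
    by rewrite ler_pM ?exprn_ge0 ?lerDl ?ler01 ?(ltW hn).
  by rewrite mulVf// gt_eqF// ltr_wpDl.
have mono (a : F) m n : (m <= n)%N -> absF (p ^+ m * a) <= 1 -> absF (p ^+ n * a) <= 1.
  move=> /subnKC <- h; rewrite addnC exprD -mulrA absFM_le1// absFX.
  exact: unif_expn_le1 ps _.
have : exists n, `[< integral_mx (p ^+ n *: yy x) >].
  rewrite [yy x]mx22_eta; set y := yy x.
  have [n1 h1] := bound (y 0 0); have [n2 h2] := bound (y 0 1).
  have [n3 h3] := bound (y 1 0); have [n4 h4] := bound (y 1 1).
  exists (n1 + n2 + n3 + n4)%N; apply/asboolP; rewrite scale_mx22; apply/integral_mx22.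
  by clear T1 N1; split; [apply: mono h1|apply: mono h2|apply: mono h3|apply: mono h4]; lia.
move=> /ex_minnP[n /asboolP h hmin]; exists n; split=> // m hm.
by apply: hmin; apply/asboolP.
Qed.

Lemma level_le_integral m n x : level n x ->
  integral_mx (p ^+ m *: yy x) <-> (n <= m)%N.
Proof.
move=> [_ h hmin]; split; first exact: hmin.
move=> /subnKC <-; rewrite addnC exprD -scalerA [_ *: yy x]mx22_eta scale_mx22.
apply/integral_mx22; have pm : absF (p ^+ (m - n)) <= 1.
  by rewrite absFX; exact: unif_expn_le1 ps _.
by split; apply: absFM_le1 => //; apply: h.
Qed.

Lemma level_unit n x : level n x -> x \in unitmx. Proof. by case. Qed.

(** The columns of [x *m k] are another basis of the same lattice. *)
Lemma level_mulr n x k : GL2O k -> level n x -> level n (x *m k).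
Proof.
move=> kO [xu xn xmin]; have ku := GL2O_unit kO.
have [kI _] := kO; have [kVI _] := GL2O_inv kO.
split; first by rewrite unitmx_mul xu.
  by rewrite tau_conj_mulr// scalemxAl scalemxAr; do 2 apply: integral_mxM => //.
move=> m hm; apply: xmin.
rewrite (_ : _ *: yy x = k *m (p ^+ m *: yy (x *m k)) *m invmx k).
  by do 2 apply: integral_mxM => //.
by rewrite tau_conj_mulr// -scalemxAr -scalemxAl !mulmxA mulmxV// mul1mx mulmxK.
Qed.

Lemma level_scale n x (c : F) : c != 0 -> level n x -> level n (c *: x).
Proof.
move=> c0 [xu xn xm].
have e : yy (c *: x) = yy x.
  apply: conjmx_eq; first by rewrite unitmxZ// unitfE.
  by rewrite -scalemxAl -scalemxAr /tau_conj !mulmxA mulmxV// mul1mx.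
by split; rewrite ?e ?unitmxZ ?unitfE.
Qed.

(** Multiplication by an element of [E] commutes with [tau], so [tau_conj] is unchanged. *)
Lemma level_mull n a b x : norm_form T N a b != 0 ->
  level n (torus_mx T N a b *m x) <-> level n x.
Proof.
move=> n0; have tu : torus_mx T N a b \in unitmx.
  by rewrite unitmxE unitfE det_torus_mx.
have xu : (torus_mx T N a b *m x \in unitmx) = (x \in unitmx) by rewrite unitmx_mul tu.
have e : x \in unitmx -> yy (torus_mx T N a b *m x) = yy x.
  move=> xu'; apply: conjmx_eq; first by rewrite xu.
  rewrite /tau_conj !mulmxA mulmxK//; congr (_ *m x).
  by rewrite !torus_mxM; congr torus_mx; ring.
by rewrite /level /=; split=> -[]; rewrite xu => h; rewrite e.
Qed.

(** Passes from the basis $x_1,x_2$ to the sublattice with basis $x_1,px_2$, the edge given by the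
    line of $x_1$ modulo p. Along it the level may rise, stay or fall. *)
Definition up_mx : M2 := mx22 1 0 0 p.

Lemma up_mx_unit : up_mx \in unitmx.
Proof. by rewrite unitmx22 mul1r mulr0 subr0 (unif_neq0 ps). Qed.

Lemma tau_conj_up x (a b c d : F) : x \in unitmx -> yy x = mx22 a b c d ->
  yy (x *m up_mx) = mx22 a (p * b) (c / p) d.
Proof.
move=> xu e; rewrite tau_conj_mulr ?up_mx_unit//; apply: conjmx_eq.
  exact: up_mx_unit.
by rewrite e !mx22M; have p0 := unif_neq0 ps; congr mx22; field.
Qed.

Lemma absF_div_unif (a : F) : absF a < 1 -> absF (a / p) <= 1.
Proof.
move=> /(unif_max ps) h.
by rewrite absFM absFV ler_pdivrMr ?(unif_gt0 ps)// mul1r.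
Qed.

Lemma absF_unif_div n (a : F) : absF (p ^+ n.+1 * a) < 1 -> absF (p ^+ n * a) <= 1.
Proof.
move=> /(unif_max ps); rewrite exprS -mulrA absFM -[leRHS]mulr1.
by rewrite ler_pM2l// (unif_gt0 ps).
Qed.

Lemma level_scaled n x (a b c d : F) : level n x -> yy x = mx22 a b c d ->
  [/\ absF (p ^+ n * a) <= 1, absF (p ^+ n * b) <= 1,
      absF (p ^+ n * c) <= 1 & absF (p ^+ n * d) <= 1].
Proof. by move=> [_ + _] e; rewrite e scale_mx22 => /integral_mx22. Qed.

(** For $n>0$ the trace and the determinant of $p^n$ times [tau_conj] vanish modulo p: its reduction
    is nilpotent. *)
Lemma scaled_trdet n x (a b c d : F) : x \in unitmx -> yy x = mx22 a b c d ->
  [/\ p ^+ n * a + p ^+ n * d = p ^+ n * T,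
      (p ^+ n * a) * (p ^+ n * d) - (p ^+ n * b) * (p ^+ n * c) = p ^+ n * p ^+ n * N,
      absF (p ^+ n * T) <= pi ^+ n & absF (p ^+ n * p ^+ n * N) <= pi ^+ n * pi ^+ n].
Proof.
move=> xu e; have [tr det] := tau_conj_trdet xu e.
split; rewrite -?tr -?det ?absFM ?absFX; try ring.
  by rewrite tr -[leRHS]mulr1 ler_wpM2l// exprn_ge0.
by rewrite det -[leRHS]mulr1 ler_wpM2l// mulr_ge0// exprn_ge0.
Qed.

(** If both were non-units, nilpotency would make the diagonal divisible by [p] as well, and the
    level would be at most [n]. *)
Lemma level_attained n x (a b c d : F) : level n.+1 x -> yy x = mx22 a b c d ->
  absF (p ^+ n.+1 * b) = 1 \/ absF (p ^+ n.+1 * c) = 1.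
Proof.
move=> lx e; have [a1 b1 c1 d1] := level_scaled lx e.
have [xu _ xmin] := lx; have [tr det Tn Nn] := scaled_trdet n.+1 xu e.
have pn : pi ^+ n.+1 < 1 by rewrite exprn_ilt1// (unif_lt1 ps).
have [bu|/(absF_lt1P b1) bn] := eqVneq (absF (p ^+ n.+1 * b)) 1; first by left.
have [cu|/(absF_lt1P c1) cn] := eqVneq (absF (p ^+ n.+1 * c)) 1; first by right.
have [an dn] : absF (p ^+ n.+1 * a) < 1 /\ absF (p ^+ n.+1 * d) < 1.
  apply: (nilpotent_diag a1 _ _ (absFM_lt1l bn c1)).
    by rewrite tr (le_lt_trans Tn).
  by rewrite det (le_lt_trans Nn)// mulr_ilt1// exprn_ge0.
suff : (n.+1 <= n)%N by rewrite ltnn.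
apply: xmin; rewrite e scale_mx22.
by apply/integral_mx22; split; apply: absF_unif_div.
Qed.

(** Only the lower left entry acquires a denominator in [tau_conj_up], and it decides whether the
    line of the first column is stable modulo p. *)
Lemma level_up n x (a b c d : F) : level n x -> yy x = mx22 a b c d ->
  level n.+1 (x *m up_mx) <-> absF (p ^+ n * c) = 1.
Proof.
move=> lx e; have [a1 b1 c1 d1] := level_scaled lx e.
have [xu _ xmin] := lx; have e' := tau_conj_up xu e.
have p0 := unif_neq0 ps; have p1 : absF p <= 1 := ltW (unif_lt1 ps).
split=> [[_ _ ymin]|cu].
  apply/eqP; rewrite -[_ == _]negbK; apply/negP => /(absF_lt1P c1) cn.
  suff : (n.+1 <= n)%N by rewrite ltnn.
  apply: ymin; rewrite e' scale_mx22; apply/integral_mx22; split=> //.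
    by rewrite mulrCA absFM_le1.
  by rewrite mulrA absF_div_unif.
split; first by rewrite unitmx_mul xu up_mx_unit.
  rewrite e' scale_mx22 exprS; apply/integral_mx22; split.
  - by rewrite -mulrA absFM_le1.
  - by rewrite mulrCA -mulrA; do 2 apply: absFM_le1 => //.
  - by rewrite [X in absF X](_ : _ = p ^+ n * c) ?cu//; field.
  - by rewrite -mulrA absFM_le1.
move=> m; rewrite e' scale_mx22 => /integral_mx22[_ _ cm _].
apply: contraTT cm; rewrite -leqNgt -ltNge => mn.
rewrite mulrA absFM absFV ltr_pdivlMr ?(unif_gt0 ps)// mul1r.
apply: lt_le_trans (unif_lt1 ps) _; rewrite -cu -(subnKC mn) exprD -mulrA mulrCA absFM absFX.
by rewrite ler_piMl// (unif_expn_le1 ps).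
Qed.

(** If the line of the first column is stable, it is the entry [b] that attains the level, and
    [tau_conj_up] multiplies it by [p]. *)
Lemma level_down n x (a b c d : F) : level n.+1 x -> yy x = mx22 a b c d ->
  level n (x *m up_mx) <-> absF (p ^+ n.+1 * c) != 1.
Proof.
move=> lx e; split=> [lg|].
  apply/eqP => /(level_up lx e).2 /(level_inj lg) /eqP.
  by rewrite ltn_eqF.
have [a1 b1 c1 d1] := level_scaled lx e.
have [xu _ xmin] := lx; have e' := tau_conj_up xu e.
have [tr det Tn Nn] := scaled_trdet n.+1 xu e.
have p0 := unif_neq0 ps; have p1 : absF p <= 1 := ltW (unif_lt1 ps).
have pn : pi ^+ n.+1 < 1 by rewrite exprn_ilt1// (unif_lt1 ps).
move=> /(absF_lt1P c1) cn.
have bu : absF (p ^+ n.+1 * b) = 1.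
  by case: (level_attained lx e) => // cu; move: cn; rewrite cu ltxx.
have [an dn] : absF (p ^+ n.+1 * a) < 1 /\ absF (p ^+ n.+1 * d) < 1.
  apply: (nilpotent_diag a1 _ _ (absFM_lt1r b1 cn)).
    by rewrite tr (le_lt_trans Tn).
  by rewrite det (le_lt_trans Nn)// mulr_ilt1// exprn_ge0.
(* After scaling, [b] is a unit, so $bc=ad-\det$ bounds [c]. Diagonal product and determinant are
   both divisible by $p^2$, which pays for the factor $p$ lost in the level and the division by $p$
   in [tau_conj_up]. *)
have c2 : absF (p ^+ n.+1 * c) <= pi * pi.
  rewrite -[leLHS]mul1r -bu -absFM.
  rewrite [X in absF X](_ : _ = (p ^+ n.+1 * a) * (p ^+ n.+1 * d) -
    ((p ^+ n.+1 * a) * (p ^+ n.+1 * d) - (p ^+ n.+1 * b) * (p ^+ n.+1 * c))); last by ring.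
  rewrite det absF_leB//; first by rewrite absFM ler_pM// (unif_max ps).
  apply: (le_trans Nn); have h : pi ^+ n.+1 <= pi.
    by rewrite exprS -[leRHS]mulr1 ler_wpM2l// (unif_expn_le1 ps).
  by rewrite ler_pM// exprn_ge0.
split; first by rewrite unitmx_mul xu up_mx_unit.
  rewrite e' scale_mx22; apply/integral_mx22; split; try exact: absF_unif_div.
    by rewrite mulrA -exprSr.
  rewrite [X in absF X](_ : _ = (p ^+ n.+1 * c) / (p * p)); last by rewrite exprS; field.
  by rewrite absFM absFV (absFM p p) ler_pdivrMr ?mulr_gt0 ?(unif_gt0 ps)// mul1r.
move=> m; rewrite e' scale_mx22 => /integral_mx22[_ bm _ _].
apply: contraTT bm; rewrite -ltnNge -ltNge mulrA -exprSr => mn.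
have e1 : p ^+ n.+1 * b = p ^+ (n - m) * (p ^+ m.+1 * b).
  by rewrite mulrA -exprD addnS subnK// ltnW.
have : absF (p ^+ (n - m)) * absF (p ^+ m.+1 * b) = 1 by rewrite -absFM -e1.
move=> e2; rewrite ltNge; apply/negP => le1.
have lt1 : absF (p ^+ (n - m)) < 1.
  by rewrite absFX exprn_ilt1 ?(unif_lt1 ps)// subn_eq0 -ltnNge.
have := absFM_lt1l lt1 le1; rewrite absFM e2 ltxx //.
Qed.

Local Notation J := (seq_sub s).

Lemma tau_conj_weyl x (a b c d : F) : x \in unitmx -> yy x = mx22 a b c d ->
  yy (x *m weyl_mx) = mx22 d c b a.
Proof.
move=> xu e; have wu := GL2O_unit GL2O_weyl; rewrite tau_conj_mulr//.
by apply: conjmx_eq; rewrite // e !mx22M; congr mx22; ring.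
Qed.

Lemma tau_conj_lower x (a b c d z : F) : x \in unitmx -> yy x = mx22 a b c d ->
  exists a' d', yy (x *m lower_mx z) = mx22 a' b (lower_left a b c d z) d'.
Proof.
move=> xu e; exists (a + b * z), (d - z * b).
have lu : lower_mx z \in unitmx by rewrite unitmx22 mulr1 mul0r subr0 oner_neq0.
rewrite tau_conj_mulr//; apply: conjmx_eq; rewrite // e !mx22M.
by congr mx22; rewrite /lower_left; ring.
Qed.

Lemma lower_left_scale (e a b c d z : F) :
  e * lower_left a b c d z = lower_left (e * a) (e * b) (e * c) (e * d) z.
Proof. by rewrite /lower_left; ring. Qed.

(* In the tree of lattices up to homothety, the neighbours of the lattice of x are
   those of x *m weyl_mx *m up_mx and of x *m lower_mx z *m up_mx, with z running
   over the residues. *)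
Definition up_neighbours n x :=
  (`[< level n.+1 (x *m weyl_mx *m up_mx) >] +
   #|[pred j : J | `[< level n.+1 (x *m lower_mx (ssval j) *m up_mx) >]]|)%N.

Definition down_neighbours n x :=
  (`[< level n (x *m weyl_mx *m up_mx) >] +
   #|[pred j : J | `[< level n (x *m lower_mx (ssval j) *m up_mx) >]]|)%N.

(** [weyl_mx] brings [b] to the lower left corner, and [lower_mx z] brings [lower_left z] there,
    where [level_up] reads it. *)
Lemma up_neighboursE n x (a b c d : F) : level n x -> yy x = mx22 a b c d ->
  up_neighbours n x = ((absF (p ^+ n * b)%R == 1%R) +
    #|[pred j : J | absF (p ^+ n * lower_left a b c d (ssval j))%R == 1%R]|)%N.
Proof.
move=> lx e; have xu := level_unit lx; congr (_ + _)%N.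
  have lw := level_mulr GL2O_weyl lx.
  by congr nat_of_bool; apply/asboolP/eqP => /(level_up lw (tau_conj_weyl xu e)).
apply: eq_card => j; rewrite !finset.inE.
have [a' [d' e']] := tau_conj_lower (ssval j) xu e.
have lj := level_mulr (GL2O_lower (residue_int ps j)) lx.
by apply/asboolP/eqP => /(level_up lj e').
Qed.

(** From a positive level each of the $q+1$ edges goes one level up or one level down, by [level_up]
    and [level_down]. *)
Lemma down_neighboursE n x (a b c d : F) : level n.+1 x -> yy x = mx22 a b c d ->
  (down_neighbours n x + ((absF (p ^+ n.+1 * b)%R == 1%R) +
    #|[pred j : J | absF (p ^+ n.+1 * lower_left a b c d (ssval j))%R == 1%R]|) = (size s).+1)%N.
Proof.
move=> lx e; have xu := level_unit lx.
rewrite addnACA -[RHS]add1n; congr (_ + _)%N.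
  have lw := level_mulr GL2O_weyl lx.
  case: asboolP => [/(level_down lw (tau_conj_weyl xu e))/negbTE->//|h].
  by case: eqP => // /eqP /(level_down lw (tau_conj_weyl xu e)).
rewrite addnC -(card_residues ps).
rewrite -(cardC [pred j : J | absF (p ^+ n.+1 * lower_left a b c d (ssval j)) == 1]).
congr (_ + _)%N.
apply: eq_card => j; rewrite !finset.inE.
have [a' [d' e']] := tau_conj_lower (ssval j) xu e.
have lj := level_mulr (GL2O_lower (residue_int ps j)) lx.
by apply/asboolP/idP => /(level_down lj e').
Qed.

Lemma up_neighbours0 x kap : unramified_type T N kap -> level 0 x ->
  (up_neighbours 0 x)%:R = (size s)%:R - kap.
Proof.
move=> type lx; have [a [b [c [d e]]]] : exists a b c d, yy x = mx22 a b c d.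
  by do 4 eexists; exact: mx22_eta.
have [tr det] := tau_conj_trdet (level_unit lx) e.
rewrite (up_neighboursE lx e); have [] := level_scaled lx e; rewrite expr0 !mul1r => a1 b1 c1 d1.
rewrite -(count_unramified ps a1 b1 c1 d1 type tr det); congr (_ + _)%N%:R.
by apply: eq_card => j; rewrite !finset.inE mul1r.
Qed.

Lemma up_neighboursS n x : level n.+1 x -> up_neighbours n.+1 x = size s.
Proof.
move=> lx; have [a [b [c [d e]]]] : exists a b c d, yy x = mx22 a b c d.
  by do 4 eexists; exact: mx22_eta.
have xu := level_unit lx; have [tr det Tn Nn] := scaled_trdet n.+1 xu e.
have pn : pi ^+ n.+1 < 1 by rewrite exprn_ilt1// (unif_lt1 ps).
rewrite (up_neighboursE lx e); have [a1 b1 c1 d1] := level_scaled lx e.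
rewrite -(count_nilpotent (d := p ^+ n.+1 * d) ps a1 b1 c1 _ _ (level_attained lx e)).
- by congr (_ + _)%N; apply: eq_card => j; rewrite !finset.inE lower_left_scale.
- by rewrite tr (le_lt_trans Tn).
- by rewrite det (le_lt_trans Nn)// mulr_ilt1// exprn_ge0.
Qed.

Lemma down_neighboursS n x : level n.+1 x -> down_neighbours n x = 1%N.
Proof.
move=> lx; have [a [b [c [d e]]]] : exists a b c d, yy x = mx22 a b c d.
  by do 4 eexists; exact: mx22_eta.
have := down_neighboursE lx e; rewrite -(up_neighboursE lx e) up_neighboursS// -[RHS]add1n.
exact: addIn.
Qed.

End Levels.

(** * Orbits of the torus and stabilizers of lattices *)

Section TorusOrbits.
Context {R : realType} {F : naLocalFieldType R}.
Local Notation M2 := 'M[F]_2.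
Variables (p : F) (s : seq F).
Hypothesis ps : uniformizer_residues p s.
Local Notation pi := (absF p).
Variables (T N : F) (kap : R).
Hypotheses (T1 : absF T <= 1) (N1 : absF N <= 1) (type : unramified_type T N kap).
Local Notation yy := (tau_conj T N).
Local Notation torus_mx := (torus_mx T N).
Local Notation norm_form := (norm_form T N).

Lemma mul_tau_conj (x : M2) : x \in unitmx -> x *m yy x = torus_mx 0 1 *m x.
Proof. by move=> xu; rewrite /tau_conj !mulmxA mulmxV// mul1mx. Qed.

Lemma tau_conj_entries (x : M2) (a b c d : F) : x \in unitmx -> yy x = mx22 a b c d ->
  [/\ x 0 0 * a + x 0 1 * c = - (N * x 1 0), x 1 0 * a + x 1 1 * c = x 0 0 + T * x 1 0,
      x 0 0 * b + x 0 1 * d = - (N * x 1 1) & x 1 0 * b + x 1 1 * d = x 0 1 + T * x 1 1].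
Proof.
move=> xu e; have := mul_tau_conj xu; rewrite e [x]mx22_eta !mx22M => /mx22_inj[h1 h2 h3 h4].
by rewrite !mx22E; split; rewrite ?h1 ?h2 ?h3 ?h4; ring.
Qed.

(** A column is an element $z$ of [E], and $N(z)$ is the determinant with columns $z$, $\tau z$.
    Writing $\tau z$ in the basis [x] leaves the factor [c], respectively [- b]. *)
Lemma column_norms (x : M2) (a b c d : F) : x \in unitmx -> yy x = mx22 a b c d ->
  norm_form (x 0 0) (x 1 0) = \det x * c /\ norm_form (x 0 1) (x 1 1) = \det x * - b.
Proof.
move=> xu e; have [h1 h2 h3 h4] := tau_conj_entries xu e.
have dx : \det x = x 0 0 * x 1 1 - x 0 1 * x 1 0 by rewrite {1}[x]mx22_eta det_mx22.
split.
  transitivity (x 0 0 * (x 0 0 + T * x 1 0) - x 1 0 * - (N * x 1 0)).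
    by rewrite /norm_form; ring.
  by rewrite -h1 -h2 dx; ring.
transitivity (x 0 1 * (x 0 1 + T * x 1 1) - x 1 1 * - (N * x 1 1)).
  by rewrite /norm_form; ring.
by rewrite -h3 -h4 dx; ring.
Qed.

(** By [column_norms], $\det x$ is a norm divided by an off-diagonal entry of [tau_conj], which for
    a suitable column has valuation $-n$. In the split case [eps] is trivial. *)
Lemma level_eps (E : comUnitAlgType F) (conj : {lrmorphism E -> E}) (tau : E) n (x : M2) :
  quadratic_basis conj tau T N ->
  (forall a m, absF a = pi ^+ m -> eps conj a = kap ^+ m) ->
  (kap = 1 -> forall a, a != 0 -> eps conj a = 1 :> R) ->
  level p T N n x -> eps conj (\det x) = kap ^+ n.
Proof.
move=> TN epsp eps1 lx; have xu := level_unit lx.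
have dx0 : \det x != 0 by rewrite -unitfE -unitmxE.
have [[k1 _]|[_ unitP]] := type; first by rewrite eps1// k1 expr1n.
have [a [b [c [d e]]]] : exists a b c d, yy x = mx22 a b c d.
  by do 4 eexists; exact: mx22_eta.
have [a1 b1 c1 d1] := level_scaled lx e.
have [norm1 norm2] := column_norms xu e.
have key (u v z : F) : norm_form u v = \det x * z -> absF (p ^+ n * z) = 1 ->
    eps conj (\det x) = kap ^+ n.
  move=> nuv zn; have z0 : z != 0.
    by apply: contra_eq_neq zn => ->; rewrite mulr0 absF0 eq_sym oner_neq0.
  rewrite -[\det x](mulfK z0) -nuv -(normEF_basis TN) (@epsM_norm _ _ _ _ _ _ _ _ _ TN); last first.
    by rewrite (normEF_basis TN) nuv mulf_neq0.
  apply: epsp; rewrite absFV; apply: (mulIf (_ : absF z != 0)); rewrite ?absF_neq0//.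
  by rewrite mulVf ?absF_neq0// -absFX -absFM.
case: n lx a1 b1 c1 d1 key => [|n] lx a1 b1 c1 d1 key.
  rewrite expr0 !mul1r in a1 b1 c1 d1.
  have [tr det] := tau_conj_trdet xu e.
  apply: key norm2 _; rewrite expr0 mul1r absFN.
  by apply: (@inert_upper_right_unit _ _ a b c d a1 b1 c1); rewrite tr det.
have [bu|cu] := level_attained ps T1 N1 lx e; last exact: key norm1 cu.
by apply: key norm2 _; rewrite mulrN absFN.
Qed.

Lemma torus_mx_GL2O a b : absF a <= 1 -> absF b <= 1 -> absF (norm_form a b) = 1 ->
  GL2O (torus_mx a b).
Proof.
move=> a1 b1 n1; split; last by rewrite det_torus_mx.
by apply/integral_mx22; rewrite absFN absF_le ?absFM_le1.
Qed.

Lemma norm_formM a b c d : norm_form a b * norm_form c d =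
  norm_form (a * c - N * b * d) (a * d + b * c + T * b * d).
Proof. by rewrite /norm_form; ring. Qed.

(** A lattice of level 0 is free over $O_E$: a neighbour of level 1 singles out a vector $z_1$ for
    which $z_1,\tau z_1$ is a basis. This leaves a factor in [GL2O], whose determinant is a norm and
    is moved into the torus. *)
Lemma level0_torus_SL2O (x : M2) : level p T N 0 x ->
  exists a b k, [/\ norm_form a b != 0, SL2O k & x = torus_mx a b *m k].
Proof.
move=> lx; have q1 := residue_card_gt1 ps.
have [r [rO lup]] : exists r, GL2O r /\ level p T N 1 (x *m r *m up_mx p).
  have : (0 < up_neighbours p s T N 0 x)%N.
    rewrite lt0n -(@pnatr_eq0 R) (up_neighbours0 ps type lx) subr_eq0.
    case: type => -[-> _]; first by rewrite -[1]/(1%:R) eqr_nat neq_ltn q1 orbT.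
    by rewrite gt_eqF// (@lt_le_trans _ _ 0) ?ltrN10.
  rewrite /up_neighbours addn_gt0 => /orP[|].
    by case: asboolP => // h _; exists (weyl_mx); split => //; exact: GL2O_weyl.
  move=> /card_gt0P[j]; rewrite finset.inE => /asboolP h.
  by exists (lower_mx (ssval j)); split=> //; apply: GL2O_lower; exact: residue_int ps j.
set z := x *m r; have lz : level p T N 0 z by exact: level_mulr.
have zu := level_unit lz.
have [a [b [c [d e]]]] : exists a b c d, yy z = mx22 a b c d.
  by do 4 eexists; exact: mx22_eta.
have [a1 b1 c1 d1] := level_scaled lz e.
move: lup => /(level_up ps lz e); rewrite expr0 !mul1r in a1 b1 c1 d1 * => cu.
have c0 : c != 0 by rewrite -(@absF_neq0 R) cu oner_neq0.
have dz0 : \det z != 0 by rewrite -unitfE -unitmxE.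
have [norm1 _] := column_norms zu e; have [h1 h2 _ _] := tau_conj_entries zu e.
(* Since $\tau z_1=az_1+cz_2$, the second column is $z_2=-(a/c)z_1+c^{-1}\tau z_1$. *)
pose m := mx22 1 (- a / c) 0 c^-1.
have zE : z = torus_mx (z 0 0) (z 1 0) *m m.
  rewrite [LHS]mx22_eta mx22M; congr mx22; try by ring.
    by rewrite -h1; field.
  by rewrite -h2; field.
have mO : GL2O m.
  split; last by rewrite det_mx22 mul1r mulr0 subr0 absFV cu invr1.
  by apply/integral_mx22; split; rewrite ?absFM ?absFV ?absFN ?cu ?invr1 ?mulr1 ?absF1 ?absF0.
have kO := GL2OM mO (GL2O_inv rO); set k := m *m invmx r in kO.
have xE : x = torus_mx (z 0 0) (z 1 0) *m k.
  by rewrite /k mulmxA -zE /z mulmxK// GL2O_unit.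
have [a' [b' [a1' b1' nk]]] := unit_norm_form ps T1 N1 type kO.2.
have tO : GL2O (torus_mx a' b').
  by apply: torus_mx_GL2O; rewrite // nk; exact: kO.2.
have tu := GL2O_unit tO.
set z0 := z 0 0 in norm1 xE *; set z1 := z 1 0 in norm1 xE *.
exists (z0 * a' - N * z1 * b'), (z0 * b' + z1 * a' + T * z1 * b').
exists (invmx (torus_mx a' b') *m k); split; last first.
- by rewrite -torus_mxM -mulmxA mulKVmx.
- have [kI _] := GL2OM (GL2O_inv tO) kO; split=> //.
  rewrite /SL2/= det_mulmx det_inv det_torus_mx nk mulVf//.
  by rewrite -(@absF_neq0 R) kO.2 oner_neq0.
rewrite -norm_formM mulf_neq0//; first by rewrite norm1 mulf_neq0.
by rewrite nk -(@absF_neq0 R) kO.2 oner_neq0.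
Qed.

Lemma torus_SL2O_level0 a b k : norm_form a b != 0 -> SL2O k ->
  level p T N 0 (torus_mx a b *m k).
Proof.
move=> n0 /SL2O_GL2O kO; apply/level_mull => //; rewrite -[k]mul1mx; apply: level_mulr => //.
split=> //; first exact: unitmx1.
rewrite expr0 scale1r /tau_conj invmx1 mul1mx mulmx1; apply/integral_mx22.
by rewrite absF0 absFN absF_le ?absFM_le1 ?absF0 ?absF1 ?ler01.
Qed.

Lemma conj_torus_mx (x : M2) a b : x \in unitmx ->
  invmx x *m torus_mx a b *m x = a%:M + b *: yy x.
Proof.
move=> xu; apply: conjmx_eq => //.
rewrite mulmxDr -scalemxAr mul_tau_conj// mul_mx_scalar -mul_scalar_mx scalemxAl -mulmxDl.
by congr (_ *m x); rewrite scalar_mx22 scale_mx22 addmx22; congr mx22; ring.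
Qed.

(** The conjugate is $a+by$ with $y$ the matrix [tau_conj]. As [a] is integral and [b] is a unit
    times $p^m$, it is integral exactly when $p^my$ is. *)
Lemma SL2O_conj_torus (x : M2) a b m n : level p T N n x -> norm_form a b = 1 ->
  absF a <= 1 -> absF b = pi ^+ m ->
  SL2O (invmx x *m torus_mx a b *m x) <-> (n <= m)%N.
Proof.
move=> lx n1 a1 bm; have xu := level_unit lx; rewrite -(level_le_integral ps m lx).
have det1 : \det (invmx x *m torus_mx a b *m x) = 1.
  by rewrite !det_mulmx mulrAC -det_mulmx mulVmx// det1 mul1r det_torus_mx.
pose u := b / p ^+ m; have p0 : p ^+ m != 0 by rewrite expf_neq0// (unif_neq0 ps).
have u1 : absF u = 1 by rewrite absFM absFV absFX bm divff// -absFX absF_neq0.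
have u0 : u != 0 by rewrite -(@absF_neq0 R) u1 oner_neq0.
have bE : b = u * p ^+ m by rewrite /u divfK.
have -> : SL2O (invmx x *m torus_mx a b *m x) <-> integral_mx (a%:M + u *: (p ^+ m *: yy x)).
  by rewrite scalerA -bE -conj_torus_mx//; split=> [[]|].
rewrite [yy x]mx22_eta scale_mx22 scale_mx22 scalar_mx22 addmx22.
split=> /integral_mx22[A B C D]; apply/integral_mx22; rewrite ?add0r in B C *; last first.
  by split; rewrite ?absF_le// absFM u1 mul1r.
rewrite absFM u1 mul1r in B; rewrite absFM u1 mul1r in C.
have key (z : F) : absF (a + u * z) <= 1 -> absF z <= 1.
  move=> h; rewrite -[absF z]mul1r -{1}u1 -absFM.
  rewrite (_ : u * z = (a + u * z) - a); last by ring.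
  exact: absF_leB.
by split=> //; exact: key.
Qed.

(** Split case: the two coordinates have product 1 and integral sum, so both are integral, and their
    difference is $b$ times a unit. Inert case: the norm has absolute value $\max(|a|,|b|)^2$. *)
Lemma integral_conj_torus (x : M2) a b : x \in unitmx -> norm_form a b = 1 ->
  integral_mx (invmx x *m torus_mx a b *m x) -> absF a <= 1 /\ absF b <= 1.
Proof.
move=> xu n1 int; have tr1 : absF (2%:R * a + T * b) <= 1.
  have -> : 2%:R * a + T * b = \tr (invmx x *m torus_mx a b *m x).
    rewrite mxtrace_mulC mulKVmx// /mxtrace big_ord_recl big_ord1.
    by rewrite (_ : lift ord0 ord0 = 1) ?mx22E; [ring|exact: val_inj].
  rewrite /mxtrace big_ord_recl big_ord1; apply: absF_le; exact: int.
have [[_ [t1 [t2 [t11 t21 t12 TE NE]]]]|[_ unitP]] := type.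
  have uv : (a + b * t1) * (a + b * t2) = 1.
    by rewrite -n1 /norm_form TE NE; ring.
  have bound (u v : F) : u * v = 1 -> absF (u + v) <= 1 -> absF u <= 1.
    move=> uv1 uv2; rewrite leNgt; apply/negP => u1; move: uv2; apply/negP; rewrite -ltNge.
    suff v1 : absF v < absF u by rewrite absFD_dom.
    have u0 : 0 < absF u by exact: lt_trans ltr01 u1.
    apply: lt_trans (u1).
    by rewrite -(ltr_pM2l u0) -absFM uv1 absF1 mulr1.
  have uv2 : absF ((a + b * t1) + (a + b * t2)) <= 1.
    by rewrite [X in absF X](_ : _ = 2%:R * a + T * b)// TE; ring.
  have u1 := bound _ _ uv uv2.
  have v1 : absF (a + b * t2) <= 1 by apply: (bound _ (a + b * t1)); [rewrite mulrC|rewrite addrC].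
  have b1 : absF b <= 1.
    rewrite -[leLHS]mulr1 -{1}t12 -absFM (_ : _ * _ = (a + b * t1) - (a + b * t2)); last by ring.
    exact: absF_leB.
  split=> //; rewrite -[a](addrK (b * t1)) absF_leB// absFM_le1//.
have [ab|ba] := leP (absF a) (absF b).
  have [b0|b0] := eqVneq b 0.
    by move: ab; rewrite b0 absF0 => a0; split; rewrite ?ler01 ?(le_trans a0 ler01).
  have : absF (b ^+ 2) = 1.
    rewrite -[RHS](@absF1 _ F) -n1 (_ : norm_form a b = b ^+ 2 * ((a / b) ^+ 2 + T * (a / b) + N)).
      by rewrite [RHS]absFM unitP ?mulr1// absFM absFV ler_pdivrMr ?mul1r// absF_gt0.
    by rewrite /norm_form; field.
  by move=> /absF_sqr1 b1; split; rewrite ?(le_trans ab) ?b1.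
have a0 : a != 0 by rewrite -(@absF_gt0 R) (le_lt_trans _ ba).
have z1 : absF (b / a) < 1 by rewrite absFM absFV ltr_pdivrMr ?mul1r// absF_gt0.
have : absF (a ^+ 2) = 1.
  rewrite -[RHS](@absF1 _ F) -n1 (_ : norm_form a b = a ^+ 2 * (1 + (T + N * (b / a)) * (b / a))).
    rewrite [RHS]absFM absFD_dom ?absF1 ?mulr1// absFM_lt1r// absF_le// absFM_le1//.
    exact: ltW.
  by rewrite /norm_form; field.
by move=> /absF_sqr1 a1; split; rewrite ?(le_trans (ltW ba)) ?a1.
Qed.

End TorusOrbits.

(** * Topology of matrices and coset spaces *)

Section Topology.
Context {R : realType} {F : naLocalFieldType R}.
Local Notation M2 := 'M[F]_2.

Lemma nbhs_absFP (x : F) (A : set F) :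
  nbhs x A <-> exists2 e : R, 0 < e & forall y, absF (x - y) < e -> A y.
Proof.
by rewrite -nbhs_ballE; split=> -[e e0 h]; exists e.
Qed.

Lemma nbhs_mxP (x : M2) (A : set M2) : nbhs x A <->
  exists2 e : R, 0 < e & forall y : M2, (forall i j, absF (x i j - y i j) < e) -> A y.
Proof.
rewrite -nbhs_ballE; split=> -[e e0 h]; exists e => // y.
  by move=> xy; apply: h; split=> // i j; rewrite ballEmdist; exact: xy.
by move=> [_ xy]; apply: h => i j; have := xy i j; rewrite ballEmdist.
Qed.

Lemma continuousFP (X : topologicalType) (f : X -> F) : continuous f <->
  forall x (e : R), 0 < e -> \forall y \near x, absF (f x - f y) < e.
Proof.
split=> [cf x e e0|h x A /nbhs_absFP[e e0 eA]]; last first.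
  by apply: filterS (h x e e0) => y; exact: eA.
by apply: (cf x [set z | absF (f x - z) < e]); apply/nbhs_absFP; exists e.
Qed.

Lemma continuousFD (X : topologicalType) (f g : X -> F) :
  continuous f -> continuous g -> continuous (fun x => f x + g x).
Proof.
move=> /continuousFP cf /continuousFP cg; apply/continuousFP => x e e0.
apply: filterS2 (cf x e e0) (cg x e e0) => y fy gy.
rewrite (_ : _ - _ = (f x - f y) + (g x - g y)); last by ring.
exact: absF_lt.
Qed.

Lemma continuousFN (X : topologicalType) (f : X -> F) :
  continuous f -> continuous (fun x => - f x).
Proof.
move=> /continuousFP cf; apply/continuousFP => x e e0.
by apply: filterS (cf x e e0) => y fy; rewrite -opprD absFN.
Qed.

Lemma continuousFM (X : topologicalType) (f g : X -> F) :
  continuous f -> continuous g -> continuous (fun x => f x * g x).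
Proof.
move=> /continuousFP cf /continuousFP cg; apply/continuousFP => x e e0.
pose r := 1 + absF (f x) + absF (g x).
have r0 : 0 < r by rewrite /r -addrA ltr_wpDr ?addr_ge0.
have d0 : 0 < e / r by rewrite divr_gt0.
have near1 := cf x 1 ltr01; near=> y.
have fy : absF (f x - f y) < e / r by near: y; exact: cf.
have gy : absF (g x - g y) < e / r by near: y; exact: cg.
have gy1 : absF (g x - g y) < 1 by near: y; exact: cg.
rewrite (_ : _ - _ = f x * (g x - g y) + (f x - f y) * g y); last by ring.
have gyr : absF (g y) < r.
  rewrite -(subKr (g x) (g y)); apply: absF_ltB.
    by rewrite /r ltrDr ltr_wpDr.
  apply: lt_le_trans gy1 _; rewrite /r -addrA lerDl addr_ge0//.
have e_r : e = r * (e / r) by rewrite mulrC divfK// gt_eqF.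
apply: absF_lt; rewrite absFM [ltRHS]e_r; last by rewrite mulrC ltr_pM.
apply: le_lt_trans (_ : r * absF (g x - g y) < _).
  by rewrite ler_wpM2r// /r addrAC lerDr addr_ge0.
by rewrite ltr_pM2l.
Unshelve. all: by end_near. Qed.

Lemma coordF_continuous i j : continuous (fun x : M2 => x i j).
Proof.
by apply/continuousFP => x e e0; apply/nbhs_mxP; exists e.
Qed.

Lemma mx_continuous (X : topologicalType) (f : X -> M2) :
  (forall i j, continuous (fun x => f x i j)) -> continuous f.
Proof.
move=> cf x A /nbhs_mxP[e e0 eA].
have near i j : \forall y \near x, absF (f x i j - f y i j) < e.
  by have /continuousFP := cf i j; exact.
near=> y; apply: eA; do 2 apply: ord2P; near: y; exact: near.
Unshelve. all: by end_near. Qed.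

Lemma mulmx2E (x y : M2) i j : (x *m y) i j = x i 0 * y 0 j + x i 1 * y 1 j.
Proof.
by rewrite mxE big_ord_recl big_ord1 (_ : lift ord0 ord0 = 1)//; exact: val_inj.
Qed.

Lemma det_mx2 (x : M2) : \det x = x 0 0 * x 1 1 - x 0 1 * x 1 0.
Proof. by rewrite {1}[x]mx22_eta det_mx22. Qed.

Lemma det_continuous : continuous (fun x : M2 => \det x).
Proof.
rewrite (_ : (fun x : M2 => \det x) = fun x => x 0 0 * x 1 1 + - (x 0 1 * x 1 0)).
  apply: continuousFD; [|apply: continuousFN];
    by apply: continuousFM; exact: coordF_continuous.
by apply/funext => x; rewrite det_mx2.
Qed.

Lemma mulmx_continuousl (k : M2) : continuous (fun x : M2 => k *m x).
Proof.
apply: mx_continuous => i j; under eq_fun do rewrite mulmx2E.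
by apply: continuousFD; apply: continuousFM;
  (exact: cst_continuous || exact: coordF_continuous).
Qed.

Lemma mulmx_continuousr (k : M2) : continuous (fun x : M2 => x *m k).
Proof.
apply: mx_continuous => i j; under eq_fun do rewrite mulmx2E.
by apply: continuousFD; apply: continuousFM;
  (exact: cst_continuous || exact: coordF_continuous).
Qed.

Lemma open_integersF : open (@integersF R F).
Proof.
rewrite openE => x x1; apply/nbhs_absFP; exists 1 => // y xy.
by rewrite /integersF/= -(subKr x y) absF_leB// ltW.
Qed.

Lemma closed_integersF : closed (@integersF R F).
Proof.
rewrite -openC openE => x /negP; rewrite -ltNge => x1; apply/nbhs_absFP.
exists 1 => // y xy; apply/negP; rewrite -ltNge -(subKr x y) absFD_dom// absFN.
exact: lt_trans x1.
Qed.

Lemma open_unitsF : open [set x : F | absF x = 1].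
Proof.
rewrite openE => x /= x1; apply/nbhs_absFP; exists 1 => // y xy /=.
by apply: (absF_near_unit x1); rewrite absFB.
Qed.

Lemma closed_point (a : F) : closed [set a].
Proof.
rewrite -openC openE => x /= /eqP xa; apply/nbhs_absFP.
exists (absF (x - a)) => [|y xy ya]; first by rewrite absF_gt0 subr_eq0.
by move: xy; rewrite ya ltxx.
Qed.

Lemma open_nonzero : open [set x : F | x != 0].
Proof.
have := @closed_point 0; rewrite -openC; congr open.
by apply/seteqP; split=> x /= /eqP.
Qed.

Lemma open_GL2 : open (@GL2 R F).
Proof.
rewrite (_ : GL2 = (fun x : M2 => \det x) @^-1` [set x | x != 0]).
  exact: (continuousP _).1 det_continuous _ open_nonzero.
by apply/seteqP; split=> x; rewrite /GL2/= unitmxE unitfE.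
Qed.

Lemma closed_SL2 : closed (@SL2 R F).
Proof. exact: (continuous_closedP _).1 det_continuous _ (@closed_point 1). Qed.

Lemma integral_mxE : [set x : M2 | integral_mx x] =
  \bigcap_(ij in [set: 'I_2 * 'I_2]) [set x : M2 | integersF (x ij.1 ij.2)].
Proof.
by apply/seteqP; split=> x /= h => [[i j] _|i j]; [exact: h|exact: (h (i, j))].
Qed.

Lemma closed_integral_mx : closed [set x : M2 | integral_mx x].
Proof.
rewrite integral_mxE; apply: closed_bigI => -[i j] _ /=.
exact: (continuous_closedP _).1 (@coordF_continuous i j) _ closed_integersF.
Qed.

Lemma open_integral_mx : open [set x : M2 | integral_mx x].
Proof.
rewrite (_ : [set x : M2 | integral_mx x] =
    ((fun x : M2 => x 0 0) @^-1` integersF `&` (fun x : M2 => x 0 1) @^-1` integersF) `&`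
    ((fun x : M2 => x 1 0) @^-1` integersF `&` (fun x : M2 => x 1 1) @^-1` integersF)).
  by do 2 apply: openI;
    exact: (continuousP _).1 (@coordF_continuous _ _) _ open_integersF.
apply/seteqP; split=> x /=; first by move=> h; do 2 split; exact: h.
by move=> [[h1 h2] [h3 h4]]; do 2 apply: ord2P.
Qed.

Lemma open_GL2O : open (@GL2O R F).
Proof.
apply: openI open_integral_mx _.
exact: (continuousP _).1 det_continuous _ open_unitsF.
Qed.

Lemma SL2OE : SL2O = [set x : M2 | integral_mx x] `&` SL2.
Proof. by apply/seteqP; split=> x [? ?]; split. Qed.

(** The translate of [GL2O] by [x] on the left is an open neighbourhood of [x]. *)
Lemma open_right_GL2O (X : set M2) : X `<=` GL2 ->
  (forall x k, X x -> GL2O k -> X (x *m k)) -> open X.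
Proof.
move=> XG XK; rewrite openE => x Xx; have xu : x \in unitmx by exact: XG.
rewrite /interior nbhsE; exists ((fun y : M2 => invmx x *m y) @^-1` GL2O) => /=.
  split; first exact: (continuousP _).1 (@mulmx_continuousl _) _ open_GL2O.
  rewrite /preimage/= mulVmx//; split; last by rewrite det1 absF1.
  by rewrite scalar_mx22; apply/integral_mx22; rewrite absF0 absF1 ler01 lexx.
by move=> y /(XK _ _ Xx); rewrite mulKVmx.
Qed.

Variables (p : F) (s : seq F).
Hypothesis ps : uniformizer_residues p s.
Local Notation pi := (absF p).

(** A class modulo $p^n$ splits into finitely many classes modulo $p^{n+1}$, and an ultrafilter must
    select one of them. *)
Lemma ultra_residues (T : Type) (U : set_system T) (f : T -> F) (n : nat) :
  UltraFilter U -> U [set x | absF (f x) <= 1] ->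
  exists c, U [set x | absF (f x - c) <= pi ^+ n].
Proof.
move=> UU U1; have FU : Filter U by typeclasses eauto.
elim: n => [|n [c Uc]].
  by exists 0; apply: filterS U1 => x /=; rewrite subr0 expr0.
have [res hres] := residue_map ps.
have [[j Uj]|nU] := pselect (exists j : seq_sub s,
    U [set x | absF (f x - (c + p ^+ n * ssval j)) <= pi ^+ n.+1]).
  by exists (c + p ^+ n * ssval j).
exfalso; have : U (\bigcap_(j in [set: seq_sub s])
    ~` [set x | absF (f x - (c + p ^+ n * ssval j)) <= pi ^+ n.+1]).
  apply: filterS (filter_forall (f := fun j : seq_sub s =>
    ~` [set x | absF (f x - (c + p ^+ n * ssval j)) <= pi ^+ n.+1]) FU _).
    by move=> x h j _; exact: h.
  move=> j; have [Uj|//] := in_ultra_setVsetC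
    [set x | absF (f x - (c + p ^+ n * ssval j)) <= pi ^+ n.+1] UU.
  by case: nU; exists j.
move=> /(filterI Uc) /filter_ex[x [/= xc xj]].
have pn0 : p ^+ n != 0 by rewrite expf_neq0// (unif_neq0 ps).
pose z := (f x - c) / p ^+ n; have z1 : absF z <= 1.
  by rewrite absFM absFV absFX ler_pdivrMr ?mul1r// exprn_gt0// (unif_gt0 ps).
apply: (xj (res z) I) => /=.
rewrite (_ : _ - _ = p ^+ n * (z - ssval (res z))); last by rewrite /z; field.
rewrite absFM absFX exprSr ler_wpM2l ?exprn_ge0//; apply: unif_max ps _ _.
exact: hres.
Qed.

(** The classes selected by an ultrafilter form a Cauchy sequence for each entry, and completeness
    provides the limit. *)
Lemma compact_integral_mx : compact [set x : M2 | integral_mx x].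
Proof.
rewrite compact_ultra => U UU Uint; have FU : Filter U by typeclasses eauto.
have lim i j : exists l : F, forall n, U [set x : M2 | absF (x i j - l) <= pi ^+ n].
  have Uij : U [set x : M2 | absF (x i j) <= 1] by apply: filterS Uint => x; exact.
  have [c Uc] := boolp.choice (fun n => ultra_residues n UU Uij).
  have cc m n : absF (c m - c n) <= Num.max (pi ^+ m) (pi ^+ n).
    have /filter_ex[x /= [xm xn]] : U ([set x : M2 | absF (x i j - c m) <= pi ^+ m] `&`
        [set x : M2 | absF (x i j - c n) <= pi ^+ n]) by exact: filterI.
    rewrite (_ : _ - _ = (x i j - c n) - (x i j - c m)); last by ring.
    by apply: absF_leB; rewrite le_max ?xm ?xn ?orbT.
  have mono m n : (m <= n)%N -> pi ^+ n <= pi ^+ m.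
    by move=> mn; rewrite ler_wiXn2l// ltW// (unif_lt1 ps).
  have [e e0|l hl] := @absF_complete _ F c.
    have [n ne] := unif_expn_small ps e0; exists n => k m nk nm.
    apply: le_lt_trans (cc k m) _.
    by rewrite gt_max !(le_lt_trans (mono _ _ _) ne).
  exists l => n; apply: filterS (Uc n) => x /= xn.
  have [|m hm] := hl (pi ^+ n); first by rewrite exprn_gt0// (unif_gt0 ps).
  rewrite (_ : _ - _ = (x i j - c n) + (c n - c (maxn m n)) + (c (maxn m n) - l)); last by ring.
  apply: absF_le; last by apply: ltW; apply: hm; exact: leq_maxl.
  apply: absF_le => //; apply: le_trans (cc _ _) _.
  by rewrite ge_max lexx mono// leq_maxr.
have [l hl] : exists l : 'I_2 -> 'I_2 -> F,
    forall i j n, U [set x : M2 | absF (x i j - l i j) <= pi ^+ n].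
  have [l hl] := boolp.choice (fun ij : 'I_2 * 'I_2 => lim ij.1 ij.2).
  by exists (fun i j => l (i, j)) => i j n; exact: (hl (i, j)).
exists (\matrix_(i, j) l i j); split.
  move=> i j; rewrite /integersF/= mxE.
  have /filter_ex[x /= [xi xl]] : U ([set x : M2 | integral_mx x] `&`
      [set x : M2 | absF (x i j - l i j) <= pi ^+ 0]) by exact: filterI.
  by rewrite -(subKr (x i j) (l i j)) absF_leB//; exact: xi.
move=> A /nbhs_mxP[e e0 eA].
have [n ne] := unif_expn_small ps e0.
have : U (\bigcap_(ij in [set: 'I_2 * 'I_2])
    [set x : M2 | absF (x ij.1 ij.2 - l ij.1 ij.2) <= pi ^+ n]).
  apply: filterS (filter_forall (f := fun ij : 'I_2 * 'I_2 =>
    [set x : M2 | absF (x ij.1 ij.2 - l ij.1 ij.2) <= pi ^+ n]) FU _).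
    by move=> x h j _; exact: h.
  by move=> -[i j]; exact: hl.
apply: filterS => x h; apply: eA => i j; rewrite mxE absFB.
by apply: le_lt_trans ne; exact: (h (i, j) I).
Qed.

Lemma compact_SL2O : compact (@SL2O R F).
Proof. by rewrite SL2OE; exact: compact_closedI compact_integral_mx closed_SL2. Qed.

Variables (T N : F).
Lemma open_level n : open (level p T N n).
Proof.
by apply: open_right_GL2O => [x /level_unit//|x k lx kO]; exact: level_mulr.
Qed.

End Topology.

(** * Coset spaces and their Borel sets *)

Section CosetSpace.
Context {R : realType} {F : naLocalFieldType R}.
Local Notation M2 := 'M[F]_2.
Variable H : set M2.
Hypothesis H1 : H 1%:M.
Hypothesis HM : forall a b, H a -> H b -> H (a *m b).
Hypothesis HV : forall a, H a -> a \in unitmx /\ H (invmx a).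

Lemma coset_eqP (x y : M2) : coset H x = coset H y <-> exists2 h, H h & x = h *m y.
Proof.
have -> : coset H x = coset H y <-> [set h *m x | h in H] = [set h *m y | h in H].
  split=> [|e].
    by move=> /(@eqquotP _ (same_coset_rel H)) /asboolP.
  by apply/(@eqquotP _ (same_coset_rel H)); apply/asboolP.
split=> [e|[h Hh ->]].
  have : [set h *m x | h in H] x by exists 1%:M; rewrite // mul1mx.
  by rewrite e => -[h Hh <-]; exists h.
have [hu Hh'] := HV Hh.
apply/seteqP; split=> _ [g Hg <-].
  by exists (g *m h); rewrite ?mulmxA//; exact: HM.
exists (g *m invmx h); first exact: HM.
by rewrite mulmxA mulmxKV.
Qed.

Lemma coset_rep (c : coset_space H) : coset H (rep c) = c.
Proof. exact: reprK. Qed.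

(** Such sets are unions of cosets, so they can be recovered from their image in [coset_space H]. *)
Definition saturated (X : set M2) := forall h x, H h -> X x -> X (h *m x).

Lemma mem_coset_image (X : set M2) x : saturated X -> (coset H @` X) (coset H x) <-> X x.
Proof.
move=> sX; split=> [[y Xy /coset_eqP[h Hh e]]|Xx]; last by exists x.
have [hu Hh'] := HV Hh.
by rewrite -(mulKmx hu x) -e; exact: sX.
Qed.

Lemma preimage_coset_image (X : set M2) : saturated X -> coset H @^-1` (coset H @` X) = X.
Proof. by move=> sX; apply/seteqP; split=> x /mem_coset_image; apply. Qed.

Lemma mem_coset_image_rep (X : set M2) (c : coset_space H) : saturated X ->
  (coset H @` X) c <-> X (rep c).
Proof. by move=> sX; rewrite -{1}(coset_rep c); exact: mem_coset_image. Qed.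

Lemma open_coset_image (X : set M2) : saturated X -> open X ->
  open (coset H @` X : set (coset_space H)).
Proof. by move=> sX; rewrite -{1}(preimage_coset_image sX). Qed.

Lemma measurable_open (X : ptopologicalType) (A : set X) : open A ->
  measurable (A : set (borel X)).
Proof. by move=> oA; exact: sub_sigma_algebra. Qed.

Lemma measurable_closed (X : ptopologicalType) (A : set X) : closed A ->
  measurable (A : set (borel X)).
Proof.
move=> cA; rewrite -[A]setCK; apply: measurableC; apply: measurable_open.
by rewrite openC.
Qed.

Lemma closed_coset_image (X : set M2) : saturated X -> saturated (~` X) -> closed X ->
  closed (coset H @` X : set (coset_space H)).
Proof.
move=> sX sX' cX; rewrite -openC.
rewrite (_ : ~` _ = coset H @` (~` X)); first by apply: open_coset_image => //; rewrite openC.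
apply/seteqP; split=> c => [nc|/(mem_coset_image_rep c sX') h /(mem_coset_image_rep c sX)//].
by apply/(mem_coset_image_rep c sX') => Xr; apply/nc/(mem_coset_image_rep c sX).
Qed.

End CosetSpace.

(** * Integrals of finite combinations of indicators *)

Section Multiplicity.
Local Open Scope ereal_scope.

(** Integrates a pointwise count. [Z0] stands apart as the one neighbour outside the family indexed
    by residues. *)
Lemma measure_multiplicity d (T : measurableType d) (R : realType)
    (mu : {measure set T -> \bar R}) (J : finType) (Z0 A : set T) (Z : J -> set T) (k : R) :
  measurable Z0 -> (forall j, measurable (Z j)) -> measurable A -> (0 <= k)%R ->
  (forall x, \1_Z0 x + \sum_j \1_(Z j) x = k * \1_A x)%R ->
  mu Z0 + \sum_j mu (Z j) = k%:E * mu A.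
Proof.
move=> mZ0 mZ mA k0 e.
have ind (B : set T) : measurable B -> \int[mu]_x (\1_B x)%:E = mu B.
  by move=> mB; rewrite integral_indic// setIT.
rewrite -(ind _ mZ0) -(ind _ mA); under eq_bigr do rewrite -(ind _ (mZ _)).
rewrite -ge0_integralZl_EFin//; last by apply/measurable_EFinP; exact: measurable_indic.
rewrite -ge0_integral_sum//; last by move=> j; apply/measurable_EFinP; exact: measurable_indic.
rewrite -ge0_integralD//.
- by apply: eq_integral => x _; rewrite sumEFin -EFinD e.
- by apply/measurable_EFinP; exact: measurable_indic.
- by move=> x _; apply: sume_ge0 => j _; rewrite lee_fin.
- by apply: emeasurable_sum => j; apply/measurable_EFinP; exact: measurable_indic.
Qed.

(** The coefficients are signed when [kap] is $-1$, so additivity is obtained from integrability. *)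
Lemma integral_simple d (T : measurableType d) (R : realType)
    (mu : {measure set T -> \bar R}) (D : set T) (m : nat) (A : nat -> set T) (c : nat -> R) :
  measurable D -> (forall n, measurable (A n)) -> (forall n, A n `<=` D) ->
  (forall n, mu (A n) < +oo) ->
  \int[mu]_(x in D) (\sum_(0 <= n < m) c n * \1_(A n) x)%:E =
  \sum_(0 <= n < m) (c n)%:E * mu (A n).
Proof.
move=> mD mA AD fin.
have ind n : \int[mu]_(x in D) (\1_(A n) x)%:E = mu (A n).
  by rewrite integral_indic// setIidl.
have mind n : measurable_fun D (fun x => (\1_(A n) x)%:E : \bar R).
  by apply/measurable_EFinP; exact: measurable_indic.
have int n : mu.-integrable D (fun x => (\1_(A n) x)%:E : \bar R).
  apply/integrableP; split; first exact: mind.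
  rewrite (eq_integral (fun x => (\1_(A n) x)%:E)) ?ind// => x _.
  by rewrite gee0_abs// lee_fin.
transitivity (\int[mu]_(x in D) (\sum_(0 <= n < m) (c n)%:E * (\1_(A n) x)%:E)).
  by apply: eq_integral => x _; rewrite -sumEFin; apply: eq_bigr => n _; rewrite EFinM.
rewrite integral_sum//; last by move=> n; exact: (integrableZl mD _ (int n)).
by apply: eq_bigr => n _; rewrite (integralZl mD (int n)) ind.
Qed.

End Multiplicity.

Section TorusGroups.
Context {R : realType} {F : naLocalFieldType R} {E : comUnitAlgType F}.
Local Notation M2 := 'M[F]_2.
Variables (conj : {lrmorphism E -> E}) (tau : E) (T N : F).
Hypothesis TN : quadratic_basis conj tau T N.
Hypothesis tau_gen : integral_generator conj tau.
Hypotheses (T1 : absF T <= 1) (N1 : absF N <= 1).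

Lemma torusGL1 : torusGL tau 1%:M.
Proof.
apply/(torusGLP TN); exists 1, 0; split; last first.
  by rewrite /torus_mx scalar_mx22; congr mx22; ring.
by rewrite /norm_form expr1n expr0n /= !mulr0 !addr0 oner_neq0.
Qed.

Lemma torusGLM a b : torusGL tau a -> torusGL tau b -> torusGL tau (a *m b).
Proof.
move=> /(torusGLP TN)[x [y [xy ->]]] /(torusGLP TN)[z [t [zt ->]]].
by rewrite torus_mxM; apply/(torusGLP TN); do 2 eexists; split => //;
  rewrite -norm_formM mulf_neq0.
Qed.

Lemma torusGLV a : torusGL tau a -> a \in unitmx /\ torusGL tau (invmx a).
Proof.
move=> /(torusGLP TN)[x [y [xy ->]]]; have e := torus_mx_inv xy.
have [u _] := mulmx1_unit e; split=> //.
rewrite -[invmx _]mulmx1 -e mulKmx//; apply/(torusGLP TN); do 2 eexists; split => //.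
rewrite -(@det_torus_mx _ _ T N); apply: contra_eq_neq e => d0.
by apply/eqP => /(congr1 determinant)/eqP; rewrite det_mulmx d0 mulr0 det1 eq_sym oner_eq0.
Qed.

Lemma torus1 : torus tau 1%:M.
Proof. by split; [exact: torusGL1|rewrite /SL2/= det1]. Qed.

Lemma torusM a b : torus tau a -> torus tau b -> torus tau (a *m b).
Proof.
move=> [ta sa] [tb sb]; split; first exact: torusGLM.
by rewrite /SL2/= det_mulmx sa sb mulr1.
Qed.

Lemma torusV a : torus tau a -> a \in unitmx /\ torus tau (invmx a).
Proof.
move=> [/torusGLV[au ta] sa]; split=> //; split => //.
by rewrite /SL2/= det_inv sa invr1.
Qed.

Lemma torusC a b : torus tau a -> torus tau b -> a *m b = b *m a.
Proof.
move=> /(torusP TN)[x [y [_ ->]]] /(torusP TN)[z [t [_ ->]]].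
by rewrite !torus_mxM; congr torus_mx; ring.
Qed.

(** A matrix is that of some $a+b\tau$ exactly when its first column determines the second by two
    linear equations. *)
Lemma closed_torus : closed (torus tau).
Proof.
rewrite (_ : torus tau = SL2 `&` ((fun x : M2 => x 0 1 + N * x 1 0) @^-1` [set 0] `&`
    (fun x : M2 => x 1 1 + - (x 0 0 + T * x 1 0)) @^-1` [set 0])).
  apply: closedI closed_SL2 _; apply: closedI;
    apply: (continuous_closedP _).1 _ _ (@closed_point _ _ 0).
    apply: continuousFD; first exact: coordF_continuous.
    by apply: continuousFM; [exact: cst_continuous|exact: coordF_continuous].
  apply: continuousFD; first exact: coordF_continuous.
  apply: continuousFN; apply: continuousFD; first exact: coordF_continuous.
  by apply: continuousFM; [exact: cst_continuous|exact: coordF_continuous].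
apply/seteqP; split=> x.
  move=> /(torusP TN)[a [b [n1 ->]]]; split; first by rewrite /SL2/= det_torus_mx.
  by split; rewrite /preimage/= !mx22E ?addNr ?subrr.
move=> [sx [/= /eqP + /eqP]]; rewrite addr_eq0 subr_eq0 => /eqP e1 /eqP e2.
have xE : x = torus_mx T N (x 0 0) (x 1 0) by rewrite [LHS]mx22_eta e1 e2.
apply/(torusP TN); exists (x 0 0), (x 1 0); split => //.
by rewrite -det_torus_mx -xE.
Qed.

Lemma closed_torusO : closed (torusO conj tau).
Proof.
rewrite (_ : torusO conj tau = torus tau `&` [set x | integral_mx x]).
  exact: closedI closed_torus closed_integral_mx.
by apply/seteqP; split=> x /(torusO_integral TN tau_gen T1 N1).
Qed.

End TorusGroups.

(** * Measures of the levels *)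

Section QuotientMeasures.
Context {R : realType} {F : naLocalFieldType R} {E : comUnitAlgType F}.
Local Notation M2 := 'M[F]_2.
Variables (conj : {lrmorphism E -> E}) (tau : E) (p : F) (s : seq F) (T N : F) (kap : R).
Hypothesis ps : uniformizer_residues p s.
Hypothesis TN : quadratic_basis conj tau T N.
Hypothesis tau_gen : integral_generator conj tau.
Hypotheses (T1 : absF T <= 1) (N1 : absF N <= 1) (type : unramified_type T N kap).
Variables (muG muT : {measure set (borel M2) -> \bar R})
  (nu : {measure set (borel (coset_space (torus tau))) -> \bar R})
  (mu : {measure set (borel (coset_space (torusGL tau))) -> \bar R}).
Hypotheses (muG_norm : muG SL2O = 1%E)
  (muT_haar : is_haar (torus tau) muT) (muT_norm : muT (torusO conj tau) = 1%E)
  (nu_quotient : is_quotient_measure SL2 muG muT nu)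
  (mu_extends : extends_measure SL2 nu mu)
  (mu_invariant : right_invariant GL2 mu).
Local Notation TS := (torus tau).
Local Notation TG := (torusGL tau).
Local Notation pi := (absF p).
Local Notation level := (level p T N).

Let TS1 := torus1 TN.
Let TSM := torusM TN.
Let TSV := torusV TN.
Let TG1 := torusGL1 TN.
Let TGM := torusGLM TN.
Let TGV := torusGLV TN.

(** The saturation of [SL2O], with the same image in the coset space. *)
Definition torus_SL2O : set M2 := [set x | exists t k, [/\ TS t, SL2O k & x = t *m k]].

Lemma SL2_mul (x y : M2) : SL2 x -> SL2 y -> SL2 (x *m y).
Proof. by rewrite /SL2/= det_mulmx => -> ->; rewrite mulr1. Qed.

Lemma SL2_mulK (x y : M2) : SL2 x -> SL2 (x *m y) -> SL2 y.
Proof. by rewrite /SL2/= det_mulmx => ->; rewrite mul1r. Qed.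

Lemma torus_SL2 (t : M2) : TS t -> SL2 t. Proof. by case. Qed.

Lemma saturated_torus_SL2O : saturated TS torus_SL2O.
Proof.
move=> h _ Hh [t [k [tt kk ->]]]; exists (h *m t), k; split; rewrite ?mulmxA//.
exact: TSM.
Qed.

Lemma saturated_SL2 : saturated TS SL2.
Proof. by move=> h x /torus_SL2 hs; exact: SL2_mul. Qed.

Lemma saturated_notSL2 : saturated TS (~` SL2).
Proof. by move=> h x /torus_SL2 hs nx /(SL2_mulK hs). Qed.

Lemma torus_SL2O_SL2 : torus_SL2O `<=` SL2.
Proof. by move=> _ [t [k [/torus_SL2 tt [kk _] ->]]]; exact: SL2_mul. Qed.

(** An open saturated set that cuts [torus_SL2O] out of the closed set [SL2], which makes the image
    of [SL2O] a Borel set. *)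
Definition torus_GL2O : set M2 := [set x | exists t k, [/\ TS t, GL2O k & x = t *m k]].

Lemma saturated_torus_GL2O : saturated TS torus_GL2O.
Proof.
move=> h _ Hh [t [k [tt kk ->]]]; exists (h *m t), k; split; rewrite ?mulmxA//.
exact: TSM.
Qed.

Lemma torus_SL2OE : torus_SL2O = SL2 `&` torus_GL2O.
Proof.
apply/seteqP; split=> [x xk|x [sx [t [k [tt kk xE]]]]].
  split; first exact: torus_SL2O_SL2.
  by case: xk => t [k [tt kk ->]]; exists t, k; split=> //; exact: SL2O_GL2O.
exists t, k; split=> //; case: kk => kI _; split=> //.
by move: sx; rewrite xE => /(SL2_mulK (torus_SL2 tt)).
Qed.

Lemma open_torus_GL2O : open torus_GL2O.
Proof.
apply: open_right_GL2O => [_ [t [k [/TSV[tu _] /GL2O_unit kk ->]]]|].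
  by rewrite /GL2/= unitmx_mul tu.
move=> _ k' [t [k [tt kk ->]]] kk'; exists t, (k *m k').
by split; rewrite ?mulmxA//; exact: GL2OM.
Qed.

Lemma coset_torus_SL2O : coset TS @` torus_SL2O = coset TS @` SL2O.
Proof.
apply/seteqP; split=> _ [x xk <-]; last first.
  by exists x => //; exists 1%:M, x; split; rewrite ?mul1mx.
case: xk => t [k [tt kk ->]]; exists k => //.
apply/(coset_eqP TS1 TSM TSV); exists (invmx t); first by have [] := TSV tt.
by rewrite mulKmx//; have [] := TSV tt.
Qed.

Lemma measurable_cosets_SL2 : measurable (@cosets R F TS SL2 : set (borel (coset_space TS))).
Proof.
apply: measurable_closed; apply: (closed_coset_image TS1 TSM TSV) => //.
- exact: saturated_SL2.
- exact: saturated_notSL2.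
- exact: closed_SL2.
Qed.

Lemma measurable_coset_SL2O :
  measurable (coset TS @` SL2O : set (borel (coset_space TS))).
Proof.
rewrite -coset_torus_SL2O (_ : _ @` _ = @cosets R F TS SL2 `&` coset TS @` torus_GL2O).
  apply: measurableI; first exact: measurable_cosets_SL2.
  apply: measurable_open; apply: (open_coset_image TS1 TSM TSV).
    exact: saturated_torus_GL2O.
  exact: open_torus_GL2O.
apply/seteqP; split=> c.
  move=> /(mem_coset_image_rep TS1 TSM TSV c saturated_torus_SL2O); rewrite torus_SL2OE => -[h1 h2].
  split; first exact/(mem_coset_image_rep TS1 TSM TSV c saturated_SL2).
  exact/(mem_coset_image_rep TS1 TSM TSV c saturated_torus_GL2O).
move=> [/(mem_coset_image_rep TS1 TSM TSV c saturated_SL2) h1].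
move=> /(mem_coset_image_rep TS1 TSM TSV c saturated_torus_GL2O) h2.
apply/(mem_coset_image_rep TS1 TSM TSV c saturated_torus_SL2O).
by rewrite torus_SL2OE.
Qed.

(** The test function for the quotient formula: continuous because the set of integral matrices is
    open and closed, and equal on [SL2] to the indicator of [SL2O]. *)
Lemma continuous_integral_indic :
  continuous (\1_[set x : M2 | integral_mx x] : M2 -> R).
Proof.
move=> x; have [xi|xi] := pselect (integral_mx x).
  have xn : nbhs x [set y : M2 | integral_mx y].
    by apply: open_nbhs_nbhs; split => //; exact: open_integral_mx.
  move=> A /nbhs_singleton; rewrite indicE mem_set// => A1.
  by apply: filterS xn => y yi; rewrite /= indicE mem_set.
have xn : nbhs x (~` [set y : M2 | integral_mx y]).
  apply: open_nbhs_nbhs; split => //; rewrite openC; exact: closed_integral_mx.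
move=> A /nbhs_singleton; rewrite indicE memNset// => A0.
by apply: filterS xn => y yi; rewrite /= indicE memNset.
Qed.

(** The set is $T(O)t^{-1}$; the torus is commutative, so the left invariance in [is_haar]
    applies. *)
Lemma muT_translate (t : M2) : TS t -> muT [set u | TS u /\ torusO conj tau (u *m t)] = 1%E.
Proof.
move=> tt; have [tu tV] := TSV tt; have [inv _ _] := muT_haar.
rewrite -muT_norm -(inv _ (torusO conj tau : set (borel M2)) tV).
- congr (muT _); apply/seteqP; split=> [u [uT ut]|_ [u uO <-]].
    exists (u *m t) => //; rewrite (torusC TN)//; last exact: TSM.
    by rewrite mulmxK.
  have [uT _] := (torusO_integral TN tau_gen T1 N1 u).1 uO.
  split; first exact: TSM.
  by rewrite -(torusC TN uT)// mulmxKV.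
- by apply: measurable_closed; exact: closed_torusO TN tau_gen T1 N1.
- by move=> u /(torusO_integral TN tau_gen T1 N1)[].
Qed.

(** The [t] for which [t *m rep c] is integral form a translate of $T(O)$ if [c] meets [SL2O], and
    the empty set otherwise. *)
Lemma inner_integral (c : coset_space TS) : @cosets R F TS SL2 c ->
  (\int[muT]_(t in TS) (\1_[set x : M2 | integral_mx x] (t *m rep c))%:E =
   (\1_(coset TS @` SL2O) c)%:E :> \bar R)%E.
Proof.
move=> /(mem_coset_image_rep TS1 TSM TSV c saturated_SL2) cs.
pose X : set M2 := [set t | integral_mx (t *m rep c)].
transitivity (\int[muT]_(t in TS) (\1_X t)%:E)%E.
  by apply: eq_integral => t _; congr EFin; rewrite !indicE; congr nat_of_bool;
    apply/idP/idP; rewrite !inE.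
have mT : measurable (TS : set (borel M2)).
  by apply: measurable_closed; exact: closed_torus TN.
rewrite integral_indic//; last first.
  apply: measurable_closed.
  exact: (continuous_closedP _).1 (@mulmx_continuousr _ _ (rep c)) _ closed_integral_mx.
rewrite -coset_torus_SL2O indicE.
have [cK|cK] := pselect ((coset TS @` torus_SL2O) c).
  rewrite mem_set//; have := cK.
  move=> /(mem_coset_image_rep TS1 TSM TSV c saturated_torus_SL2O)[t [k [tt kk cE]]].
  rewrite -(muT_translate tt); congr (muT _); apply/seteqP.
  have kO := SL2O_GL2O kk; have [kI _] := kO; have [kVI _] := GL2O_inv kO.
  split=> u [].
    rewrite /X/= cE mulmxA => uI uT; split=> //.
    apply/(torusO_integral TN tau_gen T1 N1); split; first exact: TSM.
    by rewrite -[_ *m _](mulmxK (GL2O_unit kO)); exact: integral_mxM.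
  move=> uT /(torusO_integral TN tau_gen T1 N1)[_ uI]; split => //.
  by rewrite /X/= cE mulmxA; exact: integral_mxM.
rewrite memNset// (_ : X `&` TS = set0) ?measure0//.
apply/seteqP; split=> // t [ti tt]; case: cK.
apply/(mem_coset_image_rep TS1 TSM TSV c saturated_torus_SL2O).
have [tu tV] := TSV tt.
exists (invmx t), (t *m rep c); split => //; last by rewrite mulKmx.
split; last exact: ti.
exact: SL2_mul (torus_SL2 tt) cs.
Qed.

Lemma nu_coset_SL2O : nu (coset TS @` SL2O) = 1%E.
Proof.
have mS : measurable (SL2 : set (borel M2)) by apply: measurable_closed; exact: closed_SL2.
have := nu_quotient (phi := \1_[set x : M2 | integral_mx x]).
rewrite (integral_indic muG mS); last first.
  by apply: measurable_closed; exact: closed_integral_mx.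
rewrite -SL2OE muG_norm => h.
transitivity (\int[nu]_(c in @cosets R F TS SL2)
    (\1_(coset TS @` SL2O) (c : coset_space TS))%:E)%E.
  rewrite (integral_indic nu measurable_cosets_SL2 measurable_coset_SL2O) setIidl//.
  by move=> _ [x [xs _] <-]; exists x.
rewrite h; last 2 first.
- by apply: continuous_subspaceT => x; exact: continuous_integral_indic.
- exists SL2O; split; first exact: compact_SL2O ps.
    by move=> x [].
  by move=> x sx nx; rewrite indicE memNset// => xi; exact: nx.
by apply: eq_integral => c; rewrite inE => /inner_integral ->.
Qed.

Lemma saturated_level n : saturated TG (level n).
Proof.
move=> h x /(torusGLP TN)[a [b [n0 ->]]].
by move=> /(level_mull p n x n0).
Qed.

(** Level 0 is $\widetilde T(F)K$, so its cosets are those of elements of $K$, whose mass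
    [mu_extends] takes over from [nu]. *)
Lemma mu_coset_level0 : mu (coset TG @` level 0) = 1%E.
Proof.
rewrite -nu_coset_SL2O -(mu_extends measurable_coset_SL2O); last first.
  by move=> _ [x [xs _] <-]; exists x.
congr (mu _); apply/seteqP; split=> _ [x xl <-].
  have [a [b [k [n0 kk ->]]]] := level0_torus_SL2O ps T1 N1 type xl.
  exists k; first by split; [case: kk|exists k].
  apply/esym/(coset_eqP TG1 TGM TGV); exists (torus_mx T N a b) => //.
  by apply/(torusGLP TN); exists a, b.
case: xl => xs; rewrite -coset_torus_SL2O.
move=> /(mem_coset_image TS1 TSM TSV x saturated_torus_SL2O)[t [k [tt kk ->]]].
exists (t *m k) => //; case: tt => /(torusGLP TN)[a [b [n0 ->]]] _.
exact: torus_SL2O_level0.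
Qed.

Local Notation V X := (mu (coset TG @` X)).

Lemma mu_right_translate (X : set M2) (g : M2) : saturated TG X -> open X ->
  X `<=` GL2 -> g \in unitmx -> V [set x *m g | x in X] = V X.
Proof.
move=> sX oX XG gu; rewrite -(mu_invariant (A := coset TG @` X : set (borel _)) gu).
- by congr (mu _); rewrite /right_translate (preimage_coset_image TG1 TGM TGV sX).
- by apply: measurable_open; exact: open_coset_image.
- by move=> _ [x /XG xg <-]; exists x.
Qed.

Lemma measurable_coset_open (X : set M2) : saturated TG X -> open X ->
  measurable (coset TG @` X : set (borel (coset_space TG))).
Proof. by move=> sX oX; apply: measurable_open; exact: open_coset_image. Qed.

(* Oriented edges of the tree, with prescribed levels at both ends; counting them
   from either end relates the measures of two consecutive levels. *)
Definition level_edge m n : set M2 := [set x | level m x /\ level n (x *m up_mx p)].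

Lemma saturated_level_edge m n : saturated TG (level_edge m n).
Proof.
by move=> h x hh [l1 l2]; split; rewrite -?mulmxA; exact: saturated_level.
Qed.

Lemma open_level_edge m n : open (level_edge m n).
Proof.
apply: openI; first exact: open_level.
exact: (continuousP _).1 (@mulmx_continuousr _ _ (up_mx p)) _ (@open_level R F p T N n).
Qed.

Lemma level_edge_GL2 m n : level_edge m n `<=` GL2.
Proof. by move=> x [/level_unit]. Qed.

(** Right translation by [r] preserves the level of [x] and turns the edge through [r] into the
    standard one. *)
Lemma mu_level_edge_translate m n (r : M2) : GL2O r ->
  V [set x | level m x /\ level n (x *m r *m up_mx p)] = V (level_edge m n).
Proof.
move=> rO; have ru := GL2O_unit rO.
rewrite -(@mu_right_translate (level_edge m n) (invmx r)).
- congr (mu (_ @` _)); apply/seteqP; split=> [x [l1 l2]|_ [x [l1 l2] <-]].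
    exists (x *m r); last by rewrite mulmxK.
    by split=> //; exact: level_mulr.
  split; last by rewrite mulmxKV.
  by apply: level_mulr => //; exact: GL2O_inv.
- exact: saturated_level_edge.
- exact: open_level_edge.
- exact: level_edge_GL2.
- by rewrite unitmx_inv.
Qed.

Local Notation J := (seq_sub s).
Local Open Scope ereal_scope.

(** An element of level [m] lies in exactly [k] of the $q+1$ sets [X r], one for each neighbour, and
    each of these sets has the mass of [level_edge m n]. *)
Lemma mu_level_edge_count m n (k : R) : (0 <= k)%R ->
  (forall x, level m x -> (`[< level n (x *m weyl_mx *m up_mx p) >] +
     #|[pred j : J | `[< level n (x *m lower_mx (ssval j) *m up_mx p) >]]|)%N%:R = k) ->
  V (level_edge m n) + \sum_(j : J) V (level_edge m n) = k%:E * V (level m).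
Proof.
move=> k0 count.
pose X (r : M2) := [set x | level m x /\ level n (x *m r *m up_mx p)].
have sX r : saturated TG (X r).
  by move=> h x hh [l1 l2]; split; rewrite -?mulmxA ?mulmxA; [exact: saturated_level|
    rewrite -!mulmxA; apply: saturated_level; rewrite // mulmxA].
have oX r : open (X r).
  apply: openI; first exact: open_level.
  have := (continuousP _).1 (@mulmx_continuousr R F (r *m up_mx p)) _ (@open_level R F p T N n).
  by congr open; apply/seteqP; split => x; rewrite /preimage/= mulmxA.
have -> : \sum_(j : J) V (level_edge m n) = \sum_(j : J) V (X (lower_mx (ssval j))).
  apply: eq_bigr => j _; apply/esym/mu_level_edge_translate.
  by apply: GL2O_lower; exact: residue_int ps j.
have <- : V (X weyl_mx) = V (level_edge m n).
  by apply: mu_level_edge_translate; exact: GL2O_weyl.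
have mX r : measurable (coset TG @` X r : set (borel (coset_space TG))).
  exact: measurable_coset_open.
have sl := @saturated_level m.
have mA : measurable (coset TG @` level m : set (borel (coset_space TG))).
  by apply: measurable_coset_open => //; exact: open_level.
apply: (measure_multiplicity mu (Z := fun j : J => coset TG @` X (lower_mx (ssval j)))) => // c.
have memX r : (\1_(coset TG @` X r) c : R) =
    (`[< level m (rep c) /\ level n (rep c *m r *m up_mx p) >])%:R.
  rewrite indicE; congr (nat_of_bool _)%:R; apply/idP/asboolP; rewrite inE.
    by move=> /(mem_coset_image_rep TG1 TGM TGV c (sX r)).
  by move=> h; apply/(mem_coset_image_rep TG1 TGM TGV c (sX r)).
rewrite memX; under eq_bigr do rewrite memX.
have [lc|lc] := pselect (level m (rep c)); last first.
  rewrite asboolF; last by case.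
  rewrite big1 ?addr0 => [|j _]; last by rewrite asboolF// => -[].
  rewrite indicE memNset ?mulr0// => /(mem_coset_image_rep TG1 TGM TGV c sl).
  exact: lc.
rewrite indicE mem_set; last by apply/(mem_coset_image_rep TG1 TGM TGV c sl).
rewrite mulr1 -(count _ lc) natrD; congr (_ + _)%R.
  by congr (nat_of_bool _)%:R; apply/asboolP/asboolP => [[]|].
rewrite -sum1_card natr_sum [RHS]big_mkcond/=; apply: eq_bigr => j _.
rewrite inE; case: asboolP => [[_ h]|h]; case: asboolP => // h'.
by case: h.
Qed.

(** [up_mx p *m weyl_mx] reverses edges: it leads to the neighbouring lattice, and its square is the
    scalar [p], a homothety. *)
Lemma mu_level_edge_flip n : V (level_edge n.+1 n) = V (level_edge n n.+1).
Proof.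
have wO := @GL2O_weyl R F; have wu := GL2O_unit wO; have uu := up_mx_unit ps.
have p0 := unif_neq0 ps.
have sq x : x *m (up_mx p *m weyl_mx) *m (up_mx p *m weyl_mx) = p *: x.
  rewrite -mulmxA -mul_mx_scalar; congr (_ *m _).
  by rewrite !mx22M scalar_mx22; congr mx22; ring.
have ww : weyl_mx *m weyl_mx = 1%:M :> M2.
  by rewrite mx22M scalar_mx22; congr mx22; ring.
have flip x : x *m (up_mx p *m weyl_mx) *m up_mx p = p *: (x *m weyl_mx).
  by rewrite scalemxAl -sq -[RHS]mulmxA -[X in _ = _ *m X]mulmxA ww mulmx1.
rewrite -(@mu_right_translate (level_edge n n.+1) (up_mx p *m weyl_mx)).
- congr (mu (_ @` _)); apply/seteqP; split=> [x [l1 l2]|_ [x [l1 l2] <-]]; last first.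
    split; first by rewrite mulmxA; exact: level_mulr.
    by rewrite flip; apply: level_scale => //; exact: level_mulr.
  exists (p^-1 *: (x *m (up_mx p *m weyl_mx))); last first.
    by rewrite -scalemxAl sq scalerA mulVf// scale1r.
  split; first by apply: level_scale; rewrite ?invr_eq0// mulmxA; exact: level_mulr.
  by rewrite -scalemxAl flip scalerA mulVf// scale1r; exact: level_mulr.
- exact: saturated_level_edge.
- exact: open_level_edge.
- exact: level_edge_GL2.
- by rewrite unitmx_mul uu.
Qed.

End QuotientMeasures.

(** * The orbital integral at regular elements *)

Section OrbitalIntegral.
Context {R : realType} {F : naLocalFieldType R} {E : comUnitAlgType F}.
Local Notation M2 := 'M[F]_2.
Variables (conj : {lrmorphism E -> E}) (tau : E) (p : F) (s : seq F) (T N : F) (kap : R).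
Hypothesis ps : uniformizer_residues p s.
Hypothesis TN : quadratic_basis conj tau T N.
Hypothesis tau_gen : integral_generator conj tau.
Hypotheses (T1 : absF T <= 1) (N1 : absF N <= 1) (type : unramified_type T N kap).
Hypothesis disc1 : absF (T ^+ 2 - 4%:R * N) = 1.
Hypothesis eps_unif : forall a n, absF a = absF p ^+ n -> eps conj a = kap ^+ n.
Hypothesis eps_split : kap = 1 -> forall a, a != 0 -> eps conj a = 1 :> R.
Variables (muG muT : {measure set (borel M2) -> \bar R})
  (nu : {measure set (borel (coset_space (torus tau))) -> \bar R})
  (mu : {measure set (borel (coset_space (torusGL tau))) -> \bar R}).
Hypotheses (muG_norm : muG SL2O = 1%E)
  (muT_haar : is_haar (torus tau) muT) (muT_norm : muT (torusO conj tau) = 1%E)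
  (nu_quotient : is_quotient_measure SL2 muG muT nu)
  (mu_extends : extends_measure SL2 nu mu)
  (mu_invariant : right_invariant GL2 mu).
Local Notation TG := (torusGL tau).
Local Notation pi := (absF p).
Local Notation level := (level p T N).
Local Notation V X := (mu (coset TG @` X)).
Local Notation q := ((size s)%:R : R).

Let TG1 := torusGL1 TN.
Let TGM := torusGLM TN.
Let TGV := torusGLV TN.

Lemma unramified_sign : kap * kap = 1.
Proof. by case: type => -[-> _]; rewrite ?mulrNN mulr1. Qed.

(** Both sides are $q+1$ times the mass of the edges between the two levels, counted from above on
    the left and from below on the right. *)
Lemma mu_coset_levelS n (k : R) : 0 <= k ->
  (forall x, level n x -> (up_neighbours p s T N n x)%:R = k) ->
  V (level n.+1) = (k%:E * V (level n))%E.
Proof.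
move=> k0 up; rewrite -(mu_level_edge_count ps TN mu_invariant k0 up).
have down x : level n.+1 x -> (down_neighbours p s T N n x)%:R = 1 :> R.
  by move=> lx; rewrite (down_neighboursS ps T1 N1 lx).
have := mu_level_edge_count ps TN mu_invariant ler01 down.
by rewrite mul1e (mu_level_edge_flip ps TN mu_invariant) => <-.
Qed.

(** With [q] the residue cardinality and [kap] the sign of [E], this is the index of the unit group
    of $O_F+p^nO_E$ in that of $O_E$. *)
Definition level_mass (q kap : R) n := if n is m.+1 then (q - kap) * q ^+ m else 1.

Lemma mu_coset_level n : V (level n) = (level_mass q kap n)%:E.
Proof.
have q1 : 1 < q by rewrite ltr1n (residue_card_gt1 ps).
have qk : 0 <= q - kap.
  case: type => -[-> _]; first by rewrite subr_ge0 ltW.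
  by rewrite opprK addr_ge0// ?ler01.
elim: n => [|[|n] IH].
- exact: (mu_coset_level0 ps TN tau_gen T1 N1 type muG_norm muT_haar muT_norm
    nu_quotient mu_extends).
- rewrite (mu_coset_levelS qk); last by move=> x lx; rewrite (up_neighbours0 ps type lx).
  by rewrite IH -EFinM /level_mass expr0.
- rewrite (@mu_coset_levelS n.+1 q) ?ler0n//; last first.
    by move=> x /(up_neighboursS ps T1 N1) ->.
  by rewrite IH -EFinM /level_mass exprS mulrCA.
Qed.

(** Telescopes: as $\kappa^2=1$ for $\kappa=$ [kap], the term of index $n>0$ is $(\kappa
    r)^n-(\kappa r)^{n-1}$. *)
Lemma sum_level_mass (r : R) m :
  \sum_(0 <= n < m.+1) kap ^+ n * level_mass r kap n = (kap * r) ^+ m.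
Proof.
elim: m => [|m IH]; first by rewrite big_nat1 expr0 mulr1.
rewrite big_nat_recr//= IH !exprMn !exprS.
rewrite (_ : kap * kap ^+ m * ((r - kap) * r ^+ m) =
  kap * kap ^+ m * (r * r ^+ m) - kap * kap * (kap ^+ m * r ^+ m)); last by ring.
by rewrite unramified_sign mul1r addrC subrK.
Qed.

(** On level [n] the integrand is [kap ^+ n] if $n\le m$ and 0 otherwise, hence a finite combination
    of indicators. *)
Lemma orbital_integral_torusO a b m : norm_form T N a b = 1 -> absF a <= 1 ->
  absF b = pi ^+ m ->
  orbital_integral conj mu (torus_mx T N a b) \1_SL2O = ((kap * q) ^+ m)%:E.
Proof.
move=> n1 a1 bm.
have sl n := @saturated_level _ _ _ _ _ p _ _ TN n.
have mG : measurable (@cosets R F TG GL2 : set (borel (coset_space TG))).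
  apply: measurable_open; apply: (open_coset_image TG1 TGM TGV); last exact: open_GL2.
  by move=> h x /TGV[hu _] xu; rewrite /GL2/= unitmx_mul hu.
have mA n : measurable (coset TG @` level n : set (borel (coset_space TG))).
  apply: measurable_open; apply: (open_coset_image TG1 TGM TGV) => //.
  exact: open_level.
rewrite -sum_level_mass -sumEFin.
under [RHS]eq_bigr do rewrite EFinM -mu_coset_level.
rewrite -(@integral_simple _ _ _ mu _ _ _ _ mG mA); last 2 first.
- by move=> n _ [x /level_unit xu <-]; exists x.
- by move=> n; rewrite mu_coset_level ltry.
apply: eq_integral => c; rewrite inE => cG; congr EFin.
have xu : GL2 (rep c).
  apply/(mem_coset_image_rep TG1 TGM TGV c) => //.
  by move=> h x /TGV[hu _] xu; rewrite /GL2/= unitmx_mul hu.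
have [n0 ln0] := level_exists ps T N xu.
have memA n : (\1_(coset TG @` level n) c : R) = (n == n0)%:R.
  rewrite indicE; congr (nat_of_bool _)%:R; apply/idP/eqP; rewrite inE.
    by move=> /(mem_coset_image_rep TG1 TGM TGV c (sl n)) ln; exact: level_inj ln ln0.
  by move=> ->; apply/(mem_coset_image_rep TG1 TGM TGV c (sl n0)).
under eq_bigr do rewrite memA.
rewrite (level_eps ps T1 N1 type TN eps_unif eps_split ln0) indicE.
have -> : (invmx (rep c) *m torus_mx T N a b *m rep c \in SL2O) = (n0 <= m)%N.
  by apply/idP/idP; rewrite inE => /(SL2O_conj_torus ps ln0 n1 a1 bm).
case: leqP => nm.
  rewrite (bigD1_seq n0) ?mem_index_iota ?iota_uniq//= eqxx big1 ?addr0//.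
  by move=> n /negbTE ->; rewrite mulr0.
rewrite big_nat_cond big1 ?mulr0// => n /andP[/andP[_ nm'] _].
by rewrite (_ : (n == n0) = false) ?mulr0//; apply/eqP => e; move: nm; rewrite -e; lia.
Qed.

Lemma orbital_integral_nonintegral a b : norm_form T N a b = 1 ->
  ~ torusO conj tau (torus_mx T N a b) ->
  orbital_integral conj mu (torus_mx T N a b) \1_SL2O = 0%E.
Proof.
move=> n1 nO; apply: integral0_eq => c cG.
have xu : GL2 (rep c).
  apply/(mem_coset_image_rep TG1 TGM TGV c) => //.
  by move=> h x /TGV[hu _] xu; rewrite /GL2/= unitmx_mul hu.
rewrite indicE memNset ?mulr0// => -[_ int]; apply: nO.
have [a1 b1] := integral_conj_torus T1 N1 type xu n1 int.
by apply/(torusOP TN tau_gen T1); exists a, b.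
Qed.

Lemma transfer_regular (g : E) : torus tau (mulmat tau g) ->
  mulmat tau g <> 1%:M -> mulmat tau g <> - 1%:M ->
  ((transfer_factor conj tau g)%:E * orbital_integral conj mu (mulmat tau g) \1_SL2O =
   (\1_(torusO conj tau) (mulmat tau g))%:E)%E.
Proof.
case: (TN) => _ _ /(_ g)[a [b ->]] _.
rewrite (mulmat_basis TN) (transfer_factorE TN disc1) => -[_].
rewrite /SL2/= det_torus_mx => n1 np nm.
(* With $b=0$ the norm is $a^2=1$, and the element would be 1 or $-1$. *)
have b0 : b != 0.
  apply/eqP => b0; move: n1 np nm; rewrite b0 /norm_form /torus_mx.
  rewrite expr0n/= !mulr0 !addr0 oppr0 scalar_mx22 oppmx22 oppr0 => /eqP.
  by rewrite sqrf_eq1 => /orP[/eqP -> []|/eqP -> _ []].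
have [tO|tO] := pselect (torusO conj tau (torus_mx T N a b)); last first.
  by rewrite orbital_integral_nonintegral// mule0 indicE memNset.
have /(torusOP TN tau_gen T1)[a' [b' [_ a1 b1 /mx22_inj[ea _ eb _]]]] := tO.
rewrite -ea -eb in a1 b1.
have [m bm] := absF_le1_valuation ps b0 b1.
rewrite (orbital_integral_torusO n1 a1 bm) (eps_unif bm) bm -EFinM indicE mem_set//.
(* As $q=|p|^{-1}$ and [kap] is a sign, each of the [m] factors is 1. *)
congr EFin; rewrite -!exprMn (residue_card_inv ps).
rewrite (_ : kap * pi * (kap * pi^-1) = 1) ?expr1n//.
have p0 : pi != 0 by rewrite absF_neq0 (unif_neq0 ps).
by rewrite mulrACA unramified_sign divff// mulr1.
Qed.

End OrbitalIntegral.

(** * Smooth transfer *)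

Section SmoothTransfer.
Context {R : realType} {F : naLocalFieldType R} {E : comUnitAlgType F}.
Local Notation M2 := 'M[F]_2.
Variables (conj : {lrmorphism E -> E}) (tau : E) (p : F) (s : seq F) (T N : F).
Hypothesis ps : uniformizer_residues p s.
Hypothesis TN : quadratic_basis conj tau T N.
Hypothesis tau_gen : integral_generator conj tau.
Hypotheses (T1 : absF T <= 1) (N1 : absF N <= 1).
Hypothesis disc1 : absF (T ^+ 2 - 4%:R * N) = 1.
Local Notation pi := (absF p).

Lemma torusO_locally_constant (t : M2) : torus tau t ->
  \forall u \near t, torus tau u ->
    \1_(torusO conj tau) u = \1_(torusO conj tau) t :> R.
Proof.
move=> tt; have tOP := torusO_integral TN tau_gen T1 N1.
have [ti|ti] := pselect (integral_mx t).
  have : nbhs t [set y : M2 | integral_mx y].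
    by apply: open_nbhs_nbhs; split => //; exact: open_integral_mx.
  by apply: filterS => u ui tu; rewrite !indicE !mem_set//; apply/tOP.
have : nbhs t (~` [set y : M2 | integral_mx y]).
  by apply: open_nbhs_nbhs; split => //; rewrite openC; exact: closed_integral_mx.
by apply: filterS => u ui tu; rewrite !indicE !memNset// => /tOP[].
Qed.

(** One of two consecutive powers of [p] will do: if $2+Tc$ vanished for both, then $T$ and 2 would
    be 0 in [F], and the discriminant with them. *)
Lemma small_regular_parameter (e : R) : 0 < e ->
  exists c : F, [/\ c != 0, absF c < e, absF c < 1 & 2%:R + T * c != 0].
Proof.
move=> e0; have p0 := unif_neq0 ps; have p1 := unif_lt1 ps; have pi0 := unif_gt0 ps.
have [n ne] := unif_expn_small ps e0.
have small k : (n < k)%N -> absF (p ^+ k) < e /\ absF (p ^+ k) < 1.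
  move=> nk; rewrite absFX; split; last by case: k nk => // k _; rewrite exprn_ilt1.
  by apply: le_lt_trans ne; rewrite ler_wiXn2l ?(ltW p1) ?(ltnW nk).
have [e1|] := eqVneq (2%:R + T * p ^+ n.+1) 0; last first.
  move=> h; have [he h1] := small n.+1 (ltnSn n).
  by exists (p ^+ n.+1); split; rewrite ?expf_neq0.
have [he h1] := small n.+2 (ltnW (ltnSn n.+1)).
exists (p ^+ n.+2); split=> //; first by rewrite expf_neq0.
apply/eqP => e2; have : T * (p ^+ n.+1 * (1 - p)) = 0.
  transitivity ((2%:R + T * p ^+ n.+1) - (2%:R + T * p ^+ n.+2)); last by rewrite e1 e2 subrr.
  by rewrite (exprS p n.+1); ring.
have p1' : 1 - p != 0.
  by rewrite subr_eq0; apply/eqP => e3; move: p1; rewrite -e3 absF1 ltxx.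
move/eqP; rewrite !mulf_eq0 (negbTE p1') orbF expf_eq0/= (negbTE p0) orbF => /eqP T0.
have two : 2%:R = 0 :> F by rewrite -e1 T0 mul0r addr0.
move: disc1; rewrite (_ : _ - _ = 0) ?absF0; last first.
  rewrite (_ : 4%:R = 2%:R * 2%:R); last by rewrite -natrM.
  by rewrite two T0; ring.
by move/esym/eqP; rewrite oner_eq0.
Qed.

(* The element is sg * z / conj z for z = 1 + c tau, with c small. *)
Lemma regular_near_sign (sg : F) (A : set M2) : sg ^+ 2 = 1 -> nbhs (sg%:M : M2) A ->
  exists a b, [/\ norm_form T N a b = 1, b != 0 & A (torus_mx T N a b)].
Proof.
move=> sg2 /nbhs_mxP[e e0 eA]; have [c [c0 ce c1 c2]] := small_regular_parameter e0.
have sg1 : absF sg = 1 by apply: absF_sqr1; rewrite sg2 absF1.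
have sg0 : sg != 0 by rewrite -(@absF_neq0 R) sg1 oner_neq0.
pose D := 1 + (T + N * c) * c.
have D1 : absF D = 1.
  apply: (@absF_near_unit _ _ 1); first exact: absF1.
  rewrite /D addrC addKr absFM_lt1r// absF_le// absFM_le1//; exact: ltW.
have D0 : D != 0 by rewrite -(@absF_neq0 R) D1 oner_neq0.
(* $z/\overline z=z^2/N(z)$ with $z^2=(1-Nc^2)+c(2+Tc)\tau$, and [D] is $N(z)$. *)
pose a := (1 - N * c ^+ 2) / D; pose b := c * (2%:R + T * c) / D.
have n1 : norm_form T N (sg * a) (sg * b) = 1.
  rewrite (_ : norm_form T N (sg * a) (sg * b) = sg ^+ 2 * norm_form T N a b); last first.
    by rewrite /norm_form; ring.
  by rewrite sg2 mul1r /norm_form /a /b /D; field.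
exists (sg * a), (sg * b); split=> //.
  by rewrite !mulf_neq0 ?invr_eq0.
have cle : absF c <= 1 := ltW c1.
have two1 : absF (2%:R : F) <= 1 := absF_nat 2.
(* All four entries of the difference to the scalar matrix have this shape. *)
have bound (z : F) : absF z <= 1 -> absF (sg * (c * z / D)) < e.
  move=> z1; rewrite !absFM sg1 mul1r absFV D1 invr1 mulr1.
  by apply: le_lt_trans ce; rewrite ler_piMr.
have u1 : absF (T + 2%:R * N * c) <= 1.
  by apply: absF_le => //; do 2 apply: absFM_le1 => //.
have u2 : absF (2%:R + T * c) <= 1 by apply: absF_le => //; exact: absFM_le1.
apply: eA; rewrite scalar_mx22 /torus_mx.
do 2 apply: ord2P; rewrite !mx22E.
- rewrite (_ : _ - _ = sg * (c * (T + 2%:R * N * c) / D)); last first.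
    by rewrite /a /D; field.
  exact: bound.
- rewrite (_ : _ - _ = sg * (c * (N * (2%:R + T * c)) / D)); last first.
    by rewrite /b; field.
  by apply: bound; exact: absFM_le1.
- rewrite (_ : _ - _ = sg * (c * - (2%:R + T * c) / D)); last by rewrite /b; field.
  by apply: bound; rewrite absFN.
- rewrite (_ : _ - _ = sg * (c * ((T + 2%:R * N * c) - T * (2%:R + T * c)) / D)); last first.
    by rewrite /a /b /D; field.
  by apply: bound; apply: absF_leB => //; exact: absFM_le1.
Qed.

Lemma torus_mx_regular a b : b != 0 ->
  torus_mx T N a b <> 1%:M /\ torus_mx T N a b <> - 1%:M.
Proof.
by move=> /eqP b0; split; rewrite scalar_mx22 ?oppmx22 => /mx22_inj[_ _]; rewrite ?oppr0.
Qed.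

End SmoothTransfer.

Theorem mainTheorem2 (R : realType) (F : naLocalFieldType R)
  (E : comUnitAlgType F) (conj : {lrmorphism E -> E}) (tau : E)
  (muG muT : {measure set (borel 'M[F]_2) -> \bar R})
  (nu : {measure set (borel (coset_space (torus tau))) -> \bar R})
  (mu : {measure set (borel (coset_space (torusGL tau))) -> \bar R})
  (E_unramified : unramified_quadratic conj)
  (tau_gen : integral_generator conj tau)
  (muG_haar : is_haar SL2 muG) (muG_norm : muG SL2O = 1%E)
  (muT_haar : is_haar (torus tau) muT) (muT_norm : muT (torusO conj tau) = 1%E)
  (nu_quotient : is_quotient_measure SL2 muG muT nu)
  (mu_extends : extends_measure SL2 nu mu)
  (mu_invariant : right_invariant GL2 mu) :
  forall fE : 'M[F]_2 -> R,
    is_smooth_transfer conj mu \1_SL2O fE <->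
    {in torus tau, fE =1 \1_(torusO conj tau)}.
Proof.
have [p [s ps]] : exists p s, uniformizer_residues p s := @absF_residue R F.
have [T [N [kap [[T1 N1 TN disc1 type] [eps_unif eps_split]]]]] :=
  unramified_data ps tau_gen E_unramified.
have regular := transfer_regular ps TN tau_gen T1 N1 type disc1 eps_unif eps_split
  muG_norm muT_haar muT_norm nu_quotient mu_extends mu_invariant.
have basis_torus a b : norm_form T N a b = 1 -> torus tau (torus_mx T N a b).
  by move=> n1; apply/(torusP TN); exists a, b.
move=> fE; split=> [[loc_const eq_regular] t|eq_torus]; last first.
  have fEO u : torus tau u -> fE u = \1_(torusO conj tau) u.
    by move=> tu; apply: eq_torus; rewrite inE.
  split=> [t tt|g gu tg np nm]; last by rewrite fEO// regular.
  apply: filterS (torusO_locally_constant TN tau_gen T1 N1 tt) => u uE tu.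
  by rewrite !fEO// uE.
rewrite inE => tt.
have reg a b : norm_form T N a b = 1 -> torus_mx T N a b <> 1%:M ->
    torus_mx T N a b <> - 1%:M ->
    fE (torus_mx T N a b) = \1_(torusO conj tau) (torus_mx T N a b).
  rewrite -(mulmat_basis TN) => n1 np nm; apply: EFin_inj.
  have gt : torus tau (mulmat tau (a%:A + b *: tau)).
    by rewrite (mulmat_basis TN); exact: basis_torus.
  by rewrite eq_regular// ?regular// (unit_normEF TN) (normEF_basis TN) n1 oner_neq0.
have sign (sg : F) : sg ^+ 2 = 1 -> t = sg%:M -> fE t = \1_(torusO conj tau) t.
  (* Both local constancies are recorded in one neighbourhood, so that a single regular element
     compares the two values at [t]. *)
  move=> sg2 tE; have near : nbhs (sg%:M : 'M[F]_2) [set u |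
      (torus tau u -> fE u = fE t) /\
      (torus tau u -> \1_(torusO conj tau) u = \1_(torusO conj tau) t :> R)].
    rewrite -tE; apply: filterI; first exact: loc_const.
    exact (torusO_locally_constant TN tau_gen T1 N1 tt).
  have [a [b [n1 b0 [h1 h2]]]] := regular_near_sign ps T1 N1 disc1 sg2 near.
  have [r1 r2] := @torus_mx_regular _ _ T N a b b0.
  by rewrite -h1 ?reg ?h2//; exact: basis_torus.
have [a [b [n1 tE]]] := (torusP TN t).1 tt.
have [t1|t1] := pselect (t = 1%:M); first by apply: (sign 1); rewrite ?expr1n.
have [t2|t2] := pselect (t = - 1%:M).
  by apply: (sign (-1)); rewrite ?sqrrN ?expr1n// t2 raddfN.
by rewrite tE reg// -tE.
Qed.
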